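(* For every $k\in\mathbb{Z}$, $C_{L,k} = H^0(W_L,\mathcal{O}(1,\dots,1)(k\alpha))$ as subspaces of $\operatorname{Sym}L^*$.
   Context: Let $L$ be a complex vector space of dimension $r$, and let $\ell_1,\dots,\ell_n \in L^*$ be linear forms (possibly zero, possibly proportional) with zero loci $H_1,\dots,H_n$ satisfying $H_1\cap\dots\cap H_n=0$. Set $E=\{1,\dots,n\}$. A flat is a subset $F\subseteq E$ such that if $\bigcap_{i\in F}H_i\subseteq H_j$ then $j\in F$; put $L_F=\bigcap_{i\in F}H_i$. A flat is proper if $F\ne E$. The augmented wonderful variety $W_L$ is the smooth projective variety obtained from $\mathbb{P}(L\oplus\mathbb{C})$ by blowing up the strict transforms of the strata $\mathbb{P}(L_F)$ of the hyperplane at infinity $\mathbb{P}L$, for $F$ a proper flat, in increasing order of dimension. It contains $L$ as an open subset, and $W_L\setminus L$ is a simple normal crossings divisor with irreducible components $D_F$, $F$ a proper flat, where $D_F$ is the strict transform of the exceptional divisor over $\mathbb{P}(L_F)$ (the strict transform of $\mathbb{P}L$ if $L_F=L$). $\alpha$ is the pullback to $W_L$ of the hyperplane class of $\mathbb{P}(L\oplus\mathbb{C})$, and $\mathcal{O}(1,\dots,1)$ is the pullback of $\mathcal{O}(1)^{\boxtimes n}$ under the map $W_L\to(\mathbb{P}^1)^n$ extending $(\ell_1,\dots,\ell_n):L\to\mathbb{C}^n$. One identifies $\mathcal{O}(\alpha)=\mathcal{O}(\sum_F D_F)$ and $\mathcal{O}(1,\dots,1)=\mathcal{O}(\sum_F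 (n-|F|)D_F)$ (sums over proper flats), so $\mathcal{O}(1,\dots,1)(k\alpha)=\mathcal{O}(\sum_F(n-|F|+k)D_F)$. For a divisor $D$ supported on $W_L\setminus L$, $H^0(W_L,\mathcal{O}(D))$ is the space of rational functions $f$ with $\operatorname{div}(f)+D\ge0$ (together with $0$), viewed by restriction to $L$ as a subspace of $\operatorname{Sym}L^*$. For $v\in L$, $\rho(v)$ is the number of $i$ with $v\notin H_i$. $Z_{L,k}=\operatorname{Sym}L/(v^{\rho(v)+k+1}:v\in L\setminus\{0\})$, with $Z_{L,k}=0$ if some nonzero $v$ has $\rho(v)+k+1\le0$. $\operatorname{Sym}L$ acts on $\operatorname{Sym}L^*$ with $v\in L$ acting by the directional derivative; write $f\odot g$. $C_{L,k}\subseteq\operatorname{Sym}L^*$ is the inverse system of the defining ideal $I$ of $Z_{L,k}$, i.e. $C_{L,k}=\{g\in \operatorname{Sym}L^*: f\odot g=0\text{ for all } f\in I\}$. *)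

(* Defs.v *)
From HB Require Import structures.
From mathcomp Require Import all_boot all_order all_algebra.
From mathcomp Require Import mpoly complex.
From mathcomp Require Import boolp classical_sets reals.

Set Implicit Arguments.
Unset Strict Implicit.
Unset Printing Implicit Defensive.

Import GRing.Theory.

Local Open Scope classical_set_scope.
Local Open Scope ring_scope.

(* Integral varieties are represented, after Zariski and Chevalley, by the set
   of the local rings O_{X,x} of all their scheme-theoretic points x, seen as
   subrings of the function field K (a separated integral scheme of finite type
   is determined by this set).  A point is identified with its local ring, an
   irreducible closed subset with the local ring of its generic point.  The
   point x lies in the closure of the point z iff O_{X,x} `<=` O_{X,z}. *)

Definition is_subring (K : fieldType) (A : set K) : Prop :=
  [/\ A 1, forall x y, A x -> A y -> A (x - y)
    & forall x y, A x -> A y -> A (x * y)].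

Definition subring_span (K : fieldType) (S : set K) : set K :=
  [set x | forall A, is_subring A -> S `<=` A -> A x].

Definition ideal_span (A : comNzRingType) (B S : set A) : set A :=
  [set x | exists (m : nat) (b s : 'I_m -> A),
     (forall j, B (b j) /\ S (s j)) /\ x = \sum_(j < m) b j * s j].

Definition is_prime_ideal (K : fieldType) (A P : set K) : Prop :=
  [/\ P `<=` A, P 0 /\ ~ P 1,
      forall x y, P x -> P y -> P (x + y),
      forall a x, A a -> P x -> P (a * x)
    & forall x y, A x -> A y -> P (x * y) -> P x \/ P y].

Definition localization (K : fieldType) (A P : set K) : set K :=
  [set x | exists a b, [/\ A a, A b, ~ P b & x = a / b]].

(* The non-units of A; the first disjunct is needed because 0^-1 = 0. *)
Definition max_ideal (K : fieldType) (A : set K) : set K :=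
  [set x | A x /\ (x = 0 \/ ~ A x^-1)].

Definition dominates (K : fieldType) (B A : set K) : Prop :=
  A `<=` B /\ max_ideal A `<=` max_ideal B.

Definition is_uniformizer (K : fieldType) (A : set K) (p : K) : Prop :=
  [/\ p != 0, max_ideal A p
    & forall x, x != 0 ->
        exists (u : K) (e : int), [/\ A u, A u^-1 & x = u * p ^ e]].

Definition is_dvr (K : fieldType) (A : set K) : Prop :=
  is_subring A /\ exists p, is_uniformizer A p.

Definition has_order (K : fieldType) (A : set K) (x : K) (e : int) : Prop :=
  exists p u, [/\ is_uniformizer A p, u != 0, A u, A u^-1 & x = u * p ^ e].

(* The stalk at the point A of the ideal sheaf of the closure of the point z:
   the unit ideal if A is not in this closure. *)
Definition center_ideal (K : fieldType) (z A : set K) : set K :=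
  [set a | A a /\ (A `<=` z -> max_ideal z a)].

(* The blow-up of X along the closure of z: above the point A, it is covered by
   the spectra of the rings A[I/a], for a a nonzero element of the stalk I at A
   of the ideal sheaf of the center. *)
Definition blowup_chart (K : fieldType) (z A : set K) (a : K) : set K :=
  subring_span (A `|` [set b / a | b in center_ideal z A]).

Definition blowup (K : fieldType) (X : set (set K)) (z : set K) :
    set (set K) :=
  [set B | exists A a P, [/\ X A, center_ideal z A a, a != 0,
     is_prime_ideal (blowup_chart z A a) P
     & B = localization (blowup_chart z A a) P]].

(* The exceptional divisor of the blow-up of X along the closure of z, i.e. the
   prime divisor whose image is the center (the center itself, if that is
   already a divisor).  A strict transform has the same generic local ring as
   the subvariety it comes from, so that no operation on subvarieties is needed
   to pass to further blow-ups. *)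
Definition exceptional_divisor (K : fieldType) (X : set (set K)) (z : set K) :
    set (set K) :=
  [set E | [/\ blowup X z E, is_dvr E & dominates E z]].

(* H^0(X, O(D)) for X normal, where a divisor D is given by its coefficients on
   the prime divisors of X, i.e. on the points of X whose local ring is a
   discrete valuation ring. *)
Definition global_sections (K : fieldType) (X : set (set K))
    (D : set K -> int) : set K :=
  [set f | f != 0 -> forall E, X E -> is_dvr E ->
     forall e, has_order E f e -> 0 <= e + D E].

(* Sym L is the polynomial ring on a basis of L, Sym L^* the polynomial ring on
   the dual basis; both have the type sym_alg L.  sym_vec is the inclusion of L
   in Sym L, and sym_form the inclusion of L^* in Sym L^*. *)
Definition sym_alg (C : fieldType) (L : vectType C) : idomainType :=
  {mpoly C[\dim {:L}]}.

Definition sym_vec (C : fieldType) (L : vectType C) (v : L) : sym_alg L :=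
  \sum_(j < \dim {:L}) coord (vbasis {:L}) j v *: ('X_j : {mpoly C[_]}).

Definition sym_form (C : fieldType) (L : vectType C) (h : 'Hom(L, C^o)) :
    sym_alg L :=
  \sum_(j < \dim {:L}) h (vbasis {:L})`_j *: ('X_j : {mpoly C[_]}).

(* The action of Sym L on Sym L^* by differential operators. *)
Definition sym_act (C : fieldType) (L : vectType C) (f g : sym_alg L) :
    sym_alg L :=
  \sum_(m <- msupp f) f@_m *: mderivm m g.

Definition rat_fun (C : fieldType) (L : vectType C) : fieldType :=
  {fraction (sym_alg L)}.

(* The linear form (v, s) |-> h.1 v + h.2 * s on L (+) C, restricted to the
   open subset s = 1 of P(L (+) C), which is identified with L. *)
Definition hyp_form (C : fieldType) (L : vectType C) (h : 'Hom(L, C^o) * C) :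
    rat_fun L :=
  tofrac (sym_form h.1 + mpolyC _ h.2).

(* The coordinate ring of the complement in P(L (+) C) of the hyperplane
   h = 0. *)
Definition proj_chart (C : fieldType) (L : vectType C)
    (h : 'Hom(L, C^o) * C) : set (rat_fun L) :=
  subring_span ([set tofrac (mpolyC _ c) | c in @setT C]
                `|` range (fun h' => hyp_form h' / hyp_form h)).

Definition proj_space (C : fieldType) (L : vectType C) :
    set (set (rat_fun L)) :=
  [set A | exists h P, [/\ h != 0, is_prime_ideal (proj_chart h) P
     & A = localization (proj_chart h) P]].
Arguments proj_space {C} L.

(* The local ring of P(L (+) C) at the generic point of P(M (+) 0), for M a
   nonzero subspace of L; it can be computed in the complement of any
   hyperplane h = 0 that does not contain P(M (+) 0). *)
Definition stratum (C : fieldType) (L : vectType C) (M : {vspace L}) :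
    set (rat_fun L) :=
  [set x | exists h : 'Hom(L, C^o) * C, ~~ (M <= lker h.1)%VS /\
     localization (proj_chart h)
       (ideal_span (proj_chart h)
          [set hyp_form h' / hyp_form h
            | h' in [set h' : 'Hom(L, C^o) * C | (M <= lker h'.1)%VS]]) x].

Definition flat_space (C : fieldType) (L : vectType C) (n : nat)
    (l : 'I_n -> 'Hom(L, C^o)) (F : {set 'I_n}) : {vspace L} :=
  (\bigcap_(i in F) lker (l i))%VS.

Definition flat (C : fieldType) (L : vectType C) (n : nat)
    (l : 'I_n -> 'Hom(L, C^o)) (F : {set 'I_n}) : bool :=
  [forall j, (flat_space l F <= lker (l j))%VS ==> (j \in F)].

Definition proper_flat (C : fieldType) (L : vectType C) (n : nat)
    (l : 'I_n -> 'Hom(L, C^o)) (F : {set 'I_n}) : bool :=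
  flat l F && (F != [set: 'I_n]%SET).

Definition proper_flats (C : fieldType) (L : vectType C) (n : nat)
    (l : 'I_n -> 'Hom(L, C^o)) : seq {set 'I_n} :=
  sort (fun F G => \dim (flat_space l F) <= \dim (flat_space l G))%N
    [seq F <- enum {set 'I_n} | proper_flat l F].

Definition iterated_blowup (C : fieldType) (L : vectType C) (n : nat)
    (l : 'I_n -> 'Hom(L, C^o)) (s : seq {set 'I_n}) : set (set (rat_fun L)) :=
  foldl (fun X F => blowup X (stratum (flat_space l F))) (proj_space L) s.

Definition wonderful (C : fieldType) (L : vectType C) (n : nat)
    (l : 'I_n -> 'Hom(L, C^o)) : set (set (rat_fun L)) :=
  iterated_blowup l (proper_flats l).

(* The divisor D_F, as the singleton of its generic point: the exceptional
   divisor of the blow-up along the strict transform of P(L_F). *)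
Definition boundary_divisor (C : fieldType) (L : vectType C) (n : nat)
    (l : 'I_n -> 'Hom(L, C^o)) (F : {set 'I_n}) : set (set (rat_fun L)) :=
  exceptional_divisor
    (iterated_blowup l (take (index F (proper_flats l)) (proper_flats l)))
    (stratum (flat_space l F)).

(* The divisor \sum_F c_F D_F. *)
Definition boundary_sum (C : fieldType) (L : vectType C) (n : nat)
    (l : 'I_n -> 'Hom(L, C^o)) (c : {set 'I_n} -> int) (E : set (rat_fun L)) :
    int :=
  \sum_(F : {set 'I_n} | proper_flat l F)
     (if `[< boundary_divisor l F E >] then c F else 0).

(* O(alpha) = O(\sum_F D_F) and O(1,...,1) = O(\sum_F (n - |F|) D_F). *)
Definition alpha_divisor (C : fieldType) (L : vectType C) (n : nat)
    (l : 'I_n -> 'Hom(L, C^o)) : set (rat_fun L) -> int :=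
  boundary_sum l (fun=> 1).

Definition ones_divisor (C : fieldType) (L : vectType C) (n : nat)
    (l : 'I_n -> 'Hom(L, C^o)) : set (rat_fun L) -> int :=
  boundary_sum l (fun F => n%:Z - #|F|%:Z).

Definition rho (C : fieldType) (L : vectType C) (n : nat)
    (l : 'I_n -> 'Hom(L, C^o)) (v : L) : nat :=
  #|[pred i | v \notin lker (l i)]|.

(* A nonpositive exponent is replaced by 0, so that the ideal below is the unit
   ideal as soon as one such exponent occurs. *)
Definition power_exponent (C : fieldType) (L : vectType C) (n : nat)
    (l : 'I_n -> 'Hom(L, C^o)) (k : int) (v : L) : nat :=
  match ((rho l v)%:Z + k + 1)%R with Posz m => m | Negz _ => 0 end.

Definition power_ideal (C : fieldType) (L : vectType C) (n : nat)
    (l : 'I_n -> 'Hom(L, C^o)) (k : int) : set (sym_alg L) :=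
  ideal_span setT
    [set sym_vec v ^+ power_exponent l k v | v in [set v : L | v != 0]].

Definition inverse_system (C : fieldType) (L : vectType C) (n : nat)
    (l : 'I_n -> 'Hom(L, C^o)) (k : int) : set (sym_alg L) :=
  [set g | forall f, power_ideal l k f -> sym_act f g = 0].

(* Main.v *)
(* For a flat F and a linear projection p of L onto L_F, the substitution
   g(x) |-> g((1 - p) x + T p x) has the degree of g along L_F as its T-degree.
   Minus this degree is the valuation of the divisor D_F, so that a polynomial g
   is a section of O(\sum_F c_F D_F) iff its degree along each L_F is at most
   c_F; for c_F = n - |F| + k this says that v^(rho(v) + k + 1) annihilates g
   for v generic in L_F, i.e. that g lies in the inverse system.

   The divisors of W_L are the prime divisors of L and the D_F.  Let E be a
   discrete valuation ring of W_L on which some linear form has a pole.  The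
   center of E on the successive blow-ups stays the localization of an explicit
   ring C[h / y_i, 1 / y_i], where y_1, y_2, ... are forms with the worst pole
   along E among those vanishing on an increasing chain of spaces L_(F_i), and
   F_i is the smallest flat whose stratum contains the center.  On such a ring,
   an element of positive weight for the degree along L_(F_i) is in the ideal
   generated by the obvious elements of positive weight (split off the part of
   weight 0, which cannot have positive valuation).  This identifies the ideal
   of the next center and, at the end of the chain, shows that E is contained
   in, hence equal to, the valuation ring of D_F for the last flat F.

   A rational function without poles on L is a polynomial: after a generic linear
   change of coordinates its denominator is monic in one variable, and it
   suffices to look at the discrete valuation rings given by irreducible
   polynomials over the field of fractions of the other variables. *)

From HB Require Import structures.
Require Import Defs.
From mathcomp Require Import all_boot all_order all_algebra.
From mathcomp Require Import ssrcomplements mpoly complex.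
From mathcomp Require Import boolp classical_sets reals.
From mathcomp Require Import zify ring.

Set Implicit Arguments.
Unset Strict Implicit.
Unset Printing Implicit Defensive.

Import Order.TTheory GRing.Theory Num.Theory.

Local Open Scope classical_set_scope.
Local Open Scope ring_scope.

(** * Local rings and blow-ups in a field *)

Section Subrings.
Context {K : fieldType}.
Implicit Types (A B E R S P X z : set K).

(** Three points carry the weight. (1) Splitting off weight 0 requires one projection [p] for which
    all of y_1, y_2, ... are homogeneous of weight 1, that is y_i o p = y_i. Such a [p] exists onto
    every larger space because the y_i are triangular: y_(i+1) vanishes on L_(F_i) while y_i does
    not, so a rank-one correction adjusts one form without disturbing the earlier ones. (2) Centers
    are governed by inclusions: [cen E R] is the smallest ring that contains R and is dominated by
    E, and a discrete valuation ring is contained in no other one. Most equalities of local rings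
    thus reduce to comparing generators. (3) The generic vectors v of L_F are those with rho(v) = n
    - |F|; the others lie in some smaller L_G and test D_G. Since v^(c + 1) kills the polynomials of
    degree at most c along L_F, the exponent has an extra 1. Characteristic 0 enters twice: the
    integers furnish enough points to avoid the zeros of a polynomial, and the e-th derivative of
    T^i does not vanish for i >= e. *)

Lemma subring1 A : is_subring A -> A 1.
Proof. by case. Qed.

Lemma subringB A x y : is_subring A -> A x -> A y -> A (x - y).
Proof. by case=> _ h _; exact: h. Qed.

Lemma subringM A x y : is_subring A -> A x -> A y -> A (x * y).
Proof. by case=> _ _ h; exact: h. Qed.

Lemma subring0 A : is_subring A -> A 0.
Proof. by move=> h; rewrite -(subrr 1); apply: subringB => //; exact: subring1. Qed.

Lemma subringN A x : is_subring A -> A x -> A (- x).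
Proof. by move=> h Ax; rewrite -sub0r; apply: subringB => //; exact: subring0. Qed.

Lemma subringD A x y : is_subring A -> A x -> A y -> A (x + y).
Proof. by move=> h Ax Ay; rewrite -[y]opprK; apply: subringB => //; exact: subringN. Qed.

Lemma subringX A x k : is_subring A -> A x -> A (x ^+ k).
Proof.
move=> h Ax; elim: k => [|k IH]; first by rewrite expr0; exact: subring1.
by rewrite exprS; exact: subringM.
Qed.

Lemma subring_sum A (I : Type) (r : seq I) (Q : pred I) (F : I -> K) :
  is_subring A -> (forall i, Q i -> A (F i)) -> A (\sum_(i <- r | Q i) F i).
Proof.
move=> h hF; elim/big_ind : _ => //; first exact: subring0.
by move=> x y; exact: subringD.
Qed.

Lemma subring_spanP (S : set K) : is_subring (subring_span S).
Proof.
split=> [A hA _|x y hx hy A hA SA|x y hx hy A hA SA]; first exact: subring1.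
- by apply: subringB => //; [exact: hx | exact: hy].
- by apply: subringM => //; [exact: hx | exact: hy].
Qed.

Lemma sub_subring_span (S : set K) : S `<=` subring_span S.
Proof. by move=> x Sx A _; apply. Qed.

Lemma subring_span_min (S A : set K) : is_subring A -> S `<=` A -> subring_span S `<=` A.
Proof. by move=> hA SA x; apply. Qed.

Lemma max_idealM A a x : is_subring A -> A a -> max_ideal A x -> max_ideal A (a * x).
Proof.
move=> hA Aa [Ax hx]; split; first exact: subringM.
have [->|a0] := eqVneq a 0; first by left; rewrite mul0r.
case: hx => [->|nx]; first by left; rewrite mulr0.
right=> h; apply: nx.
by rewrite -[x^-1](mulfVK a0) -invfM mulrC; apply: subringM => //; rewrite mulrC.
Qed.

Lemma max_ideal0 A : is_subring A -> max_ideal A 0.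
Proof. by move=> hA; split; [exact: subring0 | left]. Qed.

Lemma max_ideal1 A : is_subring A -> ~ max_ideal A 1.
Proof.
by move=> hA [_ [/eqP|]]; [rewrite oner_eq0 | rewrite invr1; apply; exact: subring1].
Qed.

Lemma notin_max_ideal A x : A x -> ~ max_ideal A x -> A x^-1.
Proof. by move=> Ax nx; apply: contrapT => h; apply: nx; split=> //; right. Qed.

Lemma notin_max_ideal_neq0 A x : is_subring A -> ~ max_ideal A x -> x != 0.
Proof. by move=> hA h; apply/eqP => x0; apply: h; rewrite x0; exact: max_ideal0. Qed.

(** The non-units are always stable under multiplication by [A], so stability under sums is the one
    ideal axiom to demand. *)
Definition local_ring A : Prop :=
  is_subring A /\ forall x y, max_ideal A x -> max_ideal A y -> max_ideal A (x + y).

Lemma max_ideal_prime A : local_ring A -> is_prime_ideal A (max_ideal A).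
Proof.
move=> [hA hD]; split=> //.
- by move=> x [].
- by split; [exact: max_ideal0 | exact: max_ideal1].
- by move=> a x Aa mx; exact: max_idealM.
move=> x y Ax Ay [_ mxy].
have [x0|x0] := eqVneq x 0; first by left; rewrite x0; exact: max_ideal0.
have [y0|y0] := eqVneq y 0; first by right; rewrite y0; exact: max_ideal0.
apply: contrapT => /not_orP[nx ny].
case: mxy => [/eqP|]; first by rewrite mulf_eq0 (negbTE x0) (negbTE y0).
by apply; rewrite invfM; apply: subringM => //; exact: notin_max_ideal.
Qed.

Lemma sub_localization A P : is_subring A -> ~ P 1 -> A `<=` localization A P.
Proof. by move=> hA P1 x Ax; exists x, 1; split=> //; [exact: subring1 | rewrite divr1]. Qed.

Lemma prime_neq0 A P x : is_prime_ideal A P -> ~ P x -> x != 0.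
Proof. by move=> [_ [P0 _] _ _ _] Px; apply/eqP => x0; apply: Px; rewrite x0. Qed.

Lemma prime_mul A P x y : is_prime_ideal A P -> A x -> A y -> ~ P x -> ~ P y -> ~ P (x * y).
Proof. by move=> [_ _ _ _ h] Ax Ay Px Py /h []. Qed.

Lemma localization_subring A P :
  is_subring A -> is_prime_ideal A P -> is_subring (localization A P).
Proof.
move=> hA hP; have [_ [P0 P1] _ _ _] := hP.
split; first by apply: sub_localization => //; exact: subring1.
- move=> _ _ [a [b [Aa Ab Pb ->]]] [c [d [Ac Ad Pd ->]]].
  have b0 := prime_neq0 hP Pb; have d0 := prime_neq0 hP Pd.
  exists (a * d - c * b), (b * d); split.
  + by apply: subringB => //; exact: subringM.
  + exact: subringM.
  + exact: (prime_mul hP).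
  + by rewrite -mulNr addf_div // mulNr.
- move=> _ _ [a [b [Aa Ab Pb ->]]] [c [d [Ac Ad Pd ->]]].
  exists (a * c), (b * d); split; [exact: subringM | exact: subringM | | ].
  + exact: (prime_mul hP).
  + by rewrite mulf_div.
Qed.

(* The local ring of Spec R at the center of E. *)
Definition cen E R : set K := localization R (R `&` max_ideal E).

Lemma cen_prime E R :
  local_ring E -> is_subring R -> R `<=` E -> is_prime_ideal R (R `&` max_ideal E).
Proof.
move=> hE hR RE; have [sE _] := hE; have [_ [m0 m1] mD mM mP] := max_ideal_prime hE.
split.
- by move=> x [].
- by split; [split=> //; exact: subring0 | case].
- by move=> x y [Rx mx] [Ry my]; split; [exact: subringD | exact: mD].
- by move=> a x Ra [Rx mx]; split; [exact: subringM | apply: mM => //; exact: RE].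
- by move=> x y Rx Ry [_ /mP]; case; [exact: RE | exact: RE | left | right].
Qed.

Lemma cen_subring E R :
  local_ring E -> is_subring R -> R `<=` E -> is_subring (cen E R).
Proof. by move=> hE hR RE; apply: localization_subring => //; exact: cen_prime. Qed.

Lemma sub_cen E R : local_ring E -> is_subring R -> R `<=` cen E R.
Proof. by move=> [sE _] hR; apply: sub_localization => // -[_]; exact: max_ideal1. Qed.

Lemma cenP E R x : local_ring E -> R `<=` E -> cen E R x ->
  exists p q, [/\ R p, R q, E q^-1, q != 0 & x = p / q].
Proof.
move=> [sE _] RE [p [q [Rp Rq nq ->]]]; exists p, q.
have mq : ~ max_ideal E q by move=> mq; apply: nq.
split=> //; first by apply: notin_max_ideal => //; exact: RE.
exact: notin_max_ideal_neq0 mq.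
Qed.

Lemma cenI E R p q : R p -> R q -> E q^-1 -> q != 0 -> cen E R (p / q).
Proof. by move=> Rp Rq Eq q0; exists p, q; split=> // -[_ [_ [/eqP|//]]]; rewrite (negbTE q0). Qed.

Lemma cen_sub E R : local_ring E -> R `<=` E -> cen E R `<=` E.
Proof.
move=> hE RE x /(cenP hE RE) [p [q [Rp Rq Eq q0 ->]]].
by case: hE => sE _; apply: subringM => //; exact: RE.
Qed.

Lemma cen_unit E R x :
  local_ring E -> is_subring R -> R `<=` E -> cen E R x -> E x^-1 -> cen E R x^-1.
Proof.
move=> hE sR RE /(cenP hE RE) [p [q [Rp Rq Eq q0 ->]]].
have [->|p0] := eqVneq p 0.
  by rewrite mul0r invr0 => _; rewrite -(mul0r q^-1); apply: cenI => //; exact: subring0.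
rewrite invf_div => Eqp; apply: cenI => //.
by rewrite -[p^-1](mulKf q0); case: hE => sE _; apply: subringM.
Qed.

Lemma cen_mono E R S : R `<=` S -> cen E R `<=` cen E S.
Proof.
move=> RS x [p [q [Rp Rq nq ->]]]; exists p, q; split=> //; [exact: RS| exact: RS|].
by case=> _ mq; apply: nq.
Qed.

Lemma cen_dom E R :
  local_ring E -> is_subring R -> R `<=` E -> dominates E (cen E R).
Proof.
move=> hE hR RE; split; first exact: cen_sub.
move=> x [cx hx]; split; first exact: cen_sub cx.
case: hx => [->|nx]; [by left|right=> Ex; apply: nx].
exact: cen_unit.
Qed.

Lemma dom_unit E B x : dominates E B -> B x -> E x^-1 -> x != 0 -> B x^-1.
Proof.
move=> [_ mBE] Bx Ex x0; apply: notin_max_ideal => // mx.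
by have [_ [/eqP|//]] := mBE _ mx; rewrite (negbTE x0).
Qed.

Lemma cen_min E B R :
  local_ring E -> is_subring B -> dominates E B -> R `<=` B -> cen E R `<=` B.
Proof.
move=> hE sB dom RB x /(cenP hE _) [|p [q [Rp Rq Eq q0 ->]]].
  by move=> y /RB; case: dom => h _; exact: h.
by apply: subringM => //; [exact: RB | apply: (dom_unit dom) => //; exact: RB].
Qed.

(** Uniqueness of the center on an affine chart: domination turns elements of [P] into non-units of
    [E] and elements of [R] outside [P] into units, so [P] is the trace of the maximal ideal. *)
Lemma localization_cen E R P : is_subring R -> is_prime_ideal R P ->
  dominates E (localization R P) -> localization R P = cen E R.
Proof.
move=> sR hP [locE mE]; have [PR [P0 P1] PD PM Pp] := hP.
congr localization; apply/seteqP; split=> [b Pb|b [Rb mb]].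
  split; first exact: PR.
  apply: mE; split; first by apply: sub_localization => //; exact: PR.
  have [->|b0] := eqVneq b 0; [by left|right].
  move=> [c [d [Rc Rd Pd e]]].
  have d0 := prime_neq0 hP Pd; apply: Pd.
  have -> : d = c * b.
    by apply: (mulIf (invr_neq0 b0)); rewrite mulfK // e mulrC mulfVK.
  exact: PM.
apply: contrapT => Pb; case: mb => _ [b0|]; first by apply: Pb; rewrite b0.
apply; apply: locE; exists 1, b; split=> //; [exact: subring1 | by rewrite mul1r].
Qed.

Lemma localization_max A : local_ring A -> localization A (max_ideal A) = A.
Proof.
move=> [sA _]; apply/seteqP; split; last first.
  by apply: sub_localization => //; exact: max_ideal1.
by move=> x [a [b [Aa Ab nb ->]]]; apply: subringM => //; exact: notin_max_ideal.
Qed.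

(** This makes projective space and its blow-ups stable under generization. *)
Lemma localization_localization R P Q : is_subring R -> is_prime_ideal R P ->
  is_prime_ideal (localization R P) Q ->
  is_prime_ideal R (R `&` Q) /\
  localization (localization R P) Q = localization R (R `&` Q).
Proof.
move=> sR hP hQ; have [_ [P0 P1] _ _ _] := hP.
have RL : R `<=` localization R P by exact: sub_localization.
have sL := localization_subring sR hP.
have [QL [Q0 Q1] QD QM Qp] := hQ.
split.
  split.
  - by move=> x [].
  - by split; [split=> //; exact: subring0 | case].
  - by move=> x y [Rx mx] [Ry my]; split; [exact: subringD | exact: QD].
  - by move=> a x Ra [Rx mx]; split; [exact: subringM | apply: QM => //; exact: RL].
  - by move=> x y Rx Ry [_ /Qp]; case; [exact: RL | exact: RL | left | right].
apply/seteqP; split; last first.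
  move=> x [a [b [Ra Rb nb ->]]]; exists a, b; split=> //; [exact: RL|exact: RL|].
  by move=> Qb; apply: nb.
move=> x [_ [_ [[a [b [Ra Rb Pb ->]]] [c [d [Rc Rd Pd ->]]] nQ ->]]].
have b0 := prime_neq0 hP Pb; have d0 := prime_neq0 hP Pd.
exists (a * d), (b * c); split; [exact: subringM|exact: subringM| |].
  case=> _ /Qp[]; [exact: RL|exact: RL| |].
  + move=> Qb; apply: Q1; rewrite -(mulVf b0); apply: QM => //.
    by exists 1, b; split=> //; [exact: subring1 | rewrite mul1r].
  + move=> Qc; apply: nQ; rewrite mulrC; apply: QM => //.
    by exists 1, d; split=> //; [exact: subring1 | rewrite mul1r].
by rewrite invf_div mulf_div.
Qed.

End Subrings.

(** * Points of a blow-up and centers on it *)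

Section Blowups.
Context {K : fieldType}.
Implicit Types (A B E R S P z : set K) (X : set (set K)).

(** Stability under generization. It allows a point of [X] to be replaced by the center of [E] on
    its local ring. *)
Definition loc_closed X : Prop := forall A, X A ->
  is_subring A /\ forall P, is_prime_ideal A P -> X (localization A P).

Lemma blowup_chart_subring z A a : is_subring (blowup_chart z A a).
Proof. exact: subring_spanP. Qed.

Lemma sub_blowup_chart z A a : A `<=` blowup_chart z A a.
Proof. by move=> x Ax; apply: sub_subring_span; left. Qed.

Lemma blowup_chart_div z A a b : center_ideal z A b -> blowup_chart z A a (b / a).
Proof. by move=> cb; apply: sub_subring_span; right; exists b. Qed.

Lemma blowup_chart_min z A a R : is_subring R -> A `<=` R ->
  (forall b, center_ideal z A b -> R (b / a)) -> blowup_chart z A a `<=` R.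
Proof. by move=> sR AR h; apply: subring_span_min => // x [/AR//|[b /h hb <-]]. Qed.

Lemma blowup_loc_closed X z : loc_closed (blowup X z).
Proof.
move=> B [A [a [P [XA ca a0 hP ->]]]].
split; first by apply: localization_subring => //; exact: blowup_chart_subring.
move=> Q hQ; have [hP' ->] := localization_localization (blowup_chart_subring z A a) hP hQ.
by exists A, a, (blowup_chart z A a `&` Q).
Qed.

(** The point [A0] over which [B] is presented may be too special for [E] to dominate it. The center
    [A] of [E] on [A0] is dominated by [E], and [B] is still the center of [E] on a chart over
    [A]. *)
Lemma blowup_over E X z B : is_subring z -> local_ring E -> loc_closed X ->
  blowup X z B -> dominates E B ->
  exists A a, [/\ X A /\ is_subring A, dominates E A, center_ideal z A a /\ a != 0,
    blowup_chart z A a `<=` B & B = cen E (blowup_chart z A a)].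
Proof.
move=> sz hE hX [A0 [a [P [XA ca a0 hP eB]]]] dom.
have [sA0 clA0] := hX _ XA.
have sC := blowup_chart_subring z A0 a.
have sB : is_subring B by rewrite eB; exact: localization_subring.
have [_ [P0 P1] _ _ _] := hP.
have CB : blowup_chart z A0 a `<=` B by rewrite eB; exact: sub_localization.
have [BE mBE] := dom.
have A0B : A0 `<=` B by apply: (subset_trans (@sub_blowup_chart z A0 a)).
have A0E : A0 `<=` E by apply: (subset_trans A0B).
have eB' : B = cen E (blowup_chart z A0 a).
  by rewrite eB; apply: localization_cen => //; rewrite -eB.
have hP0 := cen_prime hE sA0 A0E.
pose A := cen E A0.
have sA : is_subring A by exact: cen_subring.
have A0A : A0 `<=` A by exact: sub_cen.
have AB : A `<=` B by apply: cen_min.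
have AE : A `<=` E by apply: (subset_trans AB).
have cA : center_ideal z A a.
  case: ca => Aa ha; split; first exact: A0A.
  by move=> Az; apply: ha; apply: (subset_trans A0A).
have chB : blowup_chart z A a `<=` B.
  apply: blowup_chart_min => // b [Ab hb].
  have [p [q [Ap Aq Eq q0 eb]]] := cenP hE A0E Ab.
  have Bq : B q^-1 by apply: (dom_unit dom) => //; exact: A0B.
  have [Az|nAz] := pselect (A `<=` z).
    have zq : z q by apply: Az; exact: A0A.
    have mp : max_ideal z p.
      have -> : p = q * b by rewrite eb mulrC mulfVK.
      by apply: max_idealM => //; exact: hb.
    have : B (p / a) by apply: CB; apply: blowup_chart_div; split.
    by rewrite eb mulrAC => h; apply: subringM.
  have [A0z|nA0z] := pselect (A0 `<=` z); last first.
    have : B (p / a) by apply: CB; apply: blowup_chart_div; split.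
    by rewrite eb mulrAC => h; apply: subringM.
  (* Here [A0] is in the closure of [z] but [A] is not: some denominator q' of [A] lies in the
     center ideal at [A0] and is a unit of [B], so q' / a in [B] yields a^-1 in [B]. *)
  suff Ba : B a^-1 by apply: subringM => //; exact: AB.
  have [x nAx] : exists x, ~ (A x -> z x) by apply/existsNP.
  have [Ax nzx] : A x /\ ~ z x by apply/not_implyP.
  have [p' [q' [Ap' Aq' Eq' q'0 ex]]] := cenP hE A0E Ax.
  have cq' : center_ideal z A0 q'.
    split=> // _; split; first exact: A0z.
    right=> zq'; apply: nzx; rewrite ex; apply: subringM => //; exact: A0z.
  have Bq'a : B (q' / a) by apply: CB; exact: blowup_chart_div.
  have Bq' : B q'^-1 by apply: (dom_unit dom) => //; exact: A0B.
  by rewrite -(mulKf q'0 a^-1); apply: subringM.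
exists A, a; split=> //.
- by split=> //; exact: clA0.
- exact: cen_dom.
apply/seteqP; split; last exact: cen_min.
rewrite eB'; apply: cen_mono; apply: blowup_chart_min.
- exact: blowup_chart_subring.
- by apply: (subset_trans A0A); exact: sub_blowup_chart.
move=> b [Ab hb]; have [Az|nAz] := pselect (A `<=` z).
  apply: blowup_chart_div; split; first exact: A0A.
  by move=> _; apply: hb; apply: (subset_trans A0A).
by apply: blowup_chart_div; split; first exact: A0A.
Qed.

(** Off the center the ideal is all of [A], so the chart contains 1 / a; by domination [a] was
    already a unit of [A], and the chart adds nothing. *)
Lemma blowup_away E z A B a : local_ring E -> is_subring A -> dominates E A ->
  a != 0 -> ~ (A `<=` z) -> center_ideal z A a ->
  blowup_chart z A a `<=` E -> B = cen E (blowup_chart z A a) -> B = A.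
Proof.
move=> hE sA dom a0 nAz [Aa _] chE ->.
have c1 : center_ideal z A 1 by split; first exact: subring1.
have Ea : E a^-1 by apply: chE; rewrite -[a^-1]mul1r; exact: blowup_chart_div.
have Aai : A a^-1 by exact: (dom_unit dom).
apply/seteqP; split.
  apply: cen_min => //; apply: blowup_chart_min => // b [Ab _].
  by apply: subringM.
apply: (subset_trans (@sub_blowup_chart z A a)).
by apply: sub_cen => //; exact: blowup_chart_subring.
Qed.

Lemma blowup_keep X z A : local_ring A -> X A -> ~ (A `<=` z) -> blowup X z A.
Proof.
move=> hA XA nAz; have [sA _] := hA.
have e : blowup_chart z A 1 = A.
  apply/seteqP; split; last exact: sub_blowup_chart.
  by apply: blowup_chart_min => // b [Ab _]; rewrite divr1.
exists A, 1, (max_ideal A); rewrite e; split=> //.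
- by split; first exact: subring1.
- exact: oner_neq0.
- exact: max_ideal_prime.
- by rewrite localization_max.
Qed.

End Blowups.

(** * Discrete valuation rings and their normalized valuations *)

Section Valuations.
Context {K : fieldType}.
Implicit Types (E z : set K) (v : K -> int).

Record dvr_val E v : Prop := DvrVal {
  dvr_valM : forall x y, x != 0 -> y != 0 -> v (x * y) = v x + v y;
  dvr_valE : forall x, x != 0 -> E x <-> 0 <= v x;
  dvr_val_subring : is_subring E;
  dvr_val_onto : exists2 p, p != 0 & v p = 1 }.

Lemma dvr_val1 E v : dvr_val E v -> v 1 = 0.
Proof.
move=> h; have := dvr_valM h (oner_neq0 _) (oner_neq0 _).
by rewrite mulr1 => /eqP; rewrite addrC -subr_eq subrr eq_sym => /eqP.
Qed.

Lemma dvr_valV E v x : dvr_val E v -> x != 0 -> v x^-1 = - v x.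
Proof.
move=> h x0; apply/eqP; rewrite -addr_eq0 addrC -(dvr_valM h) ?invr_eq0 //.
by rewrite divff // (dvr_val1 h).
Qed.

Lemma dvr_valX E v x k : dvr_val E v -> x != 0 -> v (x ^+ k) = v x * k%:Z.
Proof.
move=> h x0; elim: k => [|k IH]; first by rewrite expr0 mulr0 (dvr_val1 h).
by rewrite exprS (dvr_valM h) ?expf_neq0 // IH intS mulrDr mulr1.
Qed.

Lemma dvr_valXz E v x (e : int) : dvr_val E v -> x != 0 -> v (x ^ e) = v x * e.
Proof.
move=> h x0; case: e => k; first by rewrite -exprnP (dvr_valX _ h).
by rewrite NegzE -exprnN (dvr_valV h) ?expf_neq0 // (dvr_valX _ h) // mulrN.
Qed.

Lemma max_ideal_dvr E v x : dvr_val E v -> x != 0 -> max_ideal E x <-> 0 < v x.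
Proof.
move=> h x0; have hx := dvr_valE h x0; have := dvr_valE h (invr_neq0 x0).
rewrite (dvr_valV h) // oppr_ge0 => hxi; split.
  move=> [Ex [/eqP|nEx]]; first by rewrite (negbTE x0).
  by rewrite ltNge; apply/negP => /hxi.
move=> lt0; split; first by apply/hx; exact: ltW.
by right=> /hxi; rewrite leNgt lt0.
Qed.

Lemma dvr_div E v a b : dvr_val E v -> a != 0 -> (b != 0 -> v a <= v b) -> E (b / a).
Proof.
move=> h a0 ab; have [->|b0] := eqVneq b 0.
  by rewrite mul0r; apply: subring0; exact: dvr_val_subring h.
apply/(dvr_valE h); first by rewrite mulf_neq0 ?invr_eq0.
by rewrite (dvr_valM h) ?invr_eq0 // (dvr_valV h) // subr_ge0 ab.
Qed.

(** Expresses a lower bound on [v] as membership in [E], so that bounds pass to sums through the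
    ring structure. *)
Lemma dvr_shift E v q (B : nat) x : dvr_val E v -> q != 0 -> v q = 1 -> x != 0 ->
  E (q ^+ B * x) <-> - B%:Z <= v x.
Proof.
move=> h q0 vq x0; have qx0 : q ^+ B * x != 0 by rewrite mulf_neq0 ?expf_neq0.
split=> [/(dvr_valE h qx0)|le].
  by rewrite (dvr_valM h) ?expf_neq0 // (dvr_valX _ h) // vq mul1r; lia.
apply/(dvr_valE h) => //.
by rewrite (dvr_valM h) ?expf_neq0 // (dvr_valX _ h) // vq mul1r; lia.
Qed.

Lemma dvr_pole_inv E v x : dvr_val E v -> ~ E x -> max_ideal E x^-1.
Proof.
move=> h nEx; have x0 : x != 0.
  by apply/eqP => e; apply: nEx; rewrite e; apply: subring0; exact: dvr_val_subring h.
apply/(max_ideal_dvr h); first by rewrite invr_eq0.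
by rewrite (dvr_valV h) // oppr_gt0 ltNge; apply/negP => /(dvr_valE h x0).
Qed.

Lemma dvr_local E v : dvr_val E v -> local_ring E.
Proof.
move=> h; have sE := dvr_val_subring h; split=> // x y mx my.
have [x0|x0] := eqVneq x 0; first by rewrite x0 add0r.
have [y0|y0] := eqVneq y 0; first by rewrite y0 addr0.
have main a b : a != 0 -> b != 0 -> max_ideal E a -> max_ideal E b -> v a <= v b ->
    max_ideal E (a + b).
  move=> a0 b0 ma mb ab.
  have -> : a + b = (1 + b / a) * a by rewrite mulrDl mul1r mulfVK.
  apply: max_idealM => //; apply: subringD => //; first exact: subring1.
  exact: (dvr_div h).
case/orP: (le_total (v x) (v y)) => le; first exact: main.
by rewrite addrC; exact: main.
Qed.

Lemma dvr_val_dvr E v : dvr_val E v -> is_dvr E.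
Proof.
move=> h; split; first exact: dvr_val_subring h.
have [p p0 vp] := dvr_val_onto h; exists p; split=> //.
  by apply/(max_ideal_dvr h) => //; rewrite vp.
move=> x x0; exists (x / p ^ (v x)), (v x).
have pv0 : p ^ v x != 0 by rewrite expfz_neq0.
have vu : v (x / p ^ v x) = 0.
  by rewrite (dvr_valM h) ?invr_eq0 // (dvr_valV h) // (dvr_valXz _ h) // vp mul1r subrr.
have u0 : x / p ^ v x != 0 by rewrite mulf_neq0 ?invr_eq0.
split; last by rewrite mulfVK.
- by apply/(dvr_valE h) => //; rewrite vu.
- by apply/(dvr_valE h); rewrite ?invr_eq0 // (dvr_valV h) // vu.
Qed.

Lemma dvr_exists_val E : is_dvr E -> exists v, dvr_val E v.
Proof.
move=> [sE [p [p0 mp hp]]].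
have npE : ~ E p^-1 by case: mp => _ [/eqP|//]; rewrite (negbTE p0).
have Ep : E p by case: mp.
have EpX k : E (p ^+ k) by exact: subringX.
have uniq u e : u != 0 -> E u -> E u^-1 -> E (u * p ^ e) <-> 0 <= e.
  move=> u0 Eu Eui; case: e => k.
    by rewrite -exprnP; split=> // _; apply: subringM.
  rewrite NegzE -exprnN; split=> // h; exfalso; apply: npE.
  have -> : p^-1 = u^-1 * (p ^+ k) * (u * p ^- k.+1).
    rewrite exprSr invfM mulrACA mulVf // mul1r mulrA mulfV ?expf_neq0 //.
    by rewrite mul1r.
  by apply: subringM => //; apply: subringM.
have /choice [v hv] : forall x, exists e, x != 0 ->
    exists u, [/\ E u, E u^-1 & x = u * p ^ e].
  move=> x; have [->|x0] := eqVneq x 0; first by exists 0.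
  by have [u [e h]] := hp x x0; exists e => _; exists u.
have v0 x u e : x != 0 -> E u -> E u^-1 -> x = u * p ^ e -> v x = e.
  move=> x0 Eu Eui ex; have [w [Ew Ewi ew]] := hv x x0.
  have u0 : u != 0 by apply: contraNneq x0 => u0; rewrite ex u0 mul0r.
  have w0 : w != 0 by apply: contraNneq x0 => w0; rewrite ew w0 mul0r.
  have gen a b c d : a != 0 -> E a -> E a^-1 -> b != 0 -> E b -> E b^-1 ->
      a * p ^ c = b * p ^ d -> d <= c.
    move=> a0 Ea Eai b0 Eb Ebi eq.
    have := (uniq (b / a) (c - d)).
    rewrite subr_ge0 => hh; apply/hh => //.
    + by rewrite mulf_neq0 ?invr_eq0.
    + exact: subringM.
    + by rewrite invf_div; apply: subringM.
    (* The relation says p ^ (c - d) = b / a, so the element tested by [uniq] is the square of an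
       element of [E], which forces c - d >= 0. *)
    have -> : b / a * p ^ (c - d) = (b / a) ^+ 2.
      have pd : p ^ c = b / a * p ^ d.
        by apply: (mulfI a0); rewrite eq mulrA [a * _]mulrC mulfVK.
      by rewrite expfzDr // pd -invr_expz mulfK // expfz_neq0.
    by apply: (@subringX _ _ _ 2 sE); exact: subringM.
  apply/eqP; rewrite eq_le (gen u w) ?(gen w u) //.
    by rewrite -ex -ew.
  by rewrite -ex -ew.
exists v; split=> //.
- move=> x y x0 y0; have [u [Eu Eui eu]] := hv x x0; have [w [Ew Ewi ew]] := hv y y0.
  apply: (v0 _ (u * w)); first by rewrite mulf_neq0.
  + exact: subringM.
  + by rewrite invfM; apply: subringM.
  + by rewrite expfzDr // mulrACA -eu -ew.
- move=> x x0; have [u [Eu Eui eu]] := hv x x0.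
  by rewrite {1}eu; apply: uniq => //; apply: contraNneq x0 => u0; rewrite eu u0 mul0r.
- exists p => //; apply: (v0 _ 1) => //; rewrite ?invr1 ?expr1z ?mul1r //; exact: subring1.
Qed.

Lemma has_orderE E v x e : dvr_val E v -> x != 0 -> has_order E x e <-> e = v x.
Proof.
move=> h x0; split.
  move=> [p [u [[p0 mp hp] u0 Eu Eui ->]]].
  (* Every uniformizer has value 1: an element of value 1 is a unit times some p ^ f, so v p * f = 1
     with v p > 0. *)
  have vp : v p = 1.
    have [q q0 vq] := dvr_val_onto h.
    have [w [f [Ew Ewi eq]]] := hp q q0.
    have w0 : w != 0 by apply: contraNneq q0 => w0; rewrite eq w0 mul0r.
    have vw : v w = 0.
      move/(dvr_valE h w0): Ew; move/(dvr_valE h (invr_neq0 w0)): Ewi.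
      by rewrite (dvr_valV h) // oppr_ge0 => h1 h2; apply/eqP; rewrite eq_le h1 h2.
    move: vq; rewrite eq (dvr_valM h) ?expfz_neq0 // vw add0r (dvr_valXz _ h) // => e1.
    move/(max_ideal_dvr h p0): mp => vp0; clear -e1 vp0.
    move: (v p) vp0 e1 => a a0 e1; have f0 : 0 < f by nia.
    by nia.
  have vu : v u = 0.
    move/(dvr_valE h u0): Eu; move/(dvr_valE h (invr_neq0 u0)): Eui.
    by rewrite (dvr_valV h) // oppr_ge0 => h1 h2; apply/eqP; rewrite eq_le h1 h2.
  by rewrite (dvr_valM h) ?expfz_neq0 // vu add0r (dvr_valXz _ h) // vp mul1r.
move=> ->; have [_ [p up]] := dvr_val_dvr h; have [p0 mp hp] := up.
have vp : exists2 q, q != 0 & v q = 1 by exact: dvr_val_onto h.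
have [q q0 vq] := vp.
have pv0 : q ^ v x != 0 by rewrite expfz_neq0.
have u0 : x / q ^ v x != 0 by rewrite mulf_neq0 ?invr_eq0.
have vu : v (x / q ^ v x) = 0.
  by rewrite (dvr_valM h) ?invr_eq0 // (dvr_valV h) // (dvr_valXz _ h) // vq mul1r subrr.
exists q, (x / q ^ v x); split=> //; last by rewrite mulfVK.
- split=> //; first by apply/(max_ideal_dvr h) => //; rewrite vq.
  move=> y y0; exists (y / q ^ (v y)), (v y).
  have qy0 : q ^ v y != 0 by rewrite expfz_neq0.
  have vy : v (y / q ^ v y) = 0.
    by rewrite (dvr_valM h) ?invr_eq0 // (dvr_valV h) // (dvr_valXz _ h) // vq mul1r subrr.
  have w0 : y / q ^ v y != 0 by rewrite mulf_neq0 ?invr_eq0.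
  split; last by rewrite mulfVK.
  + by apply/(dvr_valE h) => //; rewrite vy.
  + by apply/(dvr_valE h); rewrite ?invr_eq0 // (dvr_valV h) // vy.
- by apply/(dvr_valE h) => //; rewrite vu.
- by apply/(dvr_valE h); rewrite ?invr_eq0 // (dvr_valV h) // vu.
Qed.

(** If x in [E'] has a pole along [E], then q^-1 x^-k is in [E] for large k, so [E'] contains q^-1
    for its own uniformizer q. *)
Lemma dvr_sub_eq E E' v v' : dvr_val E v -> dvr_val E' v' -> E `<=` E' -> E = E'.
Proof.
move=> h h' EE'; apply/seteqP; split=> // x E'x; apply: contrapT => nEx.
have x0 : x != 0.
  by apply/eqP => x0; apply: nEx; rewrite x0; apply: subring0; exact: dvr_val_subring h.
have vx : v x < 0 by rewrite ltNge; apply/negP => /(dvr_valE h x0).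
have [q q0 vq] := dvr_val_onto h'.
have [k vk] : exists k : nat, 0 <= v q^-1 - v x * k%:Z.
  by exists `|v q^-1|%N; move: vx; move: (v x) (v q^-1) => a b a0; nia.
have : E' (q^-1 * x ^- k * x ^+ k).
  apply: subringM; [exact: dvr_val_subring h'| | by apply: subringX => //; exact: dvr_val_subring h'].
  apply: EE'; apply/(dvr_valE h); first by rewrite mulf_neq0 ?invr_eq0 ?expf_neq0.
  by rewrite (dvr_valM h) ?invr_eq0 ?expf_neq0 // (dvr_valV h (expf_neq0 _ x0)) (dvr_valX _ h).
rewrite mulfVK ?expf_neq0 // => /(dvr_valE h') -/(_ (invr_neq0 q0)).
by rewrite (dvr_valV h') // vq.
Qed.

(** Ideals of a discrete valuation ring are principal, so the chart at an element of least value is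
    [E] itself. The element [x] ensures that the stalk of the ideal is nonzero. *)
Lemma blowup_keep_dvr X E v z (x : K) : dvr_val E v -> X E -> is_subring z ->
  x != 0 -> max_ideal z x -> blowup X z E.
Proof.
move=> h XE sz x0 mx; have sE := dvr_val_subring h; have hE := dvr_local h.
have [Ez|nEz] := pselect (E `<=` z); last exact: blowup_keep.
have Ex : E x.
  apply/(dvr_valE h) => //; rewrite leNgt; apply/negP => vx.
  case: mx => _ [/eqP|]; first by rewrite (negbTE x0).
  apply; apply: Ez; apply/(dvr_valE h); first by rewrite invr_eq0.
  by rewrite (dvr_valV h) // oppr_ge0 ltW.
pose Q (k : nat) := exists2 a, center_ideal z E a /\ a != 0 & v a = k%:Z.
have exQ : exists k, `[< Q k >].
  exists `|v x|%N; apply/asboolP; exists x; first by split=> //; split.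
  by rewrite gez0_abs //; apply/(dvr_valE h).
case: (ex_minnP exQ) => k /asboolP [a [ca a0] va] min.
have e : blowup_chart z E a = E.
  apply/seteqP; split; last exact: sub_blowup_chart.
  apply: blowup_chart_min => // b [Eb hb].
  apply: (dvr_div h a0) => b0; rewrite va.
  have vb : 0 <= v b by apply/(dvr_valE h).
  rewrite -(gez0_abs vb) lez_nat; apply: min; apply/asboolP.
  by exists b; [split=> //; split | rewrite gez0_abs].
exists E, a, (max_ideal E); rewrite e; split=> //.
- exact: max_ideal_prime.
- by rewrite localization_max.
Qed.

End Valuations.

(** * The degree along a subspace as a valuation *)

Lemma fracP (A : idomainType) (x : {fraction A}) :
  exists a b : A, b != 0 /\ x = tofrac a / tofrac b.
Proof.
elim/quotW: x => r; exists (frac r).1, (frac r).2; split; first exact: denom_ratioP.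
have r2 := denom_ratioP r.
apply: (@mulIf _ (tofrac (frac r).2)); first by rewrite tofrac_eq0.
rewrite mulfVK ?tofrac_eq0 //.
change (FracField.mul (\pi_(FracField.type A) r)%qT (tofrac (frac r).2) = tofrac (frac r).1).
rewrite !piE; apply/eqmodP => /=.
rewrite FracField.equivfE /FracField.mulf !numden_Ratio ?mulf_neq0 ?oner_neq0 //.
by rewrite !mulr1 mulrC.
Qed.

Section MpolyGen.
Variables (C : fieldType) (n : nat).

Lemma mpoly_gen (P : {mpoly C[n]} -> Prop) :
  (forall c, P c%:MP) -> (forall j, P 'X_j) ->
  (forall f g, P f -> P g -> P (f + g)) ->
  (forall f g, P f -> P g -> P (f * g)) -> forall g, P g.
Proof.
move=> hC hX hD hM g.
rewrite [g]mpolyE; apply: (big_ind P); [by rewrite -mpolyC0 | exact: hD|].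
move=> m _; rewrite -mul_mpolyC; apply: (hM) => //.
rewrite mpolyXE_id; apply: (big_ind P); [by rewrite -mpolyC1 | exact: hM|].
move=> i _; elim: (m i) => [|k IH]; first by rewrite expr0 -mpolyC1.
by rewrite exprS; apply: hM.
Qed.

End MpolyGen.

Section Forms.
Variables (C : fieldType) (L : vectType C).
Implicit Types (h : 'Hom(L, C^o)).
Local Notation A := (sym_alg L).

Definition sym_const (c : C) : sym_alg L := mpolyC _ c.

Lemma sym_formD h h' : sym_form (h + h') = sym_form h + sym_form h'.
Proof.
rewrite /sym_form -big_split /=; apply: eq_bigr => j _.
by rewrite add_lfunE scalerDl.
Qed.

Lemma sym_formZ c h : sym_form (c *: h) = sym_const c * sym_form h.
Proof.
rewrite /sym_const mul_mpolyC /sym_form scaler_sumr; apply: eq_bigr => j _.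
by rewrite scale_lfunE scalerA.
Qed.

Lemma sym_formN h : sym_form (- h) = - sym_form h.
Proof. by rewrite -scaleN1r sym_formZ /sym_const mpolyCN mpolyC1 mulN1r. Qed.

Lemma sym_formB h h' : sym_form (h - h') = sym_form h - sym_form h'.
Proof. by rewrite sym_formD sym_formN. Qed.

Lemma sym_form0 : sym_form (0 : 'Hom(L, C^o)) = 0.
Proof. by rewrite -(subrr 0) sym_formB subrr. Qed.

Definition coord_form (j : 'I_(\dim {:L})) : 'Hom(L, C^o) := linfun (coord (vbasis {:L}) j : L -> C^o).

Lemma coord_formE j x : coord_form j x = coord (vbasis {:L}) j x.
Proof. by rewrite lfunE. Qed.

Lemma form_coord h : h = \sum_(j < \dim {:L}) h (vbasis {:L})`_j *: coord_form j.
Proof.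
apply/lfunP => x; rewrite sum_lfunE.
rewrite {1}(coord_vbasis (memvf x)) linear_sum; apply: eq_bigr => j _ /=.
by rewrite scale_lfunE coord_formE linearZ /= [RHS]mulrC.
Qed.

Lemma sym_form_coord j : sym_form (coord_form j) = 'X_j :> {mpoly C[_]}.
Proof.
rewrite /sym_form (bigD1 j) //= big1 ?addr0.
  by rewrite coord_formE coord_free ?eqxx ?scale1r // (basis_free (vbasisP _)).
move=> i ij; rewrite coord_formE coord_free ?(basis_free (vbasisP _)) //.
by rewrite (negbTE ij) scale0r.
Qed.

Lemma sym_form_eq0 h : (sym_form h == 0) = (h == 0).
Proof.
apply/eqP/eqP => [h0|->]; last exact: sym_form0.
rewrite (form_coord h) big1 // => j _.
suff -> : h (vbasis {:L})`_j = 0 by rewrite scale0r.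
have := congr1 (fun p : {mpoly C[_]} => p@_U_(j)) h0.
rewrite /sym_form linear_sum /= mcoeff0 (bigD1 j) //= big1 ?addr0.
  by rewrite linearZ /= mcoeffXU eqxx mulr1.
by move=> i ij; rewrite linearZ /= mcoeffXU (negbTE ij) mulr0.
Qed.

Lemma sym_alg_gen (P : A -> Prop) :
  (forall c, P (sym_const c)) -> (forall h, P (sym_form h)) ->
  (forall f g, P f -> P g -> P (f + g)) ->
  (forall f g, P f -> P g -> P (f * g)) -> forall g, P g.
Proof.
by move=> hC hF hD hM; apply: mpoly_gen => // j; rewrite -sym_form_coord.
Qed.

Lemma sym_form_sum (I : Type) (r : seq I) (h : I -> 'Hom(L, C^o)) :
  sym_form (\sum_(i <- r) h i) = \sum_(i <- r) sym_form (h i).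
Proof.
elim: r => [|i r IH]; first by rewrite !big_nil sym_form0.
by rewrite !big_cons sym_formD IH.
Qed.

End Forms.

Definition proj_onto (C : fieldType) (L : vectType C) (p : 'End(L)) (N : {vspace L}) :=
  (forall x, p x \in N) /\ (forall x, x \in N -> p x = x).

Section Weights.
Variables (C : fieldType) (L : vectType C).
Implicit Types (h : 'Hom(L, C^o)) (p : 'End(L)) (N : {vspace L}).
Local Notation A := (sym_alg L).
Local Notation K := (rat_fun L).

(* g(x) |-> g((1 - p) x + T p x) *)
Definition weight_poly p : A -> {poly A} :=
  mmap ((@polyC A) \o (@mpolyC _ C))
    (fun j => (sym_form (coord_form j - (coord_form j \o p)%VF))%:P
              + (sym_form (coord_form j \o p)%VF)%:P * 'X).

HB.instance Definition _ p := GRing.RMorphism.copy (weight_poly p)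
  (mmap ((@polyC A) \o (@mpolyC _ C))
    (fun j => (sym_form (coord_form j - (coord_form j \o p)%VF))%:P
              + (sym_form (coord_form j \o p)%VF)%:P * 'X)).

Lemma weight_poly_const p c : weight_poly p (sym_const L c) = (sym_const L c)%:P.
Proof. exact: mmapC. Qed.

Lemma weight_poly_form p h : weight_poly p (sym_form h) =
  (sym_form (h - (h \o p)%VF))%:P + (sym_form (h \o p)%VF)%:P * 'X.
Proof.
rewrite {1}(form_coord h) sym_form_sum rmorph_sum /=.
transitivity (\sum_(j < \dim {:L}) ((sym_const L (h (vbasis {:L})`_j))%:P *
  ((sym_form (coord_form j - (coord_form j \o p)%VF))%:P
              + (sym_form (coord_form j \o p)%VF)%:P * 'X))).
  apply: eq_bigr => j _; rewrite sym_formZ rmorphM /= weight_poly_const; congr (_ * _).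
  by rewrite sym_form_coord /weight_poly mmapX mmap1U.
under eq_bigr do rewrite mulrDr mulrA -!polyCM -!sym_formZ.
rewrite big_split /= -mulr_suml -!rmorph_sum /= -!sym_form_sum.
have e : \sum_(j < \dim {:L}) (h (vbasis {:L})`_j *: (coord_form j \o p)%VF) = (h \o p)%VF.
  apply/lfunP => x; rewrite sum_lfunE comp_lfunE {2}(form_coord h) sum_lfunE.
  by apply: eq_bigr => j _; rewrite !scale_lfunE comp_lfunE.
congr (_%:P + _%:P * _); congr sym_form => //.
rewrite -{}e {2}(form_coord h) -sumrB; apply: eq_bigr => j _.
by rewrite scalerBr.
Qed.

(** At T = 1 the substitution is the identity: it is injective, and g is the sum of its weight
    components. *)
Lemma weight_poly_at1 p g : (weight_poly p g).[1] = g.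
Proof.
elim/sym_alg_gen: g => [c|h|f g hf hg|f g hf hg].
- by rewrite weight_poly_const hornerC.
- by rewrite weight_poly_form !hornerE -sym_formD subrK.
- by rewrite rmorphD hornerD hf hg.
- by rewrite rmorphM hornerM hf hg.
Qed.

Lemma weight_poly_eq0 p g : (weight_poly p g == 0) = (g == 0).
Proof.
apply/eqP/eqP => [h|->]; last by rewrite rmorph0.
by rewrite -(weight_poly_at1 p g) h horner0.
Qed.

(** One more than the degree along the image of [p], and 0 for g = 0; hence the shift in [wsizeM]
    and the bounds c_F + 1 later on. *)
Definition wsize p g := size (weight_poly p g).

Lemma wsize_eq0 p g : (wsize p g == 0%N) = (g == 0).
Proof. by rewrite size_poly_eq0 weight_poly_eq0. Qed.

Lemma wsizeM p f g : f != 0 -> g != 0 -> (wsize p (f * g)).+1 = (wsize p f + wsize p g)%N.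
Proof.
move=> f0 g0; rewrite /wsize rmorphM size_mul ?weight_poly_eq0 // prednK //.
by rewrite addn_gt0 lt0n wsize_eq0 f0.
Qed.

Lemma wsizeB p f g : (wsize p (f - g) <= maxn (wsize p f) (wsize p g))%N.
Proof.
rewrite /wsize rmorphB -[X in (_ <= maxn _ X)%N]size_polyN; exact: size_polyD.
Qed.

Lemma tofrac_mul_eq (a b c d : A) : b != 0 -> d != 0 ->
  (tofrac a / tofrac b = tofrac c / tofrac d :> K) -> a * d = c * b.
Proof.
move=> b0 d0 e; apply/eqP; rewrite -tofrac_eq !rmorphM /=.
by rewrite -eqr_div ?tofrac_eq0 //; apply/eqP.
Qed.

Definition weight_dvr p : set K :=
  [set x | exists a b, [/\ b != 0, x = tofrac a / tofrac b & (wsize p a <= wsize p b)%N]].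

Lemma weight_dvrP p a b : b != 0 ->
  weight_dvr p (tofrac a / tofrac b) <-> (wsize p a <= wsize p b)%N.
Proof.
move=> b0; split; last by move=> h; exists a, b.
move=> [c [d [d0 /(tofrac_mul_eq b0 d0) e le]]].
have [->|a0] := eqVneq a 0; first by rewrite /wsize rmorph0 size_poly0.
have c0 : c != 0.
  by apply: contra_neq a0 => c0; move/eqP: e; rewrite c0 mul0r mulf_eq0 (negbTE d0) orbF => /eqP.
have := wsizeM p a0 d0; have := wsizeM p c0 b0; rewrite e => -> ?; lia.
Qed.

Definition weight_val_spec p (v : K -> int) := forall a b, a != 0 -> b != 0 ->
  v (tofrac a / tofrac b) = (wsize p b)%:Z - (wsize p a)%:Z.

Lemma weight_val_exists p : exists v, weight_val_spec p v.
Proof.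
have /choice [f hf] : forall x : K, exists ab : A * A,
    ab.2 != 0 /\ x = tofrac ab.1 / tofrac ab.2.
  by move=> x; have [a [b h]] := fracP x; exists (a, b).
exists (fun x => (wsize p (f x).2)%:Z - (wsize p (f x).1)%:Z) => a b a0 b0.
have [d0 e] := hf (tofrac a / tofrac b).
move: (f _).1 (f _).2 d0 e => c d d0 /(tofrac_mul_eq b0 d0) e.
have c0 : c != 0.
  by apply: contra_neq a0 => c0; move/eqP: e; rewrite c0 mul0r mulf_eq0 (negbTE d0) orbF => /eqP.
have := wsizeM p a0 d0; have := wsizeM p c0 b0; rewrite e => -> ?; lia.
Qed.

Lemma wsize_const p c : (wsize p (sym_const L c) <= 1)%N.
Proof. by rewrite /wsize weight_poly_const size_polyC_leq1. Qed.

Lemma wsize_form p h : (wsize p (sym_form h) <= 2)%N.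
Proof.
rewrite /wsize weight_poly_form; apply: (leq_trans (size_polyD _ _)).
rewrite geq_max (leq_trans (size_polyC_leq1 _)) //=.
by rewrite (leq_trans (size_polyMleq _ _)) // size_polyX addn2 /= ltnS size_polyC_leq1.
Qed.

Section Proj.
Variables (p : 'End(L)) (N : {vspace L}).
Hypothesis hp : proj_onto p N.

Lemma perp_proj h : (N <= lker h)%VS -> (h \o p)%VF = 0.
Proof.
move=> /subvP hN; apply/lfunP => x; rewrite comp_lfunE zero_lfunE.
by apply/eqP; rewrite -memv_ker; apply: hN; case: hp.
Qed.

Lemma weight_poly_perp h : (N <= lker h)%VS -> weight_poly p (sym_form h) = (sym_form h)%:P.
Proof. by move=> /perp_proj e; rewrite weight_poly_form e subr0 sym_form0 mul0r addr0. Qed.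

Lemma form_proj_neq0 h : ~~ (N <= lker h)%VS -> (h \o p)%VF != 0.
Proof.
apply: contraNneq => e; apply/subvP => x Nx; rewrite memv_ker.
by case: hp => _ /(_ x Nx) {1}<-; rewrite -comp_lfunE e zero_lfunE.
Qed.

Lemma wsize_form_eq h (c : C) : ~~ (N <= lker h)%VS -> wsize p (sym_form h + sym_const L c) = 2%N.
Proof.
move=> /form_proj_neq0 h0; rewrite /wsize rmorphD /= weight_poly_form weight_poly_const.
rewrite addrAC -polyCD addrC -['X]expr1 mul_polyC size_polyDl.
  by rewrite size_scale ?size_polyXn // sym_form_eq0.
by rewrite size_scale ?size_polyXn ?sym_form_eq0 // ltnS size_polyC_leq1.
Qed.

Lemma wsize_perp h (c : C) : (N <= lker h)%VS -> (wsize p (sym_form h + sym_const L c) <= 1)%N.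
Proof.
move=> hN; rewrite /wsize rmorphD /= weight_poly_perp // weight_poly_const -polyCD.
exact: size_polyC_leq1.
Qed.

Lemma exists_notperp : N != 0%VS -> exists h, ~~ (N <= lker h)%VS.
Proof.
move=> N0; apply: contrapT => /forallNP all.
move/negP: N0; apply; rewrite -subv0; apply/subvP => x Nx.
rewrite memv0 (coord_vbasis (memvf x)) big1 // => j _.
have /negP/negPn/subvP/(_ x Nx) := all (coord_form j).
by rewrite memv_ker coord_formE => /eqP ->; rewrite scale0r.
Qed.

Lemma weight_poly_proj h : (h \o p)%VF = h ->
  weight_poly p (sym_form h) = (sym_form h)%:P * 'X.
Proof. by move=> e; rewrite weight_poly_form e subrr sym_form0 add0r. Qed.

(** The axioms come from additivity of [wsize]; value 1 is attained at 1 / h for a form h that is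
    not zero on [N], which exists since [N] is nonzero. *)
Lemma weight_dvr_val v : N != 0%VS -> weight_val_spec p v -> dvr_val (weight_dvr p) v.
Proof.
move=> N0 hv; split.
- move=> x y; have [a [b [b0 ->]]] := fracP x; have [c [d [d0 ->]]] := fracP y.
  rewrite !mulf_eq0 !invr_eq0 !tofrac_eq0 (negbTE b0) (negbTE d0) !orbF => a0 c0.
  rewrite mulf_div -!rmorphM !hv ?mulf_neq0 //.
  have := wsizeM p a0 c0; have := wsizeM p b0 d0; lia.
- move=> x; have [a [b [b0 ->]]] := fracP x.
  rewrite mulf_eq0 invr_eq0 !tofrac_eq0 (negbTE b0) orbF => a0.
  by rewrite hv // subr_ge0 lez_nat; exact: weight_dvrP.
- split.
  + by rewrite -(divr1 1) -(rmorph1 (@tofrac A)); apply/weight_dvrP; rewrite ?oner_neq0.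
  + move=> _ _ [a [b [b0 -> le1]]] [c [d [d0 -> le2]]].
    rewrite -mulNr addf_div ?tofrac_eq0 // mulNr -!rmorphM -rmorphB.
    apply/weight_dvrP; first by rewrite mulf_neq0.
    apply: (leq_trans (wsizeB _ _ _)); rewrite geq_max.
    have bd := wsizeM p b0 d0; apply/andP; split.
    * have [->|a0] := eqVneq a 0; first by rewrite mul0r /wsize rmorph0 size_poly0.
      have := wsizeM p a0 d0; lia.
    * have [->|c0] := eqVneq c 0; first by rewrite mul0r /wsize rmorph0 size_poly0.
      have := wsizeM p c0 b0; lia.
  + move=> _ _ [a [b [b0 -> le1]]] [c [d [d0 -> le2]]].
    rewrite mulf_div -!rmorphM; apply/weight_dvrP; first by rewrite mulf_neq0.
    have bd := wsizeM p b0 d0.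
    have [->|a0] := eqVneq a 0; first by rewrite mul0r /wsize rmorph0 size_poly0.
    have [->|c0] := eqVneq c 0; first by rewrite mulr0 /wsize rmorph0 size_poly0.
    have := wsizeM p a0 c0; lia.
- have [h hN] := exists_notperp N0.
  have h2 := wsize_form_eq 0 hN; rewrite /sym_const mpolyC0 addr0 in h2.
  have h0 : sym_form h != 0 by rewrite -(wsize_eq0 p) h2.
  exists (tofrac 1 / tofrac (sym_form h)).
    by rewrite mulf_eq0 invr_eq0 !tofrac_eq0 oner_eq0.
  by rewrite hv ?oner_eq0 // h2 /wsize rmorph1 size_poly1.
Qed.

(* The rational functions that are homogeneous of weight 0. *)
Definition weight_inv : set K := [set x | exists a b k,
  [/\ b != 0, x = tofrac a / tofrac b, weight_poly p a = a%:P * 'X^k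
     & weight_poly p b = b%:P * 'X^k]].

Lemma weight_inv_subring : is_subring weight_inv.
Proof.
split.
- exists 1, 1, 0%N; rewrite oner_neq0; split=> //; first by rewrite rmorph1 divr1.
  + by rewrite rmorph1 mul1r.
  + by rewrite rmorph1 mul1r.
- move=> _ _ [a [b [k [b0 -> ea eb]]]] [c [d [m [d0 -> ec ed]]]].
  exists (a * d - c * b), (b * d), (k + m)%N; split; first by rewrite mulf_neq0.
  + by rewrite -mulNr addf_div ?tofrac_eq0 // mulNr -!rmorphM -rmorphB.
  + rewrite rmorphB !rmorphM /= ea eb ec ed polyCB !polyCM mulrBl exprD.
    by congr (_ - _); rewrite mulrACA // [X in _ * X]mulrC.
  + by rewrite rmorphM /= eb ed polyCM exprD mulrACA.
- move=> _ _ [a [b [k [b0 -> ea eb]]]] [c [d [m [d0 -> ec ed]]]].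
  exists (a * c), (b * d), (k + m)%N; split; first by rewrite mulf_neq0.
  + by rewrite mulf_div -!rmorphM.
  + by rewrite rmorphM /= ea ec polyCM exprD mulrACA.
  + by rewrite rmorphM /= eb ed polyCM exprD mulrACA.
Qed.

(** Numerator and denominator have the same weight, so the inverse of a nonzero such function is in
    the valuation ring too. *)
Lemma weight_inv_max x : weight_inv x -> max_ideal (weight_dvr p) x -> x = 0.
Proof.
move=> [a [b [k [b0 -> ea eb]]]] [_ [//|nV]].
have [->|a0] := eqVneq a 0; first by rewrite rmorph0 mul0r.
exfalso; apply: nV; rewrite invf_div; apply/weight_dvrP => //.
by rewrite /wsize ea eb !size_mulXn ?polyC_eq0 // !size_polyC a0 b0.
Qed.

Lemma weight_inv_const c : weight_inv (tofrac (sym_const L c)).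
Proof.
exists (sym_const L c), 1, 0%N; split; rewrite ?oner_neq0 ?rmorph1 ?divr1 ?mul1r //.
by rewrite weight_poly_const mulr1.
Qed.

Lemma weight_inv_perp h : (N <= lker h)%VS -> weight_inv (tofrac (sym_form h)).
Proof.
move=> hN; exists (sym_form h), 1, 0%N; split; rewrite ?oner_neq0 ?rmorph1 ?divr1 ?mul1r //.
by rewrite weight_poly_perp // mulr1.
Qed.

Lemma weight_inv_div h y : y != 0 -> (h \o p)%VF = h -> (y \o p)%VF = y ->
  weight_inv (tofrac (sym_form h) / tofrac (sym_form y)).
Proof.
move=> y0 eh ey; exists (sym_form h), (sym_form y), 1%N; rewrite expr1 sym_form_eq0.
by split=> //; exact: weight_poly_proj.
Qed.

End Proj.
End Weights.

Section IdealSpan.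
Variable K : fieldType.
Implicit Types (R S : set K).

Lemma ideal_span0 R S : ideal_span R S 0.
Proof.
exists 0%N, (fun _ => 0), (fun _ => 0); split; first by case.
by rewrite big_ord0.
Qed.

Lemma ideal_spanD R S x y : ideal_span R S x -> ideal_span R S y -> ideal_span R S (x + y).
Proof.
move=> [m [b [s [h ->]]]] [n [c [t [h' ->]]]].
exists (m + n)%N, (fun i => match split i with inl j => b j | inr j => c j end),
  (fun i => match split i with inl j => s j | inr j => t j end); split.
  by move=> i; case: (split i).
rewrite big_split_ord /=; congr (_ + _); apply: eq_bigr => i _.
  by rewrite (unsplitK (inl i)).
by rewrite (unsplitK (inr i)).
Qed.

Lemma ideal_spanM R S a x : is_subring R -> R a -> ideal_span R S x -> ideal_span R S (a * x).
Proof.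
move=> sR Ra [m [b [s [h ->]]]]; exists m, (fun i => a * b i), s; split.
  by move=> j; have [h1 h2] := h j; split=> //; exact: subringM.
by rewrite mulr_sumr; apply: eq_bigr => i _; rewrite mulrA.
Qed.

Lemma ideal_span_gen R S x : is_subring R -> S x -> ideal_span R S x.
Proof.
move=> sR Sx; exists 1%N, (fun _ => 1), (fun _ => x); split.
  by split=> //; exact: subring1.
by rewrite big_ord1 mul1r.
Qed.

Lemma ideal_span_ind R S (P : K -> Prop) : P 0 -> (forall x y, P x -> P y -> P (x + y)) ->
  (forall b s, R b -> S s -> P (b * s)) -> forall x, ideal_span R S x -> P x.
Proof.
move=> P0 PD PM x [m [b [s [h ->]]]].
by apply: (big_ind P) => // i _; have [h1 h2] := h i; exact: PM.
Qed.

Lemma ideal_span_mono R R' S S' : R `<=` R' -> S `<=` S' ->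
  ideal_span R S `<=` ideal_span R' S'.
Proof.
move=> RR SS x [m [b [s [h ->]]]]; exists m, b, s; split=> // j.
by have [h1 h2] := h j; split; [exact: RR | exact: SS].
Qed.

Lemma dom_max (E B : set K) x : is_subring E -> B `<=` E -> B x -> max_ideal E x -> max_ideal B x.
Proof.
move=> sE BE Bx [Ex hx]; split=> //; case: hx => [->|nE]; [by left|right=> /BE].
exact: nE.
Qed.

End IdealSpan.

(** * Strata at infinity *)

Section Strata.
Variables (C : fieldType) (L : vectType C).
Implicit Types (p : 'End(L)) (N M : {vspace L}).
Local Notation A := (sym_alg L).
Local Notation K := (rat_fun L).
Local Notation aff := ('Hom(L, C^o) * C)%type.
Implicit Types (h y : aff).

Lemma hyp_formE h : hyp_form h = tofrac (sym_form h.1 + sym_const L h.2).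
Proof. by []. Qed.

Lemma hyp_formB h h' : hyp_form (h - h') = hyp_form h - hyp_form h'.
Proof.
by rewrite !hyp_formE -rmorphB /sym_const /= sym_formB mpolyCB opprD addrACA.
Qed.

Lemma hyp_form_lin (h : 'Hom(L, C^o)) : hyp_form (h, 0) = tofrac (sym_form h).
Proof. by rewrite hyp_formE /sym_const mpolyC0 addr0. Qed.

Lemma hyp_form_const c : hyp_form (0, c) = tofrac (sym_const L c).
Proof. by rewrite hyp_formE sym_form0 add0r. Qed.

Lemma hyp_form1 : hyp_form (0, 1) = 1 :> K.
Proof. by rewrite hyp_form_const /sym_const mpolyC1 rmorph1. Qed.

Lemma hyp_form_eq0 h : (hyp_form h == 0) = (h == 0).
Proof.
rewrite hyp_formE tofrac_eq0; apply/eqP/eqP => [e|->]; last first.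
  by rewrite sym_form0 /sym_const mpolyC0 addr0.
have c0 : h.2 = 0.
  have := congr1 (fun p : {mpoly C[_]} => p@_0%MM) e.
  rewrite /= mcoeffD mcoeffC eqxx mulr1 mcoeff0 linear_sum /= big1 ?add0r //.
  by move=> i _; rewrite linearZ /= mcoeffX mnm1_eq0 mulr0.
move/eqP: e; rewrite c0 /sym_const mpolyC0 addr0 sym_form_eq0 => /eqP h1.
by case: h h1 c0 => /= a b -> ->.
Qed.

Lemma hyp_form_neq0 h : h != 0 -> hyp_form h != 0.
Proof. by rewrite hyp_form_eq0. Qed.

Lemma chart_subring h : is_subring (proj_chart h).
Proof. exact: subring_spanP. Qed.

Lemma chart_const h c : proj_chart h (tofrac (sym_const L c)).
Proof. by apply: sub_subring_span; left; exists c. Qed.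

Lemma chart_div h h' : proj_chart h (hyp_form h' / hyp_form h).
Proof. by apply: sub_subring_span; right; exists h'. Qed.

Lemma chart_min h (R : set K) : is_subring R -> (forall c, R (tofrac (sym_const L c))) ->
  (forall h', R (hyp_form h' / hyp_form h)) -> proj_chart h `<=` R.
Proof.
move=> sR hc hh; apply: subring_span_min => // x.
by case=> [[c _ <-]|[h' _ <-]]; [exact: hc | exact: hh].
Qed.

(** A function regular off h = 0 has a pole of bounded order there, cleared by a power of h / y. All
    larger exponents are included so that several functions can share one. *)
Lemma chart_switch h y b : h != 0 -> y != 0 -> proj_chart h b ->
  exists k, forall k', (k <= k')%N -> proj_chart y (b * (hyp_form h / hyp_form y) ^+ k').
Proof.
move=> h0 y0; move: b; have sY := chart_subring y.
have hr : proj_chart y (hyp_form h / hyp_form y) by exact: chart_div.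
pose P := [set b | exists k, forall k', (k <= k')%N ->
  proj_chart y (b * (hyp_form h / hyp_form y) ^+ k')].
change (proj_chart h `<=` P); apply: chart_min.
- split.
  + by exists 0%N => k _; rewrite mul1r; exact: (subringX k sY hr).
  + move=> a b [k hk] [m hm]; exists (maxn k m) => k'; rewrite geq_max => /andP[? ?].
    by rewrite mulrBl; apply: (subringB sY); [exact: hk | exact: hm].
  + move=> a b [k hk] [m hm]; exists (k + m)%N => k' le.
    have -> : k' = (k + (k' - k))%N by lia.
    by rewrite exprD mulrACA; apply: (subringM sY); [apply: hk | apply: hm; lia].
- move=> c; exists 0%N => k _; apply: (subringM sY); [exact: chart_const|exact: (subringX k sY hr)].
- move=> h'; exists 1%N => -[//|k] _.
  have H0 := hyp_form_neq0 h0.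
  rewrite exprS mulrA [_ * (hyp_form h / _)]mulrA (mulfVK H0).
  by apply: (subringM sY); [exact: chart_div|exact: (subringX k sY hr)].
Qed.

Definition perp_ideal N h : set K := ideal_span (proj_chart h)
  [set hyp_form h' / hyp_form h | h' in [set h' : aff | (N <= lker h'.1)%VS]].

Lemma perp_ideal_gen N h (h' : aff) : (N <= lker h'.1)%VS ->
  perp_ideal N h (hyp_form h' / hyp_form h).
Proof. by move=> hN; apply: ideal_span_gen; [exact: chart_subring|exists h']. Qed.

Lemma perp_ideal_sub N h : perp_ideal N h `<=` proj_chart h.
Proof.
have sR := chart_subring h; apply: ideal_span_ind; first exact: subring0.
  by move=> x y; exact: subringD.
by move=> b _ Rb [h' _ <-]; apply: (subringM sR) => //; exact: chart_div.
Qed.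

Lemma perp_ideal_switch N h y b : h != 0 -> y != 0 -> perp_ideal N h b ->
  exists k, forall k', (k <= k')%N -> perp_ideal N y (b * (hyp_form h / hyp_form y) ^+ k').
Proof.
move=> h0 y0; have sY := chart_subring y.
apply: (@ideal_span_ind _ _ _ (fun b => exists k, forall k', (k <= k')%N ->
  perp_ideal N y (b * (hyp_form h / hyp_form y) ^+ k'))).
- by exists 0%N => k' _; rewrite mul0r; exact: ideal_span0.
- move=> u v [k hk] [m hm]; exists (maxn k m) => k'; rewrite geq_max => /andP[? ?].
  by rewrite mulrDl; apply: ideal_spanD; [exact: hk | exact: hm].
move=> u _ Ru [h' hN <-]; have [k hk] := chart_switch h0 y0 Ru.
exists k.+1 => -[//|k'] le; rewrite exprSr mulrACA [_ / _ * (hyp_form h / _)]mulrA.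
have H0 := hyp_form_neq0 h0.
rewrite (mulfVK H0); apply: (ideal_spanM sY); first exact: hk.
exact: perp_ideal_gen.
Qed.

(** When [E] contains both charts, h / y is a unit of [E], so numerator and denominator may be
    multiplied by a common power of it. *)
Lemma cen_chart_eq (E : set K) h y : local_ring E -> h != 0 -> y != 0 ->
  proj_chart h `<=` E -> proj_chart y `<=` E -> cen E (proj_chart h) = cen E (proj_chart y).
Proof.
move=> hE; have [sE _] := hE.
have main a b : a != 0 -> b != 0 -> proj_chart a `<=` E -> proj_chart b `<=` E ->
    cen E (proj_chart a) `<=` cen E (proj_chart b).
  move=> a0 b0 aE bE x /(cenP hE aE) [u [v [Ru Rv Ev v0 ->]]].
  have [k hk] := chart_switch a0 b0 Ru; have [m hm] := chart_switch a0 b0 Rv.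
  pose r := hyp_form a / hyp_form b.
  have A0 := hyp_form_neq0 a0.
  have B0 := hyp_form_neq0 b0.
  have r0 := expf_neq0 (maxn k m) (mulf_neq0 A0 (invr_neq0 B0)).
  have -> : u / v = (u * r ^+ maxn k m) / (v * r ^+ maxn k m).
    by rewrite -mulf_div (divff r0) mulr1.
  apply: cenI; [apply: hk; lia | apply: hm; lia | | exact: mulf_neq0 v0 r0].
  rewrite invfM; apply: (subringM sE Ev).
  rewrite -exprVn; apply: (subringX _ sE); rewrite invf_div.
  by apply: aE; exact: chart_div.
move=> h0 y0 hhE hyE; apply/seteqP; split.
  exact: (main h y h0 y0 hhE hyE).
exact: (main y h y0 h0 hyE hhE).
Qed.

Section Proj.
Variables (p : 'End(L)) (N : {vspace L}).
Hypotheses (hp : proj_onto p N) (N0 : N != 0%VS).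
Local Notation V := (weight_dvr p).

Lemma weight_dvr_is_dvr : exists v, weight_val_spec p v /\ dvr_val V v.
Proof.
have [v hv] := weight_val_exists p; exists v; split=> //.
exact: (weight_dvr_val hp N0 hv).
Qed.

Lemma weight_dvr_local : local_ring V.
Proof. by have [v [_ h]] := weight_dvr_is_dvr; exact: (dvr_local h). Qed.

Lemma weight_dvr_subring : is_subring V.
Proof. by have [] := weight_dvr_local. Qed.

Lemma weight_dvr_const c : V (tofrac (sym_const L c)).
Proof.
rewrite -[tofrac _]divr1 -(rmorph1 (@tofrac A)); apply/weight_dvrP; first exact: oner_neq0.
by rewrite /wsize rmorph1 size_poly1 wsize_const.
Qed.

Lemma weight_dvr_max (a b : A) : b != 0 -> (wsize p a < wsize p b)%N ->
  max_ideal V (tofrac a / tofrac b).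
Proof.
move=> b0 lt; split; first by apply/weight_dvrP => //; exact: ltnW.
have [->|a0] := eqVneq a 0; first by left; rewrite rmorph0 mul0r.
by right; rewrite invf_div => /weight_dvrP -/(_ a0); rewrite leqNgt lt.
Qed.

Lemma chart_div_dvr h h' : ~~ (N <= lker h.1)%VS -> V (hyp_form h' / hyp_form h).
Proof.
move=> hN; have h2 := wsize_form_eq hp h.2 hN.
rewrite !hyp_formE; apply/weight_dvrP; first by rewrite -(wsize_eq0 p) h2.
rewrite h2 /wsize rmorphD; apply: (leq_trans (size_polyD _ _)).
by rewrite geq_max wsize_form (leq_trans (wsize_const _ _)).
Qed.

Lemma chart_sub_dvr h : ~~ (N <= lker h.1)%VS -> proj_chart h `<=` V.
Proof.
move=> hN; apply: chart_min; first exact: weight_dvr_subring.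
  exact: weight_dvr_const.
by move=> h'; exact: chart_div_dvr.
Qed.

Lemma perp_div_max h h' : ~~ (N <= lker h.1)%VS -> (N <= lker h'.1)%VS ->
  max_ideal V (hyp_form h' / hyp_form h).
Proof.
move=> hN h'N; have h2 := wsize_form_eq hp h.2 hN.
rewrite !hyp_formE; apply: weight_dvr_max; first by rewrite -(wsize_eq0 p) h2.
by rewrite h2 ltnS (wsize_perp hp).
Qed.

Lemma max_weight_dvrD (x y : K) : max_ideal V x -> max_ideal V y -> max_ideal V (x + y).
Proof. by have [_] := weight_dvr_local; exact. Qed.

Lemma perp_ideal_max h : ~~ (N <= lker h.1)%VS -> perp_ideal N h `<=` max_ideal V.
Proof.
move=> hN; have sV := weight_dvr_subring; apply: ideal_span_ind.
- exact: max_ideal0.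
- exact: max_weight_dvrD.
move=> b _ Rb [h' h'N <-]; apply: (max_idealM sV); first exact: (chart_sub_dvr hN).
exact: perp_div_max.
Qed.

(** Congruence to a weight-0 element of [R] is stable under the ring operations, so splittings need
    only be exhibited on generators. *)
Lemma weight_split_subring (R : set K) (S : set K) : is_subring R ->
  is_subring [set b | R b /\ exists b0, [/\ R b0, weight_inv p b0 & ideal_span R S (b - b0)]].
Proof.
move=> sR; have sI := weight_inv_subring p; split.
- split; first exact: subring1.
  by exists 1; rewrite subrr; split; [exact: subring1|exact: subring1|exact: ideal_span0].
- move=> a b [Ra [a0 [Ra0 Ia0 Ja]]] [Rb [b0 [Rb0 Ib0 Jb]]]; split; first exact: subringB.
  exists (a0 - b0); split; [exact: subringB|exact: (subringB sI)|].
  have -> : a - b - (a0 - b0) = (a - a0) + (-1) * (b - b0).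
    by rewrite mulN1r !opprB addrACA [RHS]addrACA [- b + _]addrC.
  apply: ideal_spanD => //; apply: ideal_spanM => //.
  by apply: subringN => //; exact: subring1.
- move=> a b [Ra [a0 [Ra0 Ia0 Ja]]] [Rb [b0 [Rb0 Ib0 Jb]]]; split; first exact: subringM.
  exists (a0 * b0); split; [exact: subringM|exact: (subringM sI)|].
  have -> : a * b - a0 * b0 = b * (a - a0) + a0 * (b - b0).
    by rewrite !mulrBr addrA [b * a]mulrC [b * a0]mulrC subrK.
  by apply: ideal_spanD; apply: ideal_spanM.
Qed.

(** Shows that obvious generators span the whole trace of the maximal ideal: b0 = b - (b - b0) is in
    the maximal ideal and has weight 0, hence is 0. *)
Lemma weight_split_max (R S : set K) b : is_subring R -> ideal_span R S `<=` max_ideal V ->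
  (exists b0, [/\ R b0, weight_inv p b0 & ideal_span R S (b - b0)]) ->
  max_ideal V b -> ideal_span R S b.
Proof.
move=> sR JV [b0 [Rb0 Ib0 Jb]] mb; suff b00 : b0 = 0 by rewrite b00 subr0 in Jb.
apply: (weight_inv_max Ib0).
have -> : b0 = b + (-1) * (b - b0) by rewrite mulN1r opprB addrC subrK.
apply: max_weight_dvrD => //; have sV := weight_dvr_subring.
apply: (max_idealM sV); last exact: JV.
by apply: (subringN sV); exact: (subring1 sV).
Qed.

Lemma comp_proj (h : 'Hom(L, C^o)) : ((h \o p) \o p)%VF = (h \o p)%VF.
Proof.
apply/lfunP => x; rewrite !comp_lfunE; case: hp => h1 h2.
by rewrite (h2 _ (h1 x)).
Qed.

Lemma proj_perp (h : 'Hom(L, C^o)) : (N <= lker (h - (h \o p)%VF))%VS.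
Proof.
apply/subvP => x Nx; rewrite memv_ker add_lfunE opp_lfunE comp_lfunE.
by case: hp => _ /(_ x Nx) ->; rewrite subrr.
Qed.

Lemma notperp_comp (h : 'Hom(L, C^o)) : ~~ (N <= lker h)%VS -> ~~ (N <= lker (h \o p)%VF)%VS.
Proof.
move=> hN; apply: contra hN => /subvP hN; apply/subvP => x Nx.
by have := hN x Nx; rewrite !memv_ker comp_lfunE; case: hp => _ /(_ x Nx) ->.
Qed.

(** As [y] is homogeneous of weight 1, the weight-0 part of h / y is (h o p) / y; the rest, constant
    term included, vanishes on P(N). *)
Lemma chart_split (y : 'Hom(L, C^o)) b : y != 0 -> (y \o p)%VF = y -> proj_chart (y, 0) b ->
  exists b0, [/\ proj_chart (y, 0) b0, weight_inv p b0 & perp_ideal N (y, 0) (b - b0)].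
Proof.
move=> y0 ey; move: b; have sR := chart_subring (y, 0).
suff: proj_chart (y, 0) `<=` [set b | proj_chart (y, 0) b /\ exists b0,
  [/\ proj_chart (y, 0) b0, weight_inv p b0 & perp_ideal N (y, 0) (b - b0)]].
  by move=> h b /h [].
apply: chart_min; first exact: weight_split_subring.
  move=> c; split; first exact: chart_const.
  exists (tofrac (sym_const L c)); split; [exact: chart_const|exact: weight_inv_const|].
  by rewrite subrr; exact: ideal_span0.
move=> h'; split; first exact: chart_div.
exists (hyp_form ((h'.1 \o p)%VF, 0) / hyp_form (y, 0)); split; first exact: chart_div.
  by rewrite !hyp_form_lin; apply: weight_inv_div => //; exact: comp_proj.
rewrite -mulrBl -hyp_formB; apply: perp_ideal_gen; exact: proj_perp.
Qed.

Lemma notperp_neq0 h : ~~ (N <= lker h.1)%VS -> h != 0.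
Proof.
apply: contraNneq => -> /=; apply/subvP => x _.
by rewrite memv_ker zero_lfunE.
Qed.

(** A general h is not homogeneous for [p]. The argument is made in the chart of y = h o p, where
    functions split, and brought back. *)
Lemma chart_max h b : ~~ (N <= lker h.1)%VS -> proj_chart h b -> max_ideal V b ->
  perp_ideal N h b.
Proof.
move=> hN Rb mb; pose y : aff := ((h.1 \o p)%VF, 0).
have yN : ~~ (N <= lker y.1)%VS by exact: notperp_comp.
have h0 := notperp_neq0 hN; have y0 := notperp_neq0 yN.
have y10 : y.1 != 0 by apply: contraNneq yN => ->; apply/subvP => x _; rewrite memv_ker zero_lfunE.
have sV := weight_dvr_subring; have sR := chart_subring h; have sY := chart_subring y.
have [k hk] := chart_switch h0 y0 Rb; have {}hk := hk k (leqnn k).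
have : perp_ideal N y (b * (hyp_form h / hyp_form y) ^+ k).
  apply: weight_split_max => //; first exact: perp_ideal_max.
    by apply: chart_split => //; exact: comp_proj.
  by rewrite mulrC; apply: (max_idealM sV) => //; apply: (subringX _ sV); exact: chart_div_dvr.
move=> /(perp_ideal_switch y0 h0) [m hm]; have {hm} := hm (m + k)%N (leq_addr _ _).
rewrite exprD mulrCA -mulrA -exprMn mulf_div [hyp_form y * hyp_form h]mulrC divff; last first.
  exact: mulf_neq0 (hyp_form_neq0 h0) (hyp_form_neq0 y0).
rewrite expr1n mulr1 => Jb.
(* After both changes of chart only r^m b is known to be in the ideal, with r = y / h. Since h - y
   vanishes on [N], 1 - r is in the ideal, hence so is 1 - r^m. *)
have -> : b = (hyp_form y / hyp_form h) ^+ m * b + b * (1 - (hyp_form y / hyp_form h) ^+ m).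
  by rewrite mulrBr mulr1 mulrC addrC subrK.
apply: ideal_spanD => //; apply: (ideal_spanM sR Rb).
rewrite -[1](expr1n _ m) subrXX mulrC; apply: (ideal_spanM sR).
  apply: (subring_sum _ sR) => i _; rewrite expr1n mul1r.
  by apply: (subringX _ sR); exact: chart_div.
rewrite -{1}(divff (hyp_form_neq0 h0)) -mulrBl -hyp_formB.
by apply: perp_ideal_gen; exact: proj_perp.
Qed.

Lemma perp_idealE h : ~~ (N <= lker h.1)%VS -> perp_ideal N h = proj_chart h `&` max_ideal V.
Proof.
move=> hN; apply/seteqP; split=> [x Jx|x [Rx mx]]; last exact: chart_max.
by split; [exact: perp_ideal_sub Jx | exact: (perp_ideal_max hN)].
Qed.

(** The union over charts in [stratum] collapses: each term is the center of the same valuation ring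
    on projective space. *)
Lemma stratumE h : ~~ (N <= lker h.1)%VS -> stratum N = cen V (proj_chart h).
Proof.
move=> hN; apply/seteqP; split=> [x [h' [h'N]]|x].
  rewrite -/(perp_ideal N h') perp_idealE // -/(cen V _).
  rewrite (cen_chart_eq weight_dvr_local (notperp_neq0 h'N) (notperp_neq0 hN)) //;
  exact: chart_sub_dvr.
by rewrite /cen -perp_idealE // => hx; exists h.
Qed.

Lemma stratum_dom : dominates V (stratum N).
Proof.
have [h hN] := exists_notperp N0; have hN' : ~~ (N <= lker (h, 0%R : C).1)%VS by [].
rewrite (stratumE hN'); apply: cen_dom; first exact: weight_dvr_local.
  exact: chart_subring.
exact: chart_sub_dvr.
Qed.

End Proj.

Lemma exists_proj N : exists p, proj_onto p N.
Proof.
exists (projv N); split=> x; last exact: projv_id.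
exact: memv_proj.
Qed.

Section Stratum.
Variable N : {vspace L}.
Hypothesis N0 : N != 0%VS.

Lemma stratum_subring : is_subring (stratum N).
Proof.
have [p hp] := exists_proj N.
have [h hN] := exists_notperp N0; have hN' : ~~ (N <= lker (h, 0%R : C).1)%VS by [].
rewrite (stratumE hp N0 hN'); apply: cen_subring; first exact: (weight_dvr_local hp).
  exact: chart_subring.
exact: (chart_sub_dvr hp N0 hN').
Qed.

Lemma stratum_const c : stratum N (tofrac (sym_const L c)).
Proof.
have [p hp] := exists_proj N.
have [h hN] := exists_notperp N0; have hN' : ~~ (N <= lker (h, 0%R : C).1)%VS by [].
rewrite (stratumE hp N0 hN'); apply: sub_cen; first exact: (weight_dvr_local hp).
  exact: chart_subring.
exact: chart_const.
Qed.

Lemma stratum_div h h' : ~~ (N <= lker h.1)%VS -> stratum N (hyp_form h' / hyp_form h).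
Proof.
move=> hN; have [p hp] := exists_proj N; rewrite (stratumE hp N0 hN).
apply: sub_cen; first exact: (weight_dvr_local hp).
  exact: chart_subring.
exact: chart_div.
Qed.

Lemma stratum_div_max h h' : ~~ (N <= lker h.1)%VS -> (N <= lker h'.1)%VS ->
  max_ideal (stratum N) (hyp_form h' / hyp_form h).
Proof.
move=> hN h'N; have [p hp] := exists_proj N.
have [zV _] := stratum_dom hp N0.
apply: (dom_max (weight_dvr_subring hp N0) zV); first exact: stratum_div.
exact: (perp_div_max hp hN h'N).
Qed.

Lemma stratum_proj_space : @proj_space C L (stratum N).
Proof.
have [p hp] := exists_proj N.
have [h hN] := exists_notperp N0; have hN' : ~~ (N <= lker (h, 0%R : C).1)%VS by [].
exists (h, 0), (proj_chart (h, 0) `&` max_ideal (weight_dvr p)); split.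
- exact: (notperp_neq0 hN').
- apply: cen_prime; [exact: (weight_dvr_local hp)|exact: chart_subring|exact: (chart_sub_dvr hp N0 hN')].
- exact: (stratumE hp N0 hN').
Qed.

Lemma stratum_notin h h' : (N <= lker h.1)%VS -> h != 0 -> ~~ (N <= lker h'.1)%VS ->
  ~ stratum N (hyp_form h' / hyp_form h).
Proof.
move=> hN h0 h'N; rewrite -invf_div.
have [_ [/eqP|//]] := stratum_div_max h'N hN.
by rewrite mulf_eq0 invr_eq0 !hyp_form_eq0 (negbTE h0) (negbTE (notperp_neq0 h'N)).
Qed.

End Stratum.

Lemma exists_perp_notperp N M : ~~ (N <= M)%VS ->
  exists h : 'Hom(L, C^o), (M <= lker h)%VS /\ ~~ (N <= lker h)%VS.
Proof.
move=> NM; apply: contrapT => /forallNP all; move/negP: NM; apply.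
apply/subvP => x Nx.
suff e : x - projv M x = 0 by move/eqP: e; rewrite subr_eq0 => /eqP ->; exact: memv_proj.
rewrite (coord_vbasis (memvf (x - _))) big1 // => j _.
pose h := (coord_form j \o (\1 - projv M))%VF.
have hM : (M <= lker h)%VS.
  apply/subvP => y My; rewrite memv_ker comp_lfunE add_lfunE opp_lfunE id_lfunE.
  by rewrite projv_id // subrr linear0.
have /not_andP[//|/negP/negPn/subvP/(_ x Nx)] := all h.
rewrite memv_ker comp_lfunE add_lfunE opp_lfunE id_lfunE coord_formE => /eqP ->.
by rewrite scale0r.
Qed.

(** For a form h zero on [M] but not on [N], and y not zero on [M], the quotient y / h is in the
    first ring but not in the second. *)
Lemma stratum_sub N M : N != 0%VS -> M != 0%VS -> stratum N `<=` stratum M -> (N <= M)%VS.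
Proof.
move=> N0 M0 NM; apply: contraPT NM => /exists_perp_notperp [h [hM hN]] NM.
have [y yM] := exists_notperp M0.
apply: (@stratum_notin M M0 (h, 0) (y, 0)) => //.
  by apply: (@notperp_neq0 N).
by apply: NM; exact: stratum_div.
Qed.

End Strata.

Section StratumDvr.
Variables (C : fieldType) (L : vectType C).
Implicit Types (p : 'End(L)) (N M : {vspace L}).
Local Notation A := (sym_alg L).
Local Notation K := (rat_fun L).

Lemma stratum_local N : N != 0%VS -> local_ring (stratum N).
Proof.
move=> N0; have [p hp] := exists_proj N; have [zV mzV] := stratum_dom hp N0.
have sz := stratum_subring N0; split=> // x y mx my.
apply: (dom_max (weight_dvr_subring hp N0) zV).
  by apply: (subringD sz); [case: mx | case: my].
by have [_ hD] := weight_dvr_local hp N0; apply: hD; exact: mzV.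
Qed.

(** A form h zero on [M] but not on [N] would make some h / y both a non-unit of [E] and invertible
    in it. Used in both directions, this recovers the space from the divisor. *)
Lemma stratum_dom_sub (E : set K) N M : N != 0%VS -> M != 0%VS ->
  dominates E (stratum N) -> dominates E (stratum M) -> (N <= M)%VS.
Proof.
move=> N0 M0 [NE _] [_ ME]; apply: contrapT => /negP /exists_perp_notperp [h [hM hN]].
have [y yM] := exists_notperp M0.
have mE := ME _ (@stratum_div_max _ _ M M0 (y, 0) (h, 0) yM hM).
have Ei := NE _ (@stratum_div _ _ N N0 (h, 0) (y, 0) hN).
case: mE => _ [/eqP|]; last by rewrite invf_div; apply.
rewrite mulf_eq0 invr_eq0 !hyp_form_eq0.
by rewrite (negbTE (@notperp_neq0 _ _ M (y, 0) yM)) (negbTE (@notperp_neq0 _ _ N (h, 0) hN)).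
Qed.

Section Blowup.
Variables (p : 'End(L)) (N : {vspace L}).
Hypotheses (hp : proj_onto p N) (N0 : N != 0%VS).
Local Notation V := (weight_dvr p).

(** The coefficient of T^i involves i forms factoring through [p] and otherwise constants and forms
    vanishing on [N]; y^i turns the former into quotients h / y. *)
Lemma weight_coef_chart (R : set K) (y : 'Hom(L, C^o)) : y != 0 -> is_subring R ->
  (forall c, R (tofrac (sym_const L c))) ->
  (forall h : 'Hom(L, C^o), R (tofrac (sym_form h) / tofrac (sym_form y))) ->
  (forall h : 'Hom(L, C^o), (N <= lker h)%VS -> R (tofrac (sym_form h))) ->
  forall g i, R (tofrac (weight_poly p g)`_i / tofrac (sym_form y) ^+ i).
Proof.
move=> y0 sR Rc Rd Rp; have R0 := subring0 sR.
have Y0 : tofrac (sym_form y) != 0 :> K by rewrite tofrac_eq0 sym_form_eq0.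
elim/sym_alg_gen => [c|h|f g hf hg|f g hf hg] i.
- rewrite weight_poly_const coefC; case: eqP => [->|_]; last by rewrite rmorph0 mul0r.
  by rewrite expr0 divr1.
- rewrite weight_poly_form coefD coefMX !coefC; case: i => [|[|i]] /=.
  + by rewrite addr0 expr0 divr1; apply: Rp; exact: proj_perp.
  + by rewrite add0r expr1; exact: Rd.
  + by rewrite addr0 rmorph0 mul0r.
- by rewrite rmorphD coefD rmorphD mulrDl; apply: (subringD sR); [exact: hf|exact: hg].
- rewrite rmorphM coefM rmorph_sum mulr_suml; apply: (subring_sum _ sR) => j _.
  have -> : tofrac (sym_form y) ^+ i =
      tofrac (sym_form y) ^+ j * tofrac (sym_form y) ^+ (i - j) :> K.
    by rewrite -exprD subnKC // -ltnS.
  by rewrite rmorphM -mulf_div; apply: (subringM sR); [exact: hf|exact: hg].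
Qed.

(** With g_i the weight components of g, g / y^d is the sum of the (g_i / y^i) (1 / y)^(d - i). *)
Lemma weight_div_chart (R : set K) (y : 'Hom(L, C^o)) : y != 0 -> is_subring R ->
  (forall c, R (tofrac (sym_const L c))) -> R (tofrac (sym_form y))^-1 ->
  (forall h : 'Hom(L, C^o), R (tofrac (sym_form h) / tofrac (sym_form y))) ->
  (forall h : 'Hom(L, C^o), (N <= lker h)%VS -> R (tofrac (sym_form h))) ->
  forall g d, (wsize p g <= d.+1)%N -> R (tofrac g / tofrac (sym_form y) ^+ d).
Proof.
move=> y0 sR Rc Ry Rd Rp g d le.
have Y0 : tofrac (sym_form y) != 0 :> K by rewrite tofrac_eq0 sym_form_eq0.
rewrite -{1}(weight_poly_at1 p g) (horner_coef_wide _ le) rmorph_sum mulr_suml.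
apply: (subring_sum _ sR) => i _; rewrite expr1n mulr1.
have -> : (tofrac (sym_form y) ^+ d)^-1 =
    (tofrac (sym_form y) ^+ i)^-1 * (tofrac (sym_form y))^-1 ^+ (d - i) :> K.
  by rewrite exprVn -invfM -exprD; congr (_ ^+ _)^-1; have := ltn_ord i; lia.
rewrite mulrA; apply: (subringM sR); last exact: (subringX _ sR).
exact: weight_coef_chart.
Qed.

(** The chart at the uniformizer a = 1 / y contains 1 / y, all h / y, and each form h vanishing on
    [N], as (h / y) / a: this is what [weight_div_chart] asks for. *)
Lemma weight_dvr_blowup (X : set (set K)) : X (stratum N) -> blowup X (stratum N) V.
Proof.
move=> XN; have [v [hv dv]] := weight_dvr_is_dvr hp N0.
have hV := dvr_local dv; have sV := dvr_val_subring dv.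
have [zV mzV] := stratum_dom hp N0; have sz := stratum_subring N0.
have [y1 y1N] := exists_notperp N0; pose y := (y1 \o p)%VF.
have yN : ~~ (N <= lker y)%VS by exact: (notperp_comp hp).
have y0 : y != 0 by apply: contraNneq yN => ->; apply/subvP => x _; rewrite memv_ker zero_lfunE.
have Y0 : tofrac (sym_form y) != 0 :> K by rewrite tofrac_eq0 sym_form_eq0.
have sizey : wsize p (sym_form y) = 2%N.
  by have := wsize_form_eq hp 0 yN; rewrite /sym_const mpolyC0 addr0.
have [a da] : exists a : K, a = (tofrac (sym_form y))^-1 by eexists.
have ea : a = hyp_form (0, 1) / hyp_form (y, 0) by rewrite da hyp_form1 hyp_form_lin mul1r.
have ma : max_ideal (stratum N) a.
  rewrite ea; apply: (@stratum_div_max _ _ N N0 (y, 0) (0, 1) yN).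
  by apply/subvP => x _; rewrite memv_ker zero_lfunE.
have a0 : a != 0 by rewrite da invr_eq0.
have va : v a = 1.
  rewrite da -[_^-1]mul1r -(rmorph1 (@tofrac A)) hv ?oner_eq0 ?sym_form_eq0 //.
  by rewrite sizey /wsize rmorph1 size_poly1.
have ca : center_ideal (stratum N) (stratum N) a by split; [case: ma|].
pose R := blowup_chart (stratum N) (stratum N) a.
have sR : is_subring R by exact: blowup_chart_subring.
have zR : stratum N `<=` R by exact: sub_blowup_chart.
have RV : R `<=` V.
  apply: blowup_chart_min => // b [_ /(_ (@subset_refl _ _)) /mzV mb].
  apply: (dvr_div dv a0) => b0; rewrite va.
  by have := (max_ideal_dvr dv b0).1 mb; lia.
exists (stratum N), a, (R `&` max_ideal V); split=> //; first exact: cen_prime.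
apply/seteqP; split; last exact: cen_sub.
have inR : forall g d, (wsize p g <= d.+1)%N -> R (tofrac g / tofrac (sym_form y) ^+ d).
  apply: weight_div_chart => //.
  - by move=> c; apply: zR; exact: stratum_const.
  - by rewrite -da; apply: zR; case: ma.
  - move=> h; apply: zR; rewrite -!hyp_form_lin; exact: (@stratum_div _ _ N N0 (y, 0) (h, 0)).
  - move=> h hN; have -> : tofrac (sym_form h) = (tofrac (sym_form h) / tofrac (sym_form y)) / a.
      by rewrite da invrK (mulfVK Y0).
    apply: blowup_chart_div; rewrite -!hyp_form_lin; split.
      exact: (@stratum_div _ _ N N0 (y, 0) (h, 0)).
    by move=> _; exact: (@stratum_div_max _ _ N N0 (y, 0) (h, 0)).
move=> _ [f [g [g0 -> le]]]; pose Y : K := tofrac (sym_form y).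
have sg : wsize p g = (wsize p g).-1.+1 by rewrite prednK // lt0n wsize_eq0.
(* With d the degree of the denominator g along [N], g / y^d becomes a unit of the valuation
   ring. *)
pose d := (wsize p g).-1.
have Yd0 : Y ^+ d != 0 := expf_neq0 d Y0.
have G0 : tofrac g != 0 :> K by rewrite tofrac_eq0.
have -> : tofrac f / tofrac g = (tofrac f / Y ^+ d) / (tofrac g / Y ^+ d).
  by rewrite invf_div mulrA (mulfVK Yd0).
apply: cenI; [apply: inR | apply: inR | | exact: mulf_neq0 G0 (invr_neq0 Yd0)].
- by rewrite -sg.
- by rewrite -sg.
rewrite invf_div /Y -rmorphXn; apply/weight_dvrP => //.
rewrite sg /wsize rmorphXn /= (weight_poly_proj (comp_proj hp y1)) exprMn -rmorphXn.
by rewrite /= size_mulXn ?polyC_eq0 ?expf_neq0 ?sym_form_eq0 // size_polyC expf_neq0 ?sym_form_eq0 // addn1.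
Qed.

End Blowup.
End StratumDvr.

(** * The boundary divisors *)

Section Arrangement.
Variables (C : fieldType) (L : vectType C) (n : nat) (l : 'I_n -> 'Hom(L, C^o)).
Hypothesis hl : (\bigcap_(i < n) lker (l i))%VS = 0%VS.
Local Notation K := (rat_fun L).
Implicit Types F G : {set 'I_n}.

(** A form vanishing on the common kernel is a linear combination of the k i; [P] stands for any
    property stable under such combinations. Subtracting h(w) f, where w is in W and f w = 1,
    removes one form from the list. *)
Lemma perp_span (I : eqType) (r : seq I) (k : I -> 'Hom(L, C^o)) (h : 'Hom(L, C^o))
    (P : 'Hom(L, C^o) -> Prop) :
  P 0 -> (forall f g, P f -> P g -> P (f + g)) -> (forall c f, P f -> P (c *: f)) ->
  (forall i, i \in r -> P (k i)) -> (\bigcap_(i <- r) lker (k i) <= lker h)%VS -> P h.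
Proof.
move=> P0 PD PZ; elim: r h => [|i r IH] h Pr.
  rewrite big_nil => /subvP hh; suff -> : h = 0 by [].
  by apply/lfunP => x; rewrite zero_lfunE; apply/eqP; rewrite -memv_ker hh ?memvf.
rewrite big_cons; set W := (\bigcap_(i <- r) lker (k i))%VS in IH * => sub.
have Pr' : forall j, j \in r -> P (k j) by move=> j jr; apply: Pr; rewrite inE jr orbT.
have [f ef] : exists f, f = k i by eexists.
have Pf : P f by rewrite ef; apply: Pr; rewrite inE eqxx.
rewrite -ef in sub.
have [Wf|/negP nWf] := boolP (W <= lker f)%VS.
  by apply: IH => //; apply: subv_trans sub; rewrite subv_cap Wf subvv.
have [w [wW fw]] : exists w, w \in W /\ f w = 1.
  apply: contrapT => /forallNP all; apply: nWf; apply/subvP => x xW; rewrite memv_ker.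
  apply/eqP; apply: contrapT => /eqP fx; apply: (all ((f x)^-1 *: x)); split; first exact: memvZ.
  by rewrite linearZ /= [LHS]mulVf.
have -> : h = (h - h w *: f) + h w *: f by rewrite subrK.
apply: PD; last exact: PZ.
apply: IH => //; apply/subvP => x xW; rewrite memv_ker add_lfunE opp_lfunE scale_lfunE.
have : x - f x *: w \in lker h.
  apply: (subvP sub); rewrite memv_cap memv_ker linearB linearZ /= fw.
  rewrite -[_ *: 1]/(f x * 1) mulr1 subrr eqxx /=; apply: memvB => //; exact: memvZ.
rewrite memv_ker linearB linearZ /= => /eqP e.
by rewrite -[h w *: f x]/(h w * f x) mulrC; apply/eqP.
Qed.

Lemma flat_space_ker F i : i \in F -> (flat_space l F <= lker (l i))%VS.
Proof. by move=> iF; rewrite /flat_space (bigcapv_inf i) // subvv. Qed.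

Lemma flat_space_perp F (h : 'Hom(L, C^o)) (P : 'Hom(L, C^o) -> Prop) :
  P 0 -> (forall f g, P f -> P g -> P (f + g)) -> (forall c f, P f -> P (c *: f)) ->
  (forall i, i \in F -> P (l i)) -> (flat_space l F <= lker h)%VS -> P h.
Proof.
move=> P0 PD PZ Pl sub; apply: (@perp_span _ (enum F) l) => //.
  by move=> i; rewrite mem_enum; exact: Pl.
by rewrite big_enum.
Qed.

Lemma flat_mem F j : proper_flat l F -> (flat_space l F <= lker (l j))%VS -> j \in F.
Proof. by case/andP => /forallP /(_ j) /implyP h _; exact: h. Qed.

Lemma flat_space_inj F G : proper_flat l F -> proper_flat l G ->
  flat_space l F = flat_space l G -> F = G.
Proof.
move=> pF pG e; apply/setP => i; apply/idP/idP => iF.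
  by apply: flat_mem => //; rewrite -e; exact: flat_space_ker.
by apply: flat_mem => //; rewrite e; exact: flat_space_ker.
Qed.

Lemma flat_space_eq0 F : flat_space l F = 0%VS -> flat l F -> F = [set: 'I_n]%SET.
Proof.
move=> e /forallP h; apply/setP => j; rewrite inE.
by move/implyP: (h j); apply; rewrite e sub0v.
Qed.

Lemma proper_flat_neq0 F : proper_flat l F -> flat_space l F != 0%VS.
Proof. by case/andP => fF /negP nF; apply/eqP => /flat_space_eq0 e; apply: nF; rewrite e. Qed.

Local Notation s := (proper_flats l).

Lemma mem_proper_flats F : (F \in s) = proper_flat l F.
Proof. by rewrite mem_sort mem_filter mem_enum andbT. Qed.

Lemma proper_flats_uniq : uniq s.
Proof. by rewrite sort_uniq filter_uniq ?enum_uniq. Qed.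

Lemma proper_flats_order j F G : F \in take j s -> G \in drop j s ->
  F != G /\ (\dim (flat_space l F) <= \dim (flat_space l G))%N.
Proof.
move=> Fj Gj; split.
  apply/eqP => e; have := proper_flats_uniq; rewrite -{1}(cat_take_drop j s) cat_uniq.
  by case/and3P => _ /negP nh _; apply: nh; apply/hasP; exists G => //; rewrite -e.
pose r F G := (\dim (flat_space l F) <= \dim (flat_space l G))%N.
have rtr : transitive r by move=> a b c; exact: leq_trans.
have : pairwise r s.
  by rewrite -(sorted_pairwise rtr); apply: sort_sorted => a b; exact: leq_total.
rewrite -{1}(cat_take_drop j s) pairwise_cat => /and3P[/allrelP h _ _].
exact: h.
Qed.

Definition stage j : set (set K) := iterated_blowup l (take j s).

Lemma stage0 : stage 0 = @proj_space C L.
Proof. by rewrite /stage take0. Qed.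

Lemma stageS j : (j < size s)%N ->
  stage j.+1 = blowup (stage j) (stratum (flat_space l (nth finset.set0 s j))).
Proof.
by move=> js; rewrite /stage (take_nth finset.set0 js) /iterated_blowup foldl_rcons.
Qed.

Lemma wonderful_stage : wonderful l = stage (size s).
Proof. by rewrite /stage take_size. Qed.

Lemma nth_proper j : (j < size s)%N -> proper_flat l (nth finset.set0 s j).
Proof. by move=> js; rewrite -mem_proper_flats mem_nth. Qed.

Lemma proj_space_closed : loc_closed (@proj_space C L).
Proof.
move=> A [h [P [h0 hP ->]]]; split; first by apply: localization_subring => //; exact: chart_subring.
move=> Q hQ; have [hPQ ->] := localization_localization (chart_subring h) hP hQ.
by exists h, (proj_chart h `&` Q).
Qed.

Lemma stage_closed j : (j <= size s)%N -> loc_closed (stage j).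
Proof.
case: j => [|j] js; first by rewrite stage0; exact: proj_space_closed.
by rewrite stageS //; exact: blowup_loc_closed.
Qed.

(** Every center lies at infinity, so its ideal contains some nonzero 1 / y, as [blowup_keep_dvr]
    requires. *)
Lemma stage_keep_dvr E v j k : dvr_val E v -> (j <= k <= size s)%N -> stage j E -> stage k E.
Proof.
move=> dv /andP[jk ks] Ej; elim: k jk ks => [|k IH]; first by rewrite leqn0 => /eqP <-.
rewrite leq_eqVlt => /orP[/eqP <- //|jk] ks; rewrite stageS //.
have N0 := proper_flat_neq0 (nth_proper ks); have [y yN] := exists_notperp N0.
apply: (@blowup_keep_dvr _ _ _ _ _ (hyp_form (0, 1) / hyp_form (y, 0)) dv).
- by apply: IH => //; exact: ltnW.
- exact: stratum_subring.
- rewrite hyp_form1 mul1r invr_eq0 hyp_form_eq0; exact: (@notperp_neq0 _ _ _ (y, 0) yN).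
- apply: (@stratum_div_max _ _ _ N0 (y, 0) (0, 1) yN).
  by apply/subvP => x _; rewrite memv_ker zero_lfunE.
Qed.

(** The earlier centers have dimension at most that of P(L_F) and differ from it, so none contains
    it: its generic point is untouched until its turn. *)
Lemma stratum_stage F j : proper_flat l F -> (j <= index F s)%N ->
  stage j (stratum (flat_space l F)).
Proof.
move=> pF; have F0 := proper_flat_neq0 pF.
elim: j => [|j IH] js; first by rewrite stage0; exact: stratum_proj_space.
have Fs : F \in s by rewrite mem_proper_flats.
have jlt : (j < size s)%N by rewrite (leq_trans js) // ltnW // index_mem.
have pG := nth_proper jlt; have G0 := proper_flat_neq0 pG.
rewrite stageS //; apply: blowup_keep; [exact: stratum_local|by apply: IH; exact: ltnW|].
move=> /(stratum_sub F0 G0) FG.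
have [] := @proper_flats_order j.+1 (nth finset.set0 s j) F.
- by rewrite (take_nth finset.set0 jlt) mem_rcons inE eqxx.
- have : F \in take j.+1 s ++ drop j.+1 s by rewrite cat_take_drop.
  by rewrite mem_cat in_take // ltnNge js.
move=> /eqP ne dimle; apply: ne; apply: flat_space_inj => //; apply/esym/eqP.
by rewrite eqEdim FG.
Qed.

Lemma boundary_weight F p : proper_flat l F -> proj_onto p (flat_space l F) ->
  boundary_divisor l F (weight_dvr p).
Proof.
move=> pF hp; have F0 := proper_flat_neq0 pF.
have [v [_ dv]] := weight_dvr_is_dvr hp F0.
split; last exact: stratum_dom; last exact: (dvr_val_dvr dv).
apply: weight_dvr_blowup => //; exact: stratum_stage.
Qed.

Lemma boundary_uniq F G (E : set K) : proper_flat l F -> proper_flat l G ->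
  boundary_divisor l F E -> boundary_divisor l G E -> F = G.
Proof.
move=> pF pG [_ _ dF] [_ _ dG]; apply: flat_space_inj => //.
have F0 := proper_flat_neq0 pF; have G0 := proper_flat_neq0 pG.
by apply/eqP; rewrite eqEsubv !(@stratum_dom_sub _ _ E).
Qed.

(** Domination of the stratum puts 1 / y in the maximal ideal for a form y not zero on L_F. *)
Lemma boundary_polar F (E : set K) : proper_flat l F -> boundary_divisor l F E ->
  ~ (forall g : sym_alg L, E (tofrac g)).
Proof.
move=> pF [_ _ [_ dF]] Eg; have F0 := proper_flat_neq0 pF; have [y yN] := exists_notperp F0.
have := dF _ (@stratum_div_max _ _ _ F0 (y, 0) (0, 1) yN _).
rewrite hyp_form1 mul1r hyp_form_lin => -[|_ [/eqP|]].
- by apply/subvP => x _; rewrite memv_ker zero_lfunE.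
- by rewrite invr_eq0 -hyp_form_lin hyp_form_eq0 (negbTE (@notperp_neq0 _ _ _ (y, 0) yN)).
- by rewrite invrK; apply.
Qed.

Lemma weight_wonderful F p : proper_flat l F -> proj_onto p (flat_space l F) ->
  wonderful l (weight_dvr p).
Proof.
move=> pF hp; have F0 := proper_flat_neq0 pF.
have [v [_ dv]] := weight_dvr_is_dvr hp F0.
have [bE _ _] := boundary_weight pF hp.
have Fs : (index F s < size s)%N by rewrite index_mem mem_proper_flats.
rewrite wonderful_stage; apply: (@stage_keep_dvr _ _ (index F s).+1 _ dv).
  by rewrite Fs leqnn.
by rewrite stageS // nth_index // mem_proper_flats.
Qed.

Lemma boundary_sumE c F (E : set K) : proper_flat l F -> boundary_divisor l F E ->
  boundary_sum l c E = c F.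
Proof.
move=> pF bF; rewrite /boundary_sum (bigD1 F) //= big1 ?addr0; first by case: asboolP.
move=> G /andP[pG GF]; case: asboolP => // bG.
by rewrite (boundary_uniq pG pF bG bF) eqxx in GF.
Qed.

Lemma boundary_sum0 c (E : set K) : (forall g : sym_alg L, E (tofrac g)) ->
  boundary_sum l c E = 0.
Proof.
move=> Eg; rewrite /boundary_sum big1 // => F pF; case: asboolP => // bF.
by have := boundary_polar pF bF.
Qed.

End Arrangement.

(** * Discrete valuation rings with a pole on L *)

Section BlowupCen.
Variable K : fieldType.
Implicit Types (E R S z B : set K).

(** Up to units of [E], the stalk of the center is generated by [S], and [t] divides all of [S] in
    [E]. Hence t / a is a unit at the point, and the chart at the given [a] can be exchanged for the
    explicit one at [t]. *)
Lemma blowup_cen E z R S t a B : local_ring E -> is_subring R -> R `<=` E ->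
  cen E R `<=` z ->
  (forall x, cen E R x -> max_ideal z x ->
     exists u w, [/\ R w, E w^-1, w != 0, ideal_span R S u & x = u / w]) ->
  (forall x, S x -> R x /\ max_ideal z x) ->
  S t -> t != 0 -> (forall x, S x -> E (x / t)) ->
  center_ideal z (cen E R) a -> a != 0 ->
  blowup_chart z (cen E R) a `<=` B -> dominates E B -> is_subring B ->
  B = cen E (blowup_chart z (cen E R) a) ->
  B = cen E (subring_span (R `|` [set x / t | x in S])).
Proof.
move=> hE sR RE Az hA hS St t0 hSt [Aa ma] a0 chB dom sB eB.
have [sE _] := hE; have {}ma := ma Az.
set R' := subring_span _; have sR' : is_subring R' by exact: subring_spanP.
have RR' : R `<=` R' by move=> x Rx; apply: sub_subring_span; left.
have SR' x : S x -> R' (x / t) by move=> Sx; apply: sub_subring_span; right; exists x.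
have R'E : R' `<=` E by apply: subring_span_min => // x [/RE//|[b /hSt hb <-]].
have uT : forall u, ideal_span R S u -> R' (u / t).
  apply: ideal_span_ind; first by rewrite mul0r; exact: (subring0 sR').
    by move=> x y hx hy; rewrite mulrDl; exact: (subringD sR').
  by move=> b x Rb Sx; rewrite -mulrA; apply: (subringM sR'); [exact: RR'|exact: SR'].
have sA := cen_subring hE sR RE; have RA := sub_cen hE sR.
have chA := @sub_blowup_chart _ z (cen E R) a.
have [u [w [Rw Ew w0 Ju ea]]] := hA a Aa ma.
have at' : a / t = (u / t) / w by rewrite ea mulrAC.
have ta : B (t / a).
  apply: chB; apply: blowup_chart_div; have [Rt mt] := hS t St.
  by split=> //; exact: RA.
have Eta : E (t / a) by case: dom => BE _; exact: BE.
have ta0 : t / a != 0 by rewrite mulf_neq0 ?invr_eq0.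
have Eat : E (a / t) by rewrite at'; apply: (subringM sE) => //; apply: R'E; exact: uT.
have Bat : B (a / t) by rewrite -invf_div; apply: (dom_unit dom) => //; rewrite invf_div.
apply/seteqP; split; last first.
  apply: cen_min => //; apply: subring_span_min => // x [Rx|[b Sb <-]].
    by apply: chB; apply: chA; exact: RA.
  have -> : b / t = (b / a) * (a / t) by rewrite mulrA mulfVK.
  apply: (subringM sB) => //; apply: chB; apply: blowup_chart_div.
  by have [Rb mb] := hS b Sb; split=> //; exact: RA.
have sB2 := cen_subring hE sR' R'E; have dom2 := cen_dom hE sR' R'E.
have B2at : cen E R' (a / t) by rewrite at'; apply: cenI => //; [exact: uT | exact: RR'].
have B2ta : cen E R' (t / a) by rewrite -invf_div; apply: cen_unit => //; rewrite invf_div.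
rewrite eB; apply: cen_min => //; apply: blowup_chart_min => //; first exact: cen_mono.
move=> b [Ab /(_ Az) mb]; have [u' [w' [Rw' Ew' w'0 Ju' eb]]] := hA b Ab mb.
have -> : b / a = (u' / t) / w' * (t / a).
  by rewrite eb; rewrite [u' / t / w']mulrAC !mulrA mulfVK.
apply: (subringM sB2) => //; apply: cenI => //; [exact: uT | exact: RR'].
Qed.

End BlowupCen.

Section Rank1.
Variables (C : fieldType) (L : vectType C) (w : L) (f : 'Hom(L, C^o)).

Definition rank1_fun (x : L) : L := f x *: w.

Lemma rank1_linear : linear rank1_fun.
Proof. by move=> c x y; rewrite /rank1_fun linearP scalerDl scalerA. Qed.

HB.instance Definition _ := GRing.isLinear.Build C L L _ rank1_fun rank1_linear.

Definition rank1 : 'End(L) := linfun rank1_fun.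

Lemma rank1E x : rank1 x = f x *: w.
Proof. by rewrite lfunE. Qed.

End Rank1.

Section Tower.
Variables (C : fieldType) (L : vectType C) (n : nat) (l : 'I_n -> 'Hom(L, C^o)).
Hypothesis hl : (\bigcap_(i < n) lker (l i))%VS = 0%VS.
Local Notation K := (rat_fun L).
Local Notation aff := ('Hom(L, C^o) * C)%type.
Local Notation s := (proper_flats l).
Local Notation stage := (stage l).
Implicit Types (F G : {set 'I_n}) (M N : {vspace L}) (y f : 'Hom(L, C^o)) (R : set K).

Definition frac_form f : K := tofrac (sym_form f).

Lemma hyp_form_frac f : hyp_form (f, 0) = frac_form f.
Proof. exact: hyp_form_lin. Qed.

Lemma frac_formD f g : frac_form (f + g) = frac_form f + frac_form g.
Proof. by rewrite /frac_form sym_formD rmorphD. Qed.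

Lemma frac_formZ c f : frac_form (c *: f) = tofrac (sym_const L c) * frac_form f.
Proof. by rewrite /frac_form sym_formZ rmorphM. Qed.

Lemma frac_form0 : frac_form 0 = 0.
Proof. by rewrite /frac_form sym_form0 rmorph0. Qed.

Lemma frac_form_eq0 f : (frac_form f == 0) = (f == 0).
Proof. by rewrite /frac_form tofrac_eq0 sym_form_eq0. Qed.

Lemma hyp_form_split (h : aff) : hyp_form h = frac_form h.1 + tofrac (sym_const L h.2).
Proof. by rewrite hyp_formE rmorphD. Qed.

Lemma perp0 N : (N <= lker (0%R : 'Hom(L, C^o)))%VS.
Proof. by apply/subvP => x _; rewrite memv_ker zero_lfunE. Qed.

Lemma perpD N f g : (N <= lker f)%VS -> (N <= lker g)%VS -> (N <= lker (f + g)%R)%VS.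
Proof.
move=> /subvP hf /subvP hg; apply/subvP => x Nx; rewrite memv_ker add_lfunE.
by have := hf x Nx; have := hg x Nx; rewrite !memv_ker => /eqP -> /eqP ->; rewrite addr0.
Qed.

Lemma perpZ N c f : (N <= lker f)%VS -> (N <= lker (c *: f)%R)%VS.
Proof.
move=> /subvP hf; apply/subvP => x Nx; rewrite memv_ker scale_lfunE.
by have := hf x Nx; rewrite !memv_ker => /eqP ->; rewrite scaler0.
Qed.

Lemma notperp_form_neq0 N f : ~~ (N <= lker f)%VS -> f != 0.
Proof. by apply: contraNneq => ->; exact: perp0. Qed.

Lemma notperp_space N f : ~~ (N <= lker f)%VS -> N != 0%VS.
Proof. by apply: contraNneq => ->; exact: sub0v. Qed.

Lemma stage_const j A c : (j <= size s)%N -> stage j A -> A (tofrac (sym_const L c)).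
Proof.
elim: j A => [|j IH] A js.
  rewrite stage0 => -[h [P [h0 hP ->]]].
  apply: sub_localization; [exact: chart_subring|by case: hP => _ []|exact: chart_const].
rewrite stageS // => -[B [a [P [XB _ _ hP ->]]]].
apply: sub_localization; [exact: blowup_chart_subring|by case: hP => _ []|].
by apply: sub_blowup_chart; apply: IH => //; exact: ltnW.
Qed.

Variables (E : set K) (v : K -> int).
Hypothesis dv : dvr_val E v.
Hypothesis E_const : forall c, E (tofrac (sym_const L c)).

Let hE : local_ring E := dvr_local dv.
Let sE : is_subring E := dvr_val_subring dv.

Lemma tower_maxD (x z : K) : max_ideal E x -> max_ideal E z -> max_ideal E (x + z).
Proof. by case: hE => _; exact. Qed.

(** Forms are combinations of finitely many coordinates with coefficients in [E], and q^B moves all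
    coordinates into [E]. *)
Lemma form_bound : exists B : nat, forall f, f != 0 -> - B%:Z <= v (frac_form f).
Proof.
have [q q0 vq] := dvr_val_onto dv.
pose B := (\sum_(j < \dim {:L}) `|v (frac_form (coord_form j))|)%N.
exists B => f f0; have F0 : frac_form f != 0 by rewrite frac_form_eq0.
apply: (dvr_shift B dv q0 vq F0).1.
have -> : frac_form f = \sum_(j < \dim {:L}) tofrac (sym_const L (f (vbasis {:L})`_j)) * frac_form (coord_form j).
  rewrite {1}(form_coord f) /frac_form sym_form_sum rmorph_sum; apply: eq_bigr => j _.
  by rewrite sym_formZ rmorphM.
rewrite mulr_sumr; apply: (subring_sum _ sE) => j _; rewrite mulrCA.
apply: (subringM sE); first exact: E_const.
have X0 : frac_form (coord_form j) != 0.
  rewrite frac_form_eq0; apply/eqP => /lfunP /(_ (vbasis {:L})`_j) /eqP.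
  rewrite coord_formE coord_free ?(basis_free (vbasisP _)) // eqxx zero_lfunE.
  by rewrite oner_eq0.
apply: (dvr_shift B dv q0 vq X0).2.
by rewrite /B (bigD1 j) //=; lia.
Qed.

Lemma exists_min_form M f0 : (M <= lker f0)%VS -> ~ E (frac_form f0) ->
  exists y, [/\ (M <= lker y)%VS, ~ E (frac_form y) &
    forall f, (M <= lker f)%VS -> E (frac_form f / frac_form y)].
Proof.
move=> Mf0 nE0; have [B hB] := form_bound.
pose Q (k : nat) := exists f, [/\ f != 0, (M <= lker f)%VS & v (frac_form f) + B%:Z = k%:Z].
have nz f : ~ E (frac_form f) -> f != 0.
  by move=> nf; apply/eqP => e; apply: nf; rewrite e frac_form0; exact: (subring0 sE).
have exQ : exists k, `[< Q k >].
  exists `|(v (frac_form f0) + B%:Z)%R|%N; apply/asboolP; exists f0; split=> //; first exact: nz.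
  by rewrite gez0_abs //; have := hB _ (nz _ nE0); lia.
case: (ex_minnP exQ) => k /asboolP [y [y0 My vy]] min.
have ymin f : f != 0 -> (M <= lker f)%VS -> v (frac_form y) <= v (frac_form f).
  move=> fn0 Mf; have : (k <= `|(v (frac_form f) + B%:Z)%R|)%N.
    apply: min; apply/asboolP; exists f; split=> //.
    by rewrite gez0_abs //; have := hB _ fn0; lia.
  by have := hB _ fn0; lia.
exists y; split=> //.
  have Y0 : frac_form y != 0 by rewrite frac_form_eq0.
  have f00 := nz _ nE0; have X0 : frac_form f0 != 0 by rewrite frac_form_eq0.
  move/(dvr_valE dv Y0) => vy0; apply: nE0; apply: (dvr_valE dv X0).2.
  exact: le_trans vy0 (ymin _ f00 Mf0).
move=> f Mf; apply: (dvr_div dv); first by rewrite frac_form_eq0.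
by rewrite frac_form_eq0 => fn0; exact: ymin.
Qed.

Definition perp_gens N (h : aff) : set K :=
  [set hyp_form h' / hyp_form h | h' in [set h' : aff | (N <= lker h'.1)%VS]].

(** The pole of such a form is strictly milder than that of [y]: its quotient by [y] is zero at the
    center of [E]. *)
Definition next_flat M y : {set 'I_n} :=
  [set i | (M <= lker (l i))%VS && `[< max_ideal E (frac_form (l i) / frac_form y) >]]%SET.

Local Notation next_space M y := (flat_space l (next_flat M y)).

(* M is the last space L_(F_i) in the chain, y = y_(i + 1), ys lists the earlier
   y_j, R is the ring of the chart, and processed the flats already blown up. *)
Record tower_state (processed : seq {set 'I_n}) M (ys : seq 'Hom(L, C^o)) y R : Prop :=
  TowerState {
  ts_subring : is_subring R;
  ts_sub : R `<=` E;
  ts_const : forall c, R (tofrac (sym_const L c));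
  ts_perp : (M <= lker y)%VS;
  ts_pole : ~ E (frac_form y);
  ts_div : forall h : aff, (M <= lker h.1)%VS -> R (hyp_form h / frac_form y);
  ts_stratum : forall N, (M <= N)%VS -> ~~ (N <= lker y)%VS -> R `<=` stratum N;
  ts_split : forall N p, (M <= N)%VS -> ~~ (N <= lker y)%VS -> proj_onto p N ->
    (forall f, f \in y :: ys -> (f \o p)%VF = f) -> forall b, R b ->
    exists b0, [/\ R b0, weight_inv p b0 & ideal_span R (perp_gens N (y, 0)) (b - b0)];
  ts_proj : forall N, (M <= N)%VS -> exists p, proj_onto p N /\
    forall f, f \in ys -> (f \o p)%VF = f;
  ts_next : forall F, proper_flat l F -> F \notin processed ->
    cen E R `<=` stratum (flat_space l F) -> (next_space M y <= flat_space l F)%VS }.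

Lemma tower_state_mono (processed processed' : seq {set 'I_n}) M ys y R : {subset processed <= processed'} ->
  tower_state processed M ys y R -> tower_state processed' M ys y R.
Proof.
move=> sub []; split=> // F pF nF; apply: ts_next0 => //.
by apply: contra nF; exact: sub.
Qed.

Section NextFlat.
Variables (M : {vspace L}) (y : 'Hom(L, C^o)).
Hypotheses (My : (M <= lker y)%VS) (yE : ~ E (frac_form y)).

Lemma pole_neq0 : frac_form y != 0.
Proof. by apply/eqP => e; apply: yE; rewrite e; exact: (subring0 sE). Qed.

Lemma pole_inv : max_ideal E (frac_form y)^-1.
Proof. exact: (dvr_pole_inv dv yE). Qed.

(** The conclusion is linear in f and holds for the forms indexed by the flat, which span those
    vanishing on its space. *)
Lemma next_space_perp f : (next_space M y <= lker f)%VS ->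
  (M <= lker f)%VS /\ max_ideal E (frac_form f / frac_form y).
Proof.
apply: (@flat_space_perp C L n l (next_flat M y) f
  (fun f => (M <= lker f)%VS /\ max_ideal E (frac_form f / frac_form y))).
- by split; [exact: perp0 | rewrite frac_form0 mul0r; exact: (max_ideal0 sE)].
- move=> g h [Mg mg] [Mh mh]; split; first exact: perpD.
  by rewrite frac_formD mulrDl; exact: tower_maxD.
- move=> c g [Mg mg]; split; first exact: perpZ.
  by rewrite frac_formZ -mulrA; exact: (max_idealM sE).
- by move=> i; rewrite inE => /andP[Mi /asboolP].
Qed.

Lemma next_notperp : ~~ (next_space M y <= lker y)%VS.
Proof.
apply/negP => /next_space_perp [_]; rewrite divff ?pole_neq0 //.
exact: (max_ideal1 sE).
Qed.

Lemma sub_next_space : (M <= next_space M y)%VS.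
Proof. by apply/subv_bigcapP => i; rewrite inE => /andP[]. Qed.

(** If every index belonged to the flat, its space would be 0 and [y] would vanish on it, against
    [next_notperp]. *)
Lemma next_proper : proper_flat l (next_flat M y).
Proof.
apply/andP; split.
  apply/forallP => j; apply/implyP => /next_space_perp [Mj mj].
  by rewrite inE Mj; apply/asboolP.
apply/negP => /eqP e; move: next_notperp; rewrite e => /negP; apply.
have -> : flat_space l [set: 'I_n]%SET = 0%VS by rewrite -hl /flat_space; apply: eq_bigl => i; rewrite inE.
exact: sub0v.
Qed.

(** If [y] vanished on L_F, some h / y in [R] would have a pole along P(L_F), as L_F is larger than
    [M]. If l_i / y with i in F were invertible in [E], its inverse would lie in the center and have
    a pole there. *)
Lemma next_space_contains F R : is_subring R -> R `<=` E ->
  (forall h : aff, (M <= lker h.1)%VS -> R (hyp_form h / frac_form y)) ->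
  proper_flat l F -> (M <= flat_space l F)%VS -> M != flat_space l F ->
  cen E R `<=` stratum (flat_space l F) -> (next_space M y <= flat_space l F)%VS.
Proof.
move=> sR RE Rd pF MF neMF RF; have F0 := proper_flat_neq0 pF.
have RA : R `<=` cen E R by exact: sub_cen.
have y0 : y != 0 by rewrite -frac_form_eq0; exact: pole_neq0.
have yF : ~~ (flat_space l F <= lker y)%VS.
  apply/negP => yF.
  have /exists_perp_notperp [h [Mh Fh]] : ~~ (flat_space l F <= M)%VS.
    by apply: contra neMF => FM; rewrite eqEsubv MF.
  apply: (@stratum_notin _ _ _ F0 (y, 0) (h, 0)) => //; first by rewrite -hyp_form_eq0 hyp_form_frac frac_form_eq0.
  by apply: RF; apply: RA; rewrite [hyp_form (y, _)]hyp_form_frac; exact: Rd.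
apply/subv_bigcapP => i iF; apply: flat_space_ker; rewrite inE.
have Fi := flat_space_ker l iF; rewrite (subv_trans MF Fi) /=; apply/asboolP.
apply: contrapT => nm; have ei : R (frac_form (l i) / frac_form y).
  by rewrite -hyp_form_frac; apply: Rd; exact: (subv_trans MF Fi).
have Ei := notin_max_ideal (RE _ ei) nm.
have := cen_unit hE sR RE (RA _ ei) Ei; rewrite invf_div => /RF.
rewrite -!hyp_form_frac; apply: stratum_notin => //.
rewrite -hyp_form_eq0 hyp_form_frac; apply: contra_notN nm => /eqP ->.
by rewrite mul0r; exact: (max_ideal0 sE).
Qed.

End NextFlat.

Section State.
Variables (processed : seq {set 'I_n}) (M : {vspace L}) (ys : seq 'Hom(L, C^o)) (y : 'Hom(L, C^o)) (R : set K).
Hypothesis ts : tower_state processed M ys y R.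
Let N := next_space M y.

Let sR : is_subring R := ts_subring ts.
Let RE : R `<=` E := ts_sub ts.
Let My := ts_perp ts.
Let yE := ts_pole ts.

(** Adding x |-> (y - y o p)(x) w to [p] fixes [y] when y(w) = 1, leaves alone the earlier forms
    when they kill w, and keeps a projection onto [N'] as w is in [N']. *)
Lemma proj_extend N' : (M <= N')%VS -> ~~ (N' <= lker y)%VS ->
  exists p, proj_onto p N' /\ forall f, f \in y :: ys -> (f \o p)%VF = f.
Proof.
move=> MN' yN'; have [p [hp fp]] := ts_proj ts MN'.
have [p0 [[p0M _] fp0]] := ts_proj ts (subvv M).
have [w0 [w0N yw0]] : exists w, w \in N' /\ y w = 1.
  apply: contrapT => /forallNP all; move/negP: yN'; apply; apply/subvP => x xW.
  rewrite memv_ker; apply/eqP; apply: contrapT => /eqP fx.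
  apply: (all ((y x)^-1 *: x)); split; first exact: memvZ.
  by rewrite linearZ /= [LHS]mulVf.
(* [p0] projects onto [M] and fixes the earlier forms: subtracting p0 w0 kills their values and
   keeps that of [y], which vanishes on [M]. *)
pose w := w0 - p0 w0.
have yw : y w = 1.
  rewrite linearB /= yw0; have := subvP My _ (p0M w0).
  by rewrite memv_ker => /eqP ->; rewrite subr0.
have fw f : f \in ys -> f w = 0.
  by move=> /fp0 fp0'; rewrite linearB /= -[f (p0 w0)]comp_lfunE fp0' subrr.
have wN : w \in N' by apply: memvB => //; exact: (subvP MN').
have [pN pid] := hp.
exists (p + rank1 w (y - (y \o p)%VF)); split.
  split=> x; rewrite add_lfunE rank1E; first by apply: memvD => //; exact: memvZ.
  by move=> xN; rewrite add_lfunE opp_lfunE comp_lfunE pid // subrr scale0r addr0.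
move=> f; rewrite inE => /orP[/eqP ->|fys]; apply/lfunP => x.
  rewrite comp_lfunE add_lfunE rank1E linearD linearZ /= yw add_lfunE opp_lfunE comp_lfunE.
  by rewrite -[_ *: 1]/(_ * 1) mulr1 addrC subrK.
rewrite comp_lfunE add_lfunE rank1E linearD linearZ /= fw // scaler0 addr0.
by rewrite -comp_lfunE fp.
Qed.

Lemma next_neq0 : N != 0%VS.
Proof. exact: (notperp_space (next_notperp M yE)). Qed.

Lemma perp_gens_max x : perp_gens N (y, 0) x -> max_ideal E x.
Proof.
move=> [h hN <-]; rewrite hyp_form_frac hyp_form_split mulrDl; apply: tower_maxD.
  by have [] := @next_space_perp M y h.1 hN.
by apply: (max_idealM sE) => //; exact: pole_inv.
Qed.

Lemma perp_ideal_max_center x : ideal_span R (perp_gens N (y, 0)) x -> max_ideal E x.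
Proof.
move: x; apply: ideal_span_ind; [exact: (max_ideal0 sE)|exact: tower_maxD|].
by move=> b x Rb /perp_gens_max; apply: (max_idealM sE); exact: RE.
Qed.

Lemma perp_gens_stratum x : perp_gens N (y, 0) x -> R x /\ max_ideal (stratum N) x.
Proof.
move=> [h hN <-]; split.
  rewrite hyp_form_frac; apply: (ts_div ts); exact: (subv_trans (sub_next_space M y) hN).
exact: (@stratum_div_max _ _ N next_neq0 (y, 0) h (next_notperp M yE)).
Qed.

Lemma state_sub_stratum : R `<=` stratum N.
Proof. exact: (ts_stratum ts (sub_next_space M y) (next_notperp M yE)). Qed.

Lemma max_stratum_ideal x : R x -> max_ideal (stratum N) x ->
  ideal_span R (perp_gens N (y, 0)) x.
Proof.
move=> Rx mx; have MN := sub_next_space M y; have yN := next_notperp M yE.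
have [p [hp fp]] := proj_extend MN yN.
have [zV mzV] := stratum_dom hp next_neq0.
apply: (weight_split_max hp next_neq0 sR) => //; last exact: mzV.
  apply: ideal_span_ind; first exact: (max_ideal0 (weight_dvr_subring hp next_neq0)).
    exact: (max_weight_dvrD hp next_neq0).
  move=> b u Rb [h hN <-].
  apply: (max_idealM (weight_dvr_subring hp next_neq0)).
    by apply: zV; exact: state_sub_stratum.
  exact: (@perp_div_max _ _ _ _ hp (y, 0) h yN hN).
exact: (ts_split ts MN yN hp fp).
Qed.

(** The center of [E] lies on the stratum: the ideal of the stratum in [R] consists of non-units of
    [E], so denominators invertible in [E] avoid it. *)
Lemma cen_sub_stratum : cen E R `<=` stratum N.
Proof.
have sz := stratum_subring next_neq0.
move=> x /(cenP hE RE) [u [w [Ru Rw Ew w0 ->]]].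
apply: (subringM sz); first exact: state_sub_stratum.
apply: notin_max_ideal; first exact: state_sub_stratum.
move=> /(max_stratum_ideal Rw) /perp_ideal_max_center [_ [/eqP|//]].
by apply/negP.
Qed.

Lemma cen_max_stratum x : cen E R x -> max_ideal (stratum N) x ->
  exists u w, [/\ R w, E w^-1, w != 0, ideal_span R (perp_gens N (y, 0)) u & x = u / w].
Proof.
move=> /(cenP hE RE) [u [w [Ru Rw Ew w0 ex]]] mx; exists u, w; split=> //.
apply: max_stratum_ideal => //; have -> : u = w * x by rewrite ex mulrC (mulfVK w0).
apply: max_idealM => //; first exact: (stratum_subring next_neq0).
exact: state_sub_stratum.
Qed.

(** Chart of the blow-up at [y']. The constant y' = (0, 1) serves once no form vanishing on [N] has
    a pole. *)
Definition extend (y' : aff) := subring_span (R `|` perp_gens N y').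

Section Extend.
Variable y' : aff.
Hypotheses (y'N : (N <= lker y'.1)%VS) (y'0 : y' != 0)
  (y'E : forall h : aff, (N <= lker h.1)%VS -> E (hyp_form h / hyp_form y')).

Lemma extend_subring : is_subring (extend y').
Proof. exact: subring_spanP. Qed.

Lemma sub_extend : R `<=` extend y'.
Proof. by move=> x Rx; apply: sub_subring_span; left. Qed.

Lemma extend_gen (h : aff) : (N <= lker h.1)%VS -> extend y' (hyp_form h / hyp_form y').
Proof. by move=> hN; apply: sub_subring_span; right; exists h. Qed.

Lemma extend_min (S : set K) : is_subring S -> R `<=` S ->
  (forall h : aff, (N <= lker h.1)%VS -> S (hyp_form h / hyp_form y')) -> extend y' `<=` S.
Proof.
move=> sS RS hS; apply: subring_span_min => // x [|[h hN <-]]; [exact: RS | exact: hS].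
Qed.

Lemma extend_sub : extend y' `<=` E.
Proof. by apply: extend_min. Qed.

Lemma blowup_next a (B : set K) :
  center_ideal (stratum N) (cen E R) a -> a != 0 ->
  blowup_chart (stratum N) (cen E R) a `<=` B -> dominates E B -> is_subring B ->
  B = cen E (blowup_chart (stratum N) (cen E R) a) -> B = cen E (extend y').
Proof.
move=> ca a0 chB dom sB eB.
have Y0 : hyp_form (y, 0) != 0 by rewrite hyp_form_frac; exact: pole_neq0.
have Y'0 := hyp_form_neq0 y'0.
have ed (h : aff) : hyp_form h / hyp_form (y, 0) / (hyp_form y' / hyp_form (y, 0)) =
    hyp_form h / hyp_form y' by rewrite invf_div mulrA (mulfVK Y0).
have -> : extend y' = subring_span (R `|` [set x / (hyp_form y' / hyp_form (y, 0))
    | x in perp_gens N (y, 0)]).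
  rewrite /extend; congr (subring_span (_ `|` _)); apply/seteqP; split.
    move=> _ [h hN <-]; exists (hyp_form h / hyp_form (y, 0)); last exact: ed.
    by exists h.
  by move=> _ [_ [h hN <-] <-]; exists h => //; rewrite ed.
have h1 : perp_gens N (y, 0) (hyp_form y' / hyp_form (y, 0)) by exists y'.
have h2 := mulf_neq0 Y'0 (invr_neq0 Y0).
have h3 x : perp_gens N (y, 0) x -> E (x / (hyp_form y' / hyp_form (y, 0))).
  by move=> [h hN <-]; rewrite ed; exact: y'E.
exact: (blowup_cen hE sR RE cen_sub_stratum cen_max_stratum perp_gens_stratum h1 h2 h3
  ca a0 chB dom sB eB).
Qed.

End Extend.

Lemma notperp_ge N1 N2 f : (N1 <= N2)%VS -> ~~ (N1 <= lker f)%VS -> ~~ (N2 <= lker f)%VS.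
Proof. by move=> sub; apply: contra => h; exact: (subv_trans sub). Qed.

Section NextState.
Variables (y1 : 'Hom(L, C^o)) (processed' : seq {set 'I_n}).
Hypotheses (y1N : (N <= lker y1)%VS) (y1E : ~ E (frac_form y1))
  (y1min : forall f, (N <= lker f)%VS -> E (frac_form f / frac_form y1)).
Hypotheses (sub_processed : {subset processed <= processed'}) (next_processed : next_flat M y \in processed').

Lemma next_min (h : aff) : (N <= lker h.1)%VS -> E (hyp_form h / hyp_form (y1, 0)).
Proof.
move=> hN; rewrite hyp_form_frac hyp_form_split mulrDl; apply: (subringD sE); first exact: y1min.
by apply: (subringM sE) => //; have [] := pole_inv y1E.
Qed.

Lemma next_ideal N' x : ideal_span R (perp_gens N' (y, 0)) x ->
  ideal_span (extend (y1, 0)) (perp_gens N' (y1, 0)) x.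
Proof.
have sX := extend_subring (y1, 0).
move: x; apply: ideal_span_ind; [exact: ideal_span0|exact: ideal_spanD|].
move=> b _ Rb [h hN' <-].
have Y10 : hyp_form (y1, 0) != 0 by rewrite hyp_form_frac; exact: pole_neq0.
have -> : b * (hyp_form h / hyp_form (y, 0)) =
    (b * (hyp_form (y1, 0) / hyp_form (y, 0))) * (hyp_form h / hyp_form (y1, 0)).
  rewrite -mulrA; congr (b * _).
  by rewrite [hyp_form (y1, 0) / _]mulrC -mulrA [hyp_form (y1, 0) * _]mulrC (mulfVK Y10) mulrC.
apply: (ideal_spanM sX); last by apply: ideal_span_gen => //; exists h.
apply: (subringM sX); apply: sub_extend => //.
rewrite [hyp_form (y, 0)]hyp_form_frac; apply: (ts_div ts).
exact: (subv_trans (sub_next_space M y) y1N).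
Qed.

Lemma state_next : tower_state processed' N (y :: ys) y1 (extend (y1, 0)).
Proof.
have sX := extend_subring (y1, 0); have RX := @sub_extend (y1, 0).
have MN := sub_next_space M y; have yN := next_notperp M yE.
have XE : extend (y1, 0) `<=` E by apply: extend_sub; exact: next_min.
split=> //.
- by move=> c; apply: RX; exact: (ts_const ts).
- by move=> h hN; rewrite -hyp_form_frac; exact: (@extend_gen (y1, 0) h).
- move=> N' NN' yN'; have N'0 := notperp_space yN'.
  apply: extend_min; first exact: stratum_subring.
    by apply: (ts_stratum ts (subv_trans MN NN')); exact: (notperp_ge NN').
  by move=> h hN; exact: (@stratum_div _ _ N' N'0 (y1, 0) h).
- move=> N' p NN' yN' hp fp.
  have fp' f : f \in y :: ys -> (f \o p)%VF = f.
    by move=> fys; apply: fp; rewrite inE fys orbT.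
  have fpy1 : (y1 \o p)%VF = y1 by apply: fp; rewrite inE eqxx.
  suff : extend (y1, 0) `<=` [set b | extend (y1, 0) b /\ exists b0,
      [/\ extend (y1, 0) b0, weight_inv p b0 &
        ideal_span (extend (y1, 0)) (perp_gens N' (y1, 0)) (b - b0)]].
    by move=> h b /h [].
  apply: extend_min; first exact: weight_split_subring.
    move=> b Rb; split; first exact: RX.
    have [b0 [Rb0 Ib0 Jb0]] := ts_split ts (subv_trans MN NN') (notperp_ge NN' yN) hp fp' Rb.
    by exists b0; split=> //; [exact: RX | exact: next_ideal].
  move=> h hN; split; first exact: (@extend_gen (y1, 0) h).
  have hpN : (N <= lker (h.1 \o p)%VF)%VS.
    apply/subvP => x xN; rewrite memv_ker comp_lfunE.
    have [_ pid] := hp; rewrite pid ?(subvP NN') //.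
    by have := subvP hN x xN; rewrite memv_ker.
  exists (hyp_form ((h.1 \o p)%VF, 0) / hyp_form (y1, 0)); split.
  + exact: (@extend_gen (y1, 0) ((h.1 \o p)%VF, 0)).
  + rewrite [hyp_form (_ \o _, _)%VF]hyp_form_frac [hyp_form (y1, 0)]hyp_form_frac /frac_form; apply: weight_inv_div => //.
    * exact: (notperp_form_neq0 yN').
    * exact: (comp_proj hp).
  + rewrite -mulrBl -hyp_formB; apply: ideal_span_gen => //.
    by exists (h - ((h.1 \o p)%VF, 0)) => //=; exact: (proj_perp hp).
- move=> N' NN'; have [p [hp fp]] := proj_extend (subv_trans MN NN') (notperp_ge NN' yN).
  by exists p.
move=> F pF nF XF.
have nF' : F \notin processed by apply: contra nF; exact: sub_processed.
have RF : cen E R `<=` stratum (flat_space l F).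
  by move=> x Rx; apply: XF; move: x Rx; exact: cen_mono.
(* The previous state already places [N] inside L_F, and strictly so because the flat of [N] has
   been processed: [next_space_contains] applies. *)
have NF := ts_next ts pF nF' RF.
apply: next_space_contains XF => //.
- by move=> h hN; rewrite -hyp_form_frac; exact: (@extend_gen (y1, 0) h).
- apply/eqP => e; move/negP: nF; apply; rewrite -(_ : next_flat M y = F) //.
  by apply: flat_space_inj e => //; exact: (next_proper M yE).
Qed.

End NextState.

Section Terminal.
Hypothesis Nreg : forall f, (N <= lker f)%VS -> E (frac_form f).
Local Notation X := (extend (0, 1)).

Lemma terminal_min (h : aff) : (N <= lker h.1)%VS -> E (hyp_form h / hyp_form (0, 1)).
Proof.
move=> hN; rewrite hyp_form1 divr1 hyp_form_split; apply: (subringD sE) => //; exact: Nreg.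
Qed.

(** For such an F on whose stratum the center lay, L_F would strictly contain [N]. A form vanishing
    on [N] but not on L_F is now regular on the chart, yet has a pole along P(L_F). *)
Lemma terminal_away F : proper_flat l F -> F \notin processed -> F != next_flat M y ->
  ~ (cen E X `<=` stratum (flat_space l F)).
Proof.
move=> pF nF neF XF; have F0 := proper_flat_neq0 pF.
have RF : cen E R `<=` stratum (flat_space l F).
  by move=> x Rx; apply: XF; move: x Rx; apply: cen_mono; exact: sub_extend.
have NF := ts_next ts pF nF RF.
have /exists_perp_notperp [h [Nh Fh]] : ~~ (flat_space l F <= N)%VS.
  apply: contra neF => FN; apply/eqP; apply: (flat_space_inj pF (next_proper M yE)).
  by apply/eqP; rewrite eqEsubv FN.
apply: (@stratum_notin _ _ _ F0 (0, 1) (h, 0)) => //; first exact: perp0.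
  by rewrite -hyp_form_eq0 hyp_form1 oner_eq0.
apply: XF; apply: (sub_cen hE (extend_subring _)).
exact: (@extend_gen (0, 1) (h, 0)).
Qed.

(** By [dvr_sub_eq] one inclusion suffices. A denominator in the maximal ideal of [weight_dvr p]
    would be in the ideal generated by the h / y, hence a non-unit of [E]. *)
Lemma terminal_weight : E = cen E X -> exists p, proj_onto p N /\ E = weight_dvr p.
Proof.
move=> eE; have MN := sub_next_space M y; have yN := next_notperp M yE.
have [p [hp fp]] := proj_extend MN yN; exists p; split=> //.
have [v' [_ dv']] := weight_dvr_is_dvr hp next_neq0.
have sV := weight_dvr_subring hp next_neq0; have hV := weight_dvr_local hp next_neq0.
have [zV mzV] := stratum_dom hp next_neq0.
have sX := extend_subring (0, 1); have RX := @sub_extend (0, 1).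
have XE : X `<=` E by apply: extend_sub; exact: terminal_min.
have XV : X `<=` weight_dvr p.
  apply: extend_min => //; first by apply: (subset_trans _ zV); exact: state_sub_stratum.
  move=> h hN; rewrite hyp_form1 divr1 hyp_form_split; apply: (subringD sV); last exact: weight_dvr_const.
  rewrite -[frac_form _]divr1 -(rmorph1 (@tofrac _)); apply/weight_dvrP; first exact: oner_neq0.
  by rewrite /wsize rmorph1 size_poly1 (weight_poly_perp hp) // size_polyC_leq1.
have split_X : X `<=` [set b | X b /\ exists b0,
    [/\ X b0, weight_inv p b0 & ideal_span X (perp_gens N (y, 0)) (b - b0)]].
  apply: extend_min; first exact: weight_split_subring.
    move=> b Rb; split; first exact: RX.
    have [b0 [Rb0 Ib0 Jb0]] := ts_split ts MN yN hp fp Rb.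
    exists b0; split=> //; first exact: RX.
    by move: Jb0; apply: ideal_span_mono.
  move=> h hN; have Xh := @extend_gen (0, 1) h hN; split=> //.
  exists (hyp_form h / hyp_form (0, 1)); split=> //; last by rewrite subrr; exact: ideal_span0.
  rewrite hyp_form1 divr1 hyp_form_split; apply: (subringD (weight_inv_subring p)).
    exact: (weight_inv_perp hp).
  exact: weight_inv_const.
have JE : ideal_span X (perp_gens N (y, 0)) `<=` max_ideal E.
  apply: ideal_span_ind; [exact: (max_ideal0 sE)|exact: tower_maxD|].
  by move=> b x Xb /perp_gens_max; apply: (max_idealM sE); exact: XE.
have JV : ideal_span X (perp_gens N (y, 0)) `<=` max_ideal (weight_dvr p).
  apply: ideal_span_ind; [exact: (max_ideal0 sV)|exact: (max_weight_dvrD hp next_neq0)|].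
  by move=> b x Xb /perp_gens_stratum [_ /mzV]; apply: (max_idealM sV); exact: XV.
apply: (dvr_sub_eq dv dv') => x; rewrite {1}eE => /(cenP hE XE) [u [w [Xu Xw Ew w0 ->]]].
apply: (subringM sV); first exact: XV.
apply: notin_max_ideal; first exact: XV.
move=> mw; have [_ sw] := split_X w Xw.
have [_ [/eqP|//]] := JE _ (weight_split_max hp next_neq0 sX JV sw mw).
by apply/negP.
Qed.

End Terminal.

End State.

Lemma tower_base g : ~ E (tofrac g) ->
  exists y, tower_state [::] 0%VS [::] y (proj_chart (y, 0)).
Proof.
move=> nEg.
have [f nEf] : exists f, ~ E (frac_form f).
  apply: contrapT => /forallNP all; apply: nEg; move: g; apply: sym_alg_gen => //.
  - by move=> h; apply: contrapT => /all.
  - by move=> a b Ea Eb; rewrite rmorphD; exact: (subringD sE).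
  - by move=> a b Ea Eb; rewrite rmorphM; exact: (subringM sE).
have [y [_ yE ymin]] := exists_min_form (sub0v (lker f)) nEf.
exists y; have sR := chart_subring (y, 0).
have RE : proj_chart (y, 0) `<=` E.
  apply: chart_min => // h; rewrite hyp_form_frac hyp_form_split mulrDl; apply: (subringD sE).
    by apply: ymin; exact: sub0v.
  by apply: (subringM sE) => //; have [] := pole_inv yE.
have Rd (h : aff) : (0 <= lker h.1)%VS -> proj_chart (y, 0) (hyp_form h / frac_form y).
  by move=> _; rewrite -hyp_form_frac; exact: chart_div.
split=> //.
- by move=> c; exact: chart_const.
- exact: sub0v.
- move=> N _ yN; have N0 := notperp_space yN; apply: chart_min; first exact: stratum_subring.
    exact: stratum_const.
  by move=> h; exact: (@stratum_div _ _ N N0 (y, 0) h).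
- move=> N p _ yN hp fp b Rb; apply: chart_split => //; first exact: (notperp_form_neq0 yN).
  by apply: fp; rewrite inE eqxx.
- by move=> N _; have [p hp] := exists_proj N; exists p.
- move=> F pF _ RF; apply: next_space_contains RF => //; first exact: sub0v.
  by rewrite eq_sym; exact: proper_flat_neq0.
Qed.

Lemma nth_drop_mem j : (j < size s)%N ->
  nth finset.set0 s j \in drop j s /\ nth finset.set0 s j \notin take j s.
Proof.
move=> js; have Gd : nth finset.set0 s j \in drop j s.
  by rewrite (drop_nth finset.set0 js) inE eqxx.
split=> //; apply/negP => Gt; have [] := proper_flats_order Gt Gd.
by rewrite eqxx.
Qed.

Lemma mem_take_drop j F : proper_flat l F -> F \notin take j s -> F \in drop j s.
Proof.
rewrite -mem_proper_flats -{1}(cat_take_drop j s) mem_cat => /orP[|//].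
by move=> h /negP.
Qed.

(* In the second case, no form vanishing on the last space has a pole along E. *)
Definition tower_center j (A : set K) : Prop :=
  (exists M ys y R, [/\ tower_state (take j s) M ys y R,
     next_flat M y \notin take j s & A = cen E R]) \/
  (exists M ys y R, [/\ tower_state (take j s) M ys y R, next_flat M y \in take j s,
     forall f, (next_space M y <= lker f)%VS -> E (frac_form f)
     & A = cen E (extend M y R (0, 1))]).

(** If the next flat is the one being blown up, the state advances or becomes terminal; otherwise
    the center misses the stratum and stays the same. *)
Lemma tower_center_step j A a (B : set K) : (j < size s)%N -> tower_center j A ->
  is_subring A -> dominates E A -> is_subring B -> dominates E B ->
  center_ideal (stratum (flat_space l (nth finset.set0 s j))) A a -> a != 0 ->
  blowup_chart (stratum (flat_space l (nth finset.set0 s j))) A a `<=` B ->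
  B = cen E (blowup_chart (stratum (flat_space l (nth finset.set0 s j))) A a) ->
  tower_center j.+1 B.
Proof.
move=> js; set G := nth _ s j => hA sA domA sB domB ca a0 chB eB.
have pG : proper_flat l G := nth_proper js.
have [Gd nGt] := nth_drop_mem js.
have tS : take j.+1 s = rcons (take j s) G by rewrite (take_nth finset.set0 js).
have sub : {subset take j s <= take j.+1 s} by move=> F; rewrite tS mem_rcons inE orbC => ->.
have Gt : G \in take j.+1 s by rewrite tS mem_rcons inE eqxx.
have BE : B `<=` E by case: domB.
have away : ~ (A `<=` stratum (flat_space l G)) -> B = A.
  move=> nAz; apply: (blowup_away hE sA domA a0 nAz ca) => //.
  exact: (subset_trans chB).
case: hA => -[M [ys [y [R]]]] [ts].
  move=> nn eA; have yE := ts_pole ts; have pn := next_proper M yE.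
  have [eG|neG] := eqVneq (next_flat M y) G.
    have nt : next_flat M y \in take j.+1 s by rewrite eG.
    rewrite eA -eG in ca chB eB.
    have [[f [Nf nEf]]|nof] := pselect (exists f, (next_space M y <= lker f)%VS /\ ~ E (frac_form f)).
      have [y1 [Ny1 y1E y1min]] := exists_min_form Nf nEf.
      have y10 : (y1, 0) != 0 :> aff by rewrite -hyp_form_eq0 hyp_form_frac; exact: pole_neq0.
      left; exists (next_space M y), (y :: ys), y1, (extend M y R (y1, 0)); split.
      + exact: (state_next ts Ny1 y1E y1min sub nt).
      (* The new space contains the one just blown up, and a processed flat has at most its
         dimension: the two would coincide, but [y1] vanishes on only one of them. *)
      + apply/negP => n1t.
        have dimle : (\dim (next_space (next_space M y) y1) <= \dim (flat_space l G))%N.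
          move: n1t; rewrite tS mem_rcons inE => /orP[/eqP -> //|n1t].
          by have [] := proper_flats_order n1t Gd.
        have := next_notperp (next_space M y) y1E.
        suff -> : next_space (next_space M y) y1 = next_space M y by rewrite Ny1.
        by rewrite -eG in dimle; apply/esym/eqP; rewrite eqEdim sub_next_space dimle.
      + exact: (@blowup_next _ _ _ _ _ ts (y1, 0) Ny1 y10 (next_min y1E y1min) a B ca a0 chB domB sB eB).
    have Nreg f : (next_space M y <= lker f)%VS -> E (frac_form f).
      by move=> Nf; apply: contrapT => nEf; apply: nof; exists f.
    right; exists M, ys, y, R; split=> //; first exact: (tower_state_mono sub ts).
    have n01 : (0, 1) != 0 :> aff by rewrite -hyp_form_eq0 hyp_form1 oner_eq0.
    exact: (@blowup_next _ _ _ _ _ ts (0, 1) (perp0 _) n01 (terminal_min Nreg) a B ca a0 chB domB sB eB).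
  have nn' : next_flat M y \notin take j.+1 s.
    by rewrite tS mem_rcons inE negb_or neG.
  left; exists M, ys, y, R; split=> //; first exact: (tower_state_mono sub ts).
  (* If the center lay on the stratum of [G], the next space would be inside L_G; being still to
     come, it has at least the dimension of L_G, so they would be equal. *)
  rewrite away // eA => Az; move/eqP: neG; apply; apply: (flat_space_inj pn pG).
  have [_ dimle] := proper_flats_order Gt (mem_take_drop pn nn').
  by apply/eqP; rewrite eqEdim dimle (ts_next ts pG nGt Az).
move=> nt Nreg eA; right; exists M, ys, y, R; split=> //.
- exact: (tower_state_mono sub ts).
- exact: sub.
rewrite away // eA; apply: (terminal_away ts) => //.
by apply/eqP => e; move: nGt; rewrite -/G e nt.
Qed.

Lemma tower_centerP g j A : ~ E (tofrac g) -> (j <= size s)%N ->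
  stage j A -> dominates E A -> tower_center j A.
Proof.
move=> nEg; elim: j A => [|j IH] A js.
  rewrite stage0 => -[h [P [h0 hP eA]]] dom; have [y ts] := tower_base nEg.
  left; exists 0%VS, [::], y, (proj_chart (y, 0)); rewrite take0; split=> //.
  have yE := ts_pole ts.
  have y0 : (y, 0) != 0 :> aff by rewrite -hyp_form_eq0 hyp_form_frac; exact: pole_neq0.
  have -> : A = cen E (proj_chart h).
    by rewrite eA; apply: localization_cen => //; [exact: chart_subring|rewrite -eA].
  apply: cen_chart_eq => //; last exact: (ts_sub ts).
  have [AE _] := dom; apply: (subset_trans _ AE); rewrite eA.
  by apply: sub_localization; [exact: chart_subring | case: hP => _ []].
move=> Aj dom.
have [sA _] := stage_closed js Aj.
rewrite stageS // in Aj; have pG := nth_proper js.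
have sz := stratum_subring (proper_flat_neq0 pG).
have [A' [a [[A'j sA'] dom' [ca a0] chA eA]]] :=
  blowup_over sz hE (@stage_closed _ _ _ l j (ltnW js)) Aj dom.
exact: (tower_center_step js (IH _ (ltnW js) A'j dom') sA' dom' sA dom ca a0 chA eA).
Qed.

Lemma polar_dvr g : wonderful l E -> ~ E (tofrac g) ->
  exists F p, [/\ proper_flat l F, proj_onto p (flat_space l F) & E = weight_dvr p].
Proof.
rewrite wonderful_stage => Ew nEg.
(* As a point of W_L, [E] is its own center. All proper flats are processed, which leaves the
   terminal case. *)
have := @tower_centerP g (size s) E nEg (leqnn _) Ew (conj (@subset_refl _ E) (@subset_refl _ _)).
case=> -[M [ys [y [R [ts]]]]]; rewrite take_size mem_proper_flats.
  by rewrite (next_proper M (ts_pole ts)).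
move=> pn Nreg eE; have [p [hp ep]] := terminal_weight ts Nreg eE.
by exists (next_flat M y), p.
Qed.

End Tower.

(** * Rational functions without poles on L *)

Section Nonvanishing.
Variable C : fieldType.
Hypothesis natC_inj : injective (fun k : nat => k%:R : C).

Lemma poly_nonroot (q : {poly C}) : q != 0 -> exists t, q.[t] != 0.
Proof.
move=> q0; apply: contrapT => /forallNP all.
have := @max_poly_roots _ q [seq k%:R | k <- iota 0 (size q)] q0.
rewrite size_map size_iota ltnn map_inj_uniq // iota_uniq => /(_ _ isT) h.
suff : false by []. apply: h; apply/allP => t _; rewrite rootE.
by have /negP/negPn := all t.
Qed.

End Nonvanishing.

(** * Linear coordinate changes that make a polynomial monic *)

Section Direction.
Variables (C : fieldType) (n : nat) (c : 'I_n -> C) (c0 : C).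
Hypothesis c00 : c0 != 0.
Local Notation A := {mpoly C[n.+1]}.
Local Notation A0 := {mpoly C[n]}.

(** Coordinates adapted to the direction (c, c0): a point is written (x, 0) + T (c, c0), so T is the
    last coordinate divided by c0. *)
Definition dir_var (i : 'I_n.+1) : {poly A0} :=
  if unlift ord_max i is Some j then ('X_j)%:P + ((c j)%:MP)%:P * 'X
  else (c0%:MP)%:P * 'X.

Definition dir_poly : A -> {poly A0} := mmap ((@polyC A0) \o (@mpolyC n C)) dir_var.

HB.instance Definition _ := GRing.RMorphism.copy dir_poly
  (mmap ((@polyC A0) \o (@mpolyC n C)) dir_var).

Definition undir_var (j : 'I_n) : A := 'X_(lift ord_max j) - (c j / c0)%:MP * 'X_ord_max.

Definition undir_coef : A0 -> A := mmap (@mpolyC n.+1 C) undir_var.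

HB.instance Definition _ := GRing.RMorphism.copy undir_coef (mmap (@mpolyC n.+1 C) undir_var).

Definition undir (q : {poly A0}) : A :=
  (map_poly undir_coef q).[(c0^-1)%:MP * 'X_ord_max].

HB.instance Definition _ := GRing.RMorphism.copy undir
  (horner_eval ((c0^-1)%:MP * 'X_ord_max) \o map_poly undir_coef).

Lemma dir_polyD f g : dir_poly (f + g) = dir_poly f + dir_poly g.
Proof. exact: rmorphD. Qed.

Lemma dir_polyM f g : dir_poly (f * g) = dir_poly f * dir_poly g.
Proof. exact: rmorphM. Qed.

Lemma undirD f g : undir (f + g) = undir f + undir g.
Proof. exact: rmorphD. Qed.

Lemma undirM f g : undir (f * g) = undir f * undir g.
Proof. exact: rmorphM. Qed.

Lemma undir_coefD f g : undir_coef (f + g) = undir_coef f + undir_coef g.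
Proof. exact: rmorphD. Qed.

Lemma undir_coefM f g : undir_coef (f * g) = undir_coef f * undir_coef g.
Proof. exact: rmorphM. Qed.

Lemma dir_polyC a : dir_poly a%:MP = (a%:MP)%:P.
Proof. exact: mmapC. Qed.

Lemma dir_polyX i : dir_poly 'X_i = dir_var i.
Proof. by rewrite /dir_poly mmapX mmap1U. Qed.

Lemma undir_coefC a : undir_coef a%:MP = a%:MP.
Proof. exact: mmapC. Qed.

Lemma undir_coefX j : undir_coef 'X_j = undir_var j.
Proof. by rewrite /undir_coef mmapX mmap1U. Qed.

Lemma undirC a : undir a%:P = undir_coef a.
Proof. by rewrite /undir map_polyC hornerC. Qed.

Lemma undirX : undir 'X = (c0^-1)%:MP * 'X_ord_max.
Proof. by rewrite /undir map_polyX hornerX. Qed.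

Lemma dir_polyK : cancel dir_poly undir.
Proof.
apply: mpoly_gen => [a|i|f g hf hg|f g hf hg].
- by rewrite dir_polyC undirC undir_coefC.
- rewrite dir_polyX /dir_var; case: unliftP => [j ->|->].
    rewrite undirD undirM undirX !undirC undir_coefC undir_coefX /undir_var.
    by rewrite mulrA -mpolyCM subrK.
  by rewrite undirM undirX undirC undir_coefC mulrA -mpolyCM divff // mpolyC1 mul1r.
- by rewrite dir_polyD undirD; exact: (congr2 +%R hf hg).
- by rewrite dir_polyM undirM; exact: (congr2 *%R hf hg).
Qed.

Lemma dir_poly_max : dir_poly 'X_ord_max = (c0%:MP)%:P * 'X.
Proof. by rewrite dir_polyX /dir_var unlift_none. Qed.

Lemma dir_poly_undir_coef a : dir_poly (undir_coef a) = a%:P.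
Proof.
move: a; apply: mpoly_gen => [a|j|f g hf hg|f g hf hg].
- by rewrite undir_coefC dir_polyC.
- rewrite undir_coefX /undir_var rmorphB rmorphM /= dir_poly_max dir_polyC dir_polyX.
  have e : ((c j / c0)%:MP_[n])%:P * (c0%:MP_[n])%:P = ((c j)%:MP_[n])%:P :> {poly A0}.
    rewrite -[LHS](polyCM (c j / c0)%:MP_[n] c0%:MP_[n]).
    by rewrite -mpolyCM mulfVK.
  rewrite /dir_var liftK mulrA e; exact: addrK.
- by rewrite undir_coefD dir_polyD polyCD; exact: (congr2 +%R hf hg).
- by rewrite undir_coefM dir_polyM polyCM; exact: (congr2 *%R hf hg).
Qed.

Lemma undirK : cancel undir dir_poly.
Proof.
apply: poly_ind => [|q a IH]; first by rewrite (rmorph0 undir) (rmorph0 dir_poly).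
rewrite undirD dir_polyD undirM dir_polyM.
rewrite IH undirC dir_poly_undir_coef undirX dir_polyM.
have e : ((c0^-1)%:MP_[n])%:P * (c0%:MP_[n])%:P = 1 :> {poly A0}.
  rewrite -[LHS](polyCM (c0^-1)%:MP_[n] c0%:MP_[n]).
  by rewrite -mpolyCM mulVf.
have e' : ((c0^-1)%:MP_[n])%:P * ((c0%:MP_[n])%:P * 'X) = 'X :> {poly A0}.
  by rewrite mulrA e mul1r.
by rewrite dir_poly_max dir_polyC e'.
Qed.

(** The constant [x] may be 0, which makes the predicate multiplicative without conditions. *)
Definition top_at (u : {poly A0}) (i : nat) (x : C) := (size u <= i.+1)%N /\ u`_i = x%:MP.

Lemma top_atM u v i j x y : top_at u i x -> top_at v j y -> top_at (u * v) (i + j) (x * y).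
Proof.
move=> [su eu] [sv eval_at]; split.
  by apply: (leq_trans (size_polyMleq _ _)); lia.
rewrite coefM (bigD1 (inord i)) //= inordK ?ltnS ?leq_addr // addKn eu eval_at.
rewrite big1 ?addr0 ?mpolyCM // => k /negP ki.
have [lt|le] := ltnP k i.
  by rewrite [v`_ _]nth_default ?mulr0 // (leq_trans sv) //; lia.
rewrite [u`_ _]nth_default ?mul0r // (leq_trans su) // ltn_neqAle le andbT.
by apply/negP => /eqP e; apply: ki; apply/eqP/val_inj; rewrite /= inordK ?ltnS ?leq_addr.
Qed.

Lemma top_atX u i x k : top_at u i x -> top_at (u ^+ k) (k * i) (x ^+ k).
Proof.
move=> h; elim: k => [|k IH]; last by rewrite !exprS mulSn; exact: top_atM.
by rewrite !expr0 mul0n; split; rewrite ?size_poly1 // coefC eqxx mpolyC1.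
Qed.

Definition dir_point (i : 'I_n.+1) : C := if unlift ord_max i is Some j then c j else c0.

Lemma top_at_monomial (m : 'X_{1..n.+1}) :
  top_at (dir_poly 'X_[m]) (mdeg m) (\prod_(i < n.+1) dir_point i ^+ m i).
Proof.
have -> : dir_poly 'X_[m] = \prod_(i < n.+1) dir_var i ^+ m i.
  by rewrite mpolyXE_id rmorph_prod; apply: eq_bigr => i _; rewrite rmorphXn /= dir_polyX.
rewrite mdegE; elim/big_rec3: _ => [|i u d x _ h].
  by split; rewrite ?size_poly1 // coefC eqxx mpolyC1.
apply: top_atM => //; rewrite -[X in top_at _ X]muln1; apply: top_atX.
rewrite /dir_var /dir_point; case: unliftP => [j _|_]; split.
- rewrite (leq_trans (size_polyD _ _)) // geq_max (leq_trans (size_polyC_leq1 _)) //=.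
  by rewrite (leq_trans (size_polyMleq _ _)) // size_polyX addn2 /= ltnS size_polyC_leq1.
- by rewrite coefD coefC add0r coefMX coefC.
- by rewrite (leq_trans (size_polyMleq _ _)) // size_polyX addn2 /= ltnS size_polyC_leq1.
- by rewrite coefMX coefC.
Qed.

End Direction.

Section Generic.
Variable C : fieldType.
Hypothesis natC_inj : injective (fun k : nat => k%:R : C).

(** The direction (0, 1) merely singles out the last variable; a point where the leading coefficient
    is nonzero leaves a nonzero polynomial in one variable. *)
Lemma mpoly_nonvanish n (p : {mpoly C[n]}) : p != 0 -> exists x, p.@[x] != 0.
Proof.
elim: n p => [|n IH] p p0.
  exists (fun _ => 0); apply: contraNneq p0 => e; apply/eqP; move: e.
  have -> : p = (p@_0%MM)%:MP.
    apply/mpolyP => m; rewrite mcoeffC; have -> : m = 0%MM by apply/mnmP => -[].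
    by rewrite eqxx mulr1.
  by rewrite mevalC => ->; rewrite mpolyC0.
have q0 : dir_poly (fun _ => 0) 1 p != 0.
  by rewrite -(rmorph0 (dir_poly (fun _ => 0) 1)) (can_eq (dir_polyK _ (oner_neq0 C))).
have [y hy] : exists y, map_poly (meval y) (dir_poly (fun _ => 0) 1 p) != 0.
  have := IH _ (_ : lead_coef (dir_poly (fun _ => 0) 1 p) != 0); rewrite lead_coef_eq0.
  move=> /(_ q0) [y hy]; exists y; apply: contraNneq hy => e.
  by rewrite lead_coefE -coef_map e coef0.
have [t ht] := poly_nonroot natC_inj hy.
exists (fun i => if unlift ord_max i is Some j then y j else t).
congr (_ != 0) : ht; move: (p); apply: mpoly_gen => [a|i|f g hf hg|f g hf hg].
- by rewrite dir_polyC map_polyC hornerC /= !mevalC.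
- rewrite dir_polyX mevalXU /dir_var; case: unliftP => [j _|_].
    rewrite mpolyC0 polyC0 mul0r addr0 map_polyC hornerC /= mevalXU //.
  by rewrite mpolyC1 mul1r map_polyX hornerX.
- by rewrite mevalD dir_polyD (rmorphD (map_poly _)) hornerD; exact: (congr2 +%R hf hg).
- by rewrite mevalM dir_polyM (rmorphM (map_poly _)) hornerM; exact: (congr2 *%R hf hg).
Qed.

(** The coefficient of T^d in direction [w] is the value at [w] of the part [q] of top degree d. *)
Lemma exists_monic_dir n (b : {mpoly C[n.+1]}) : b != 0 ->
  exists c c0 x, [/\ c0 != 0, x != 0 & lead_coef (dir_poly c c0 b) = x%:MP].
Proof.
move=> b0; pose d := (msize b).-1.
have sb : msize b = d.+1 by rewrite prednK // lt0n msize_poly_eq0.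
pose q : {mpoly C[n.+1]} := \sum_(m <- msupp b | mdeg m == d) b@_m *: 'X_[m].
have q0 : q != 0.
  have mb : mlead b \in msupp b by exact: mlead_supp.
  apply: contraTneq mb => e; rewrite -mcoeff_eq0.
  have := congr1 (mcoeff (mlead b)) e; rewrite mcoeff0 /q raddf_sum /=.
  rewrite -big_filter (bigD1_seq (mlead b)) ?filter_uniq ?msupp_uniq //=.
    rewrite mcoeffZ mcoeffX eqxx mulr1 big1 ?addr0 => [->//|m /negbTE mn].
    by rewrite mcoeffZ mcoeffX mn mulr0.
  by rewrite mem_filter mlead_supp // andbT -eqSS -sb mlead_deg.
have x0 : 'X_ord_max != 0 :> {mpoly C[n.+1]}.
  apply/eqP => /(congr1 (mcoeff U_(ord_max)%MM)).
  by rewrite mcoeffXU eqxx mcoeff0 => /eqP; rewrite oner_eq0.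
(* The factor ['X_ord_max] makes the last coordinate of [w], the future c0, nonzero as well. *)
have xq0 := mulf_neq0 x0 q0.
have [w] := mpoly_nonvanish xq0; rewrite mevalM mevalXU mulf_eq0 negb_or => /andP[w0 wq].
exists (fun j => w (lift ord_max j)), (w ord_max), q.@[w]; split=> //.
set c := fun j => _; set T := dir_poly c (w ord_max) b.
have dp i : dir_point c (w ord_max) i = w i.
  by rewrite /dir_point /c; case: unliftP => [j ->|->].
have [sT cT] : top_at T d q.@[w].
  have [T1 T2] : (size T <= d.+1)%N /\ T`_d = (q.@[w])%:MP; last by split.
  have eT : T = \sum_(m <- msupp b) ((b@_m)%:MP)%:P * dir_poly c (w ord_max) 'X_[m].
    rewrite /T {1}[b]mpolyE rmorph_sum; apply: eq_bigr => m _.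
    by rewrite -mul_mpolyC rmorphM /= dir_polyC.
  have sm m : m \in msupp b -> (mdeg m <= d)%N.
    by move=> mb; rewrite -ltnS -sb; exact: msize_mdeg_lt.
  split.
    rewrite eT big_seq; apply: (big_ind (fun u : {poly _} => (size u <= d.+1)%N)).
    - by rewrite size_poly0.
    - by move=> u v hu hv; rewrite (leq_trans (size_polyD _ _)) // geq_max hu.
    move=> m mb; have [s1 _] := top_at_monomial c w0 m.
    rewrite mul_polyC (leq_trans (size_scale_leq _ _)) // (leq_trans s1) // ltnS; exact: sm.
  have -> : q.@[w] = \sum_(m <- msupp b | mdeg m == d) b@_m * 'X_[m].@[w].
    by rewrite /q raddf_sum; apply: eq_bigr => m _ /=; rewrite mevalZ.
  rewrite eT coef_sum (rmorph_sum (@mpolyC n C)) /= [RHS]big_mkcond.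
  rewrite big_seq [RHS]big_seq.
  apply: eq_bigr => m mb; rewrite coefCM; have [s1 e1] := top_at_monomial c w0 m.
  case: eqP => [<-|/eqP ne].
    rewrite e1 mpolyCM mevalX; congr (_ * _%:MP); apply: eq_bigr => i _.
    by rewrite dp.
  rewrite nth_default ?mulr0 // (leq_trans s1) // ltn_neqAle ne; exact: sm.
suff sz : size T = d.+1 by rewrite lead_coefE sz.
apply/eqP; rewrite eqn_leq sT /=; rewrite ltnNge; apply/negP => le.
by move: cT; rewrite nth_default // => /esym/eqP; rewrite mpolyC_eq0 (negbTE wq).
Qed.

End Generic.

Lemma frac_mul_pow (K : fieldType) (a b a2 b2 d g da db : K) (i j : nat) :
  b != 0 -> d != 0 -> da != 0 -> db != 0 -> b2 != 0 -> g != 0 ->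
  a * (d ^+ i * da) = g ^+ i * a2 -> b * (d ^+ j * db) = g ^+ j * b2 ->
  a / b = (a2 * (db * d ^+ j)) / (b2 * (da * d ^+ i)) * g ^ (i%:Z - j%:Z).
Proof.
move=> b0 d0 da0 db0 b20 g0 ea eb.
have di := expf_neq0 i d0; have dj := expf_neq0 j d0.
have gi := expf_neq0 i g0; have gj := expf_neq0 j g0.
rewrite expfzDr // -exprnP -invr_expz -exprnP.
have -> : a = g ^+ i * a2 / (d ^+ i * da) by rewrite -ea mulfK // mulf_neq0.
have -> : b = g ^+ j * b2 / (d ^+ j * db) by rewrite -eb mulfK // mulf_neq0.
by field; rewrite da0 db0 di dj gj b20.
Qed.

(** * Discrete valuations from irreducible polynomials in one variable *)

Section FactorialCurve.
Variables (A A0 : idomainType) (Th : {rmorphism A -> {poly A0}}) (Ps : {poly A0} -> A).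
Hypotheses (ThK : cancel Th Ps) (PsK : cancel Ps Th).
Local Notation K0 := {fraction A0}.
Local Notation K := {fraction A}.

Definition frac_poly (g : A) : {poly K0} := map_poly (@tofrac A0) (Th g).

HB.instance Definition _ := GRing.RMorphism.copy frac_poly
  (map_poly (@tofrac A0) \o Th).

Lemma frac_poly_undir q : frac_poly (Ps q) = map_poly (@tofrac A0) q.
Proof. by rewrite /frac_poly PsK. Qed.

Lemma size_frac_poly g : size (frac_poly g) = size (Th g).
Proof.
by rewrite /frac_poly size_map_inj_poly ?rmorph0 // => x y /eqP; rewrite tofrac_eq => /eqP.
Qed.

Lemma frac_poly_inj : injective frac_poly.
Proof.
move=> f g e; apply: (can_inj ThK); apply/eqP; rewrite -subr_eq0 -rmorphB -size_poly_eq0.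
by rewrite -size_frac_poly rmorphB /= e subrr size_poly0.
Qed.

Lemma frac_poly_eq0 g : (frac_poly g == 0) = (g == 0).
Proof. by rewrite -(rmorph0 frac_poly) (inj_eq frac_poly_inj). Qed.

(** The denominator [d] becomes a nonzero constant over [K0], hence harmless for divisibility. *)
Lemma clear_denominators (q : {poly K0}) : exists d g : A,
  size (frac_poly d) = 1%N /\ frac_poly d * q = frac_poly g.
Proof.
elim/poly_ind: q => [|q c [d [g [sd e]]]].
  by exists 1, 0; rewrite rmorph1 size_poly1 mulr0 rmorph0.
have [a [b [b0 ->]]] := fracP c; have b0' : tofrac b != 0 :> K0 by rewrite tofrac_eq0.
exists (d * Ps b%:P), (g * Ps 'X * Ps b%:P + d * Ps a%:P).
rewrite !rmorphD !rmorphM /= !frac_poly_undir !map_polyC map_polyX /=; split.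
  by rewrite mulrC mul_polyC size_scale.
have bb : ((tofrac b)^-1)%:P * (tofrac b)%:P = 1 :> {poly K0}.
  by rewrite -polyCM mulVf.
have gen (R : comNzRingType) (x y z t u w : R) : w * u = 1 ->
    x * u * (y * z + t * w) = x * y * z * u + x * t.
  by move=> h; rewrite -[x * t]mulr1 -h; ring.
by rewrite -e; exact: gen.
Qed.

(** Plays the part of Gauss's lemma: division by [b] is possible over [A0], and its remainder,
    divisible by [b] over [K0] but of smaller degree, is 0. *)
Lemma monic_div a b : lead_coef (Th b) \is a GRing.unit ->
  frac_poly b %| frac_poly a -> exists q, a = q * b.
Proof.
move=> ub; have b0 : Th b != 0.
  by apply: contraTneq ub => ->; rewrite lead_coef0 unitr0.
have e := Pdiv.IdomainUnit.divp_eq ub (Th a).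
have ef : frac_poly a = map_poly (@tofrac A0) (Th a %/ Th b) * frac_poly b
     + map_poly (@tofrac A0) (Th a %% Th b).
  by rewrite {1}/frac_poly {1}e rmorphD rmorphM.
rewrite ef dvdp_addr ?dvdp_mull // => dv.
have r0 : Th a %% Th b = 0.
  apply: contraTeq dv => r0; apply/negP => /dvdp_leq.
  have r0' : map_poly (@tofrac A0) (Th a %% Th b) != 0.
    by rewrite -frac_poly_undir frac_poly_eq0 -(inj_eq (can_inj ThK)) PsK rmorph0.
  move=> /(_ r0'); rewrite -frac_poly_undir !size_frac_poly PsK leqNgt.
  by rewrite ltn_modp b0.
exists (Ps (Th a %/ Th b)); apply: (can_inj ThK).
by rewrite rmorphM /= PsK {1}e r0 addr0.
Qed.

Lemma exists_irreducible (F : fieldType) (q : {poly F}) : (1 < size q)%N ->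
  exists p, irreducible_poly p /\ p %| q.
Proof.
move=> sq; pose Q k := `[< exists p : {poly F}, [/\ (1 < size p)%N, p %| q & size p = k] >].
have exQ : exists k, Q k by exists (size q); apply/asboolP; exists q; split=> //; exact: dvdpp.
case: (ex_minnP exQ) => k /asboolP [p [sp pq <-]] min; exists p; split=> //; split=> // r sr rp.
have p0 : p != 0 by rewrite -size_poly_gt0 ltnW.
have r0 : r != 0 by apply: contraTneq rp => ->; rewrite dvd0p.
have sr1 : (1 < size r)%N by rewrite ltn_neqAle eq_sym sr size_poly_gt0.
rewrite -dvdp_size_eqp // eqn_leq dvdp_leq //=; apply: min; apply/asboolP.
by exists r; split=> //; exact: dvdp_trans pq.
Qed.

Section Irreducible.
Variable p : {poly K0}.
Hypothesis hp : irreducible_poly p.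

Let R : set K := range (@tofrac A).
Let P : set K := [set x | exists g, x = tofrac g /\ p %| frac_poly g].

Lemma irreducible_neq0 : p != 0.
Proof. by case: hp => sp _; rewrite -size_poly_gt0 ltnW. Qed.

Lemma irreducible_prime (u w : {poly K0}) : p %| u * w -> p %| u \/ p %| w.
Proof.
have [pu|npu] := boolP (p %| u); first by left.
by rewrite Gauss_dvdpr ?irreducible_poly_coprime //; right.
Qed.

Lemma irreducible_ndvd_mul (u w : {poly K0}) : ~~ (p %| u) -> ~~ (p %| w) -> ~~ (p %| u * w).
Proof. by move=> /negP nu /negP nw; apply/negP => /irreducible_prime []. Qed.

Lemma irreducible_ndvd_exp (u : {poly K0}) i : ~~ (p %| u) -> ~~ (p %| u ^+ i).
Proof.
move=> nu; elim: i => [|i IH]; last by rewrite exprS; exact: irreducible_ndvd_mul.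
by rewrite expr0 dvdp1; case: hp => sp _; rewrite gtn_eqF.
Qed.

Lemma irreducible_ndvd_const (u : {poly K0}) : size u = 1%N -> ~~ (p %| u).
Proof.
move=> su; apply/negP => /dvdp_leq; rewrite -size_poly_eq0 su => /(_ isT).
by case: hp; lia.
Qed.

Lemma irreducible_factor (q : {poly K0}) : q != 0 ->
  exists e r, q = p ^+ e * r /\ ~~ (p %| r).
Proof.
have [k] := ubnP (size q); elim: k q => // k IH q sq q0.
have [pq|npq] := boolP (p %| q); last by exists 0%N, q; rewrite mul1r.
have [r eq] : exists r, q = r * p by exists (q %/ p); rewrite divpK.
have r0 : r != 0 by apply: contraNneq q0 => r0; rewrite eq r0 mul0r.
have [||e [u [er nu]]] := IH r.
- have es : size q = (size r + size p).-1.
    by rewrite eq size_mul // irreducible_neq0.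
  have sr : (0 < size r)%N by rewrite size_poly_gt0.
  have [sp _] := hp; move: sq; rewrite es; move: sr sp.
  by move: (size r) (size p) => m1 m2; lia.
- by [].
by exists e.+1, u; split=> //; rewrite eq er exprSr -mulrA [u * p]mulrC mulrA.
Qed.

Lemma range_subring : is_subring R.
Proof.
split; first by exists 1 => //; rewrite rmorph1.
  by move=> _ _ [a _ <-] [b _ <-]; exists (a - b) => //; rewrite rmorphB.
by move=> _ _ [a _ <-] [b _ <-]; exists (a * b) => //; rewrite rmorphM.
Qed.

Lemma irreducible_idealE g : P (tofrac g) <-> p %| frac_poly g.
Proof.
split=> [[h [/eqP]]|pg]; last by exists g.
by rewrite tofrac_eq => /eqP ->.
Qed.

Lemma irreducible_ideal_prime : is_prime_ideal R P.
Proof.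
split.
- by move=> _ [g [-> _]]; exists g.
- split; first by exists 0; rewrite !rmorph0 dvdp0.
  rewrite -(rmorph1 (@tofrac A)) irreducible_idealE rmorph1 dvdp1.
  by case: hp => sp _; rewrite gtn_eqF.
- move=> _ _ [f [-> pf]] [g [-> pg]]; rewrite -rmorphD irreducible_idealE rmorphD.
  exact: dvdp_add.
- move=> _ _ [f _ <-] [g [-> pg]]; rewrite -rmorphM irreducible_idealE rmorphM.
  exact: dvdp_mull.
move=> _ _ [f _ <-] [g _ <-]; rewrite -rmorphM !irreducible_idealE rmorphM.
exact: irreducible_prime.
Qed.

Lemma irreducible_locI a b : ~~ (p %| frac_poly b) ->
  localization R P (tofrac a / tofrac b).
Proof.
move=> nb; exists (tofrac a), (tofrac b); split=> //; [by exists a|by exists b|].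
by rewrite irreducible_idealE; exact/negP.
Qed.

Lemma irreducible_locE x : localization R P x ->
  exists a b, ~~ (p %| frac_poly b) /\ x = tofrac a / tofrac b.
Proof.
move=> [_ [_ [[a _ <-] [b _ <-] nb ->]]]; exists a, b; split=> //.
by apply/negP; rewrite -irreducible_idealE.
Qed.

Lemma ndvd_neq0 b : ~~ (p %| frac_poly b) -> b != 0.
Proof. by apply: contraNneq => ->; rewrite rmorph0 dvdp0. Qed.

(** As [p] may have denominators, the uniformizer is g = d p with [d] clearing them. In a fraction,
    the powers of [p] are split off over [K0] and the cofactors cleared of denominators; what
    remains is a unit. *)
Lemma irreducible_dvr : is_dvr (localization R P).
Proof.
split; first by apply: localization_subring; [exact: range_subring|exact: irreducible_ideal_prime].
have [d [g [sd eg]]] := clear_denominators p.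
have nd := irreducible_ndvd_const sd; have d0 := ndvd_neq0 nd.
have g0 : g != 0.
  by rewrite -frac_poly_eq0 -eg mulf_neq0 ?irreducible_neq0 // frac_poly_eq0.
have n1 : ~~ (p %| frac_poly 1) by apply: irreducible_ndvd_const; rewrite rmorph1 size_poly1.
exists (tofrac g); split; first by rewrite tofrac_eq0.
  split.
    by rewrite -[tofrac g]divr1 -(rmorph1 (@tofrac A)); exact: irreducible_locI.
  right=> /irreducible_locE [a [b [nb e]]].
  have b0 : tofrac b != 0 :> K by rewrite tofrac_eq0 ndvd_neq0.
  move/negP: nb; apply.
  have : tofrac b = tofrac (a * g) :> K.
    rewrite rmorphM; have G0 : tofrac g != 0 :> K by rewrite tofrac_eq0.
    by apply: (mulIf (invr_neq0 G0)); rewrite mulfK // e mulrC mulfVK.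
  by move=> /eqP; rewrite tofrac_eq => /eqP ->; rewrite rmorphM /= -eg; do 2!apply: dvdp_mull.
move=> x; have [a [b [b0 ->]]] := fracP x.
rewrite mulf_eq0 invr_eq0 !tofrac_eq0 (negbTE b0) orbF => a0.
have a0' : frac_poly a != 0 by rewrite frac_poly_eq0.
have b0' : frac_poly b != 0 by rewrite frac_poly_eq0.
have [i [a1 [ea na1]]] := irreducible_factor a0'.
have [j [b1 [eb nb1]]] := irreducible_factor b0'.
have [da [a2 [sda ea2]]] := clear_denominators a1.
have [db [b2 [sdb eb2]]] := clear_denominators b1.
have nda := irreducible_ndvd_const sda; have ndb := irreducible_ndvd_const sdb.
have na2 : ~~ (p %| frac_poly a2) by rewrite -ea2; exact: irreducible_ndvd_mul.
have nb2 : ~~ (p %| frac_poly b2) by rewrite -eb2; exact: irreducible_ndvd_mul.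
have Ea : a * (d ^+ i * da) = g ^+ i * a2.
  apply: frac_poly_inj; rewrite !rmorphM !rmorphXn /= ea -eg -ea2 exprMn.
  by ring.
have Eb : b * (d ^+ j * db) = g ^+ j * b2.
  apply: frac_poly_inj; rewrite !rmorphM !rmorphXn /= eb -eg -eb2 exprMn.
  by ring.
exists (tofrac (a2 * (db * d ^+ j)) / tofrac (b2 * (da * d ^+ i))), (i%:Z - j%:Z); split.
- apply: irreducible_locI; rewrite !rmorphM rmorphXn /=.
  apply: irreducible_ndvd_mul => //; apply: irreducible_ndvd_mul => //.
  exact: irreducible_ndvd_exp.
- rewrite invf_div; apply: irreducible_locI; rewrite !rmorphM rmorphXn /=.
  apply: irreducible_ndvd_mul => //; apply: irreducible_ndvd_mul => //.
  exact: irreducible_ndvd_exp.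
rewrite !rmorphM !rmorphXn /=; apply: frac_mul_pow; rewrite ?tofrac_eq0 //.
- exact: ndvd_neq0.
- exact: ndvd_neq0.
- exact: ndvd_neq0.
- by rewrite -!rmorphXn -!rmorphM Ea.
- by rewrite -!rmorphXn -!rmorphM Eb.
Qed.

End Irreducible.

(** By [monic_div] the denominator in lowest terms over [K0] is not constant; any irreducible factor
    of it gives a pole. *)
Lemma exists_pole_dvr a b : lead_coef (Th b) \is a GRing.unit ->
  (forall q, a <> q * b) ->
  exists P, [/\ is_prime_ideal (range (@tofrac A)) P,
    is_dvr (localization (range (@tofrac A)) P) &
    ~ localization (range (@tofrac A)) P (tofrac a / tofrac b)].
Proof.
move=> ub nq; have nba : ~~ (frac_poly b %| frac_poly a).
  by apply/negP => /(monic_div ub) [q /nq].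
have b0 : frac_poly b != 0.
  rewrite frac_poly_eq0; apply: contraTneq ub => ->.
  by rewrite rmorph0 lead_coef0 unitr0.
pose G := gcdp (frac_poly a) (frac_poly b).
have G0 : G != 0 by rewrite gcdp_eq0 (negbTE b0) andbF.
have ea : frac_poly a = (frac_poly a %/ G) * G by rewrite divpK // dvdp_gcdl.
have eb : frac_poly b = (frac_poly b %/ G) * G by rewrite divpK // dvdp_gcdr.
have cop : coprimep (frac_poly a %/ G) (frac_poly b %/ G).
  by apply: coprimep_div_gcd; rewrite b0 orbT.
have sb : (1 < size (frac_poly b %/ G)%R)%N.
  have q0 : frac_poly b %/ G != 0 by apply: contraNneq b0 => e; rewrite eb e mul0r.
  rewrite ltn_neqAle size_poly_gt0 q0 andbT eq_sym; apply: contraNneq nba => s1.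
  have : frac_poly b %| G.
    by rewrite eb -[X in _ %| X]mul1r dvdp_mul2r // dvdp1 s1.
  by move=> h; apply: dvdp_trans h _; exact: dvdp_gcdl.
have [p [hp pb]] := exists_irreducible sb.
exists [set x | exists g, x = tofrac g /\ p %| frac_poly g]; split.
- exact: irreducible_ideal_prime.
- exact: irreducible_dvr.
move=> /(irreducible_locE) [u [w [nw e]]].
have b0' : b != 0 by rewrite -frac_poly_eq0.
have w0 := ndvd_neq0 nw.
have /(congr1 frac_poly) : a * w = u * b.
  apply/eqP; rewrite -tofrac_eq !rmorphM /=.
  by rewrite -eqr_div ?tofrac_eq0 //; apply/eqP.
rewrite !rmorphM /= {1}ea {1}eb mulrAC mulrA => /(mulIf G0) e2.
have : p %| frac_poly a %/ G * frac_poly w by rewrite e2 dvdp_mull.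
move=> /(irreducible_prime hp) [pa|]; last by apply/negP.
have : p %| gcdp (frac_poly a %/ G) (frac_poly b %/ G) by rewrite dvdp_gcd pa.
move: cop; rewrite -gcdp_eqp1 => /eqp_dvdr ->; rewrite dvdp1.
by case: hp => sp _; rewrite gtn_eqF.
Qed.

End FactorialCurve.

Lemma mpoly_regular (C : fieldType) n (f : {fraction {mpoly C[n]}}) :
  injective (fun k : nat => k%:R : C) ->
  (forall P, is_prime_ideal (range (@tofrac {mpoly C[n]})) P ->
    is_dvr (localization (range (@tofrac {mpoly C[n]})) P) ->
    localization (range (@tofrac {mpoly C[n]})) P f) ->
  exists g, f = tofrac g.
Proof.
move=> natC hf; have [a [b [b0 ef]]] := fracP f.
suff [q eq] : exists q, a = q * b.
  by exists q; rewrite ef eq rmorphM mulfK // tofrac_eq0.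
case: n => [|n] in f hf a b b0 ef *.
  have eC (h : {mpoly C[0]}) : h = (h@_0%MM)%:MP.
    apply/mpolyP => m; rewrite mcoeffC; have -> : m = 0%MM by apply/mnmP => -[].
    by rewrite eqxx mulr1.
  exists (a * (b@_0%MM)^-1%:MP); rewrite -mulrA {2}(eC b) -mpolyCM mulVf ?mulr1 //.
  by apply: contraNneq b0 => e; rewrite (eC b) e.
apply: contrapT => /forallNP nq.
have [c [c0 [x [c00 x0 lx]]]] := exists_monic_dir natC b0.
have ub : lead_coef (dir_poly c c0 b) \is a GRing.unit.
  by rewrite lx rmorph_unit // unitfE.
have [P [hP dP nP]] := @exists_pole_dvr _ _ (dir_poly c c0) (undir c c0)
  (dir_polyK c c00) (undirK c c00) a b ub nq.
by apply: nP; rewrite -ef; exact: hf.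
Qed.

(** * The inverse system *)

Section MpolyAct.
Variables (C : fieldType) (n : nat).
Implicit Types (f g : {mpoly C[n]}).

Definition mpoly_act f g : {mpoly C[n]} := \sum_(m <- msupp f) f@_m *: mderivm m g.

(** Provides a common index set for operators whose supports differ. *)
Lemma mpoly_actE k f g : (msize f <= k)%N ->
  mpoly_act f g = \sum_(m : 'X_{1..n < k}) f@_m *: mderivm m g.
Proof.
move=> le; set I : subFinType _ := 'X_{1..n < k}.
rewrite /mpoly_act (big_mksub I) ?msupp_uniq //=; first last.
  by move=> x /msize_mdeg_lt /leq_trans; apply.
by rewrite big_rmcond //= => j /memN_msupp_eq0 ->; rewrite scale0r.
Qed.

Lemma mpoly_actD f f' g : mpoly_act (f + f') g = mpoly_act f g + mpoly_act f' g.
Proof.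
pose k := maxn (msize (f + f')) (maxn (msize f) (msize f')).
have k1 : (msize (f + f') <= k)%N by rewrite leq_maxl.
have k2 : (msize f <= k)%N by rewrite /k !leq_max leqnn !orbT.
have k3 : (msize f' <= k)%N by rewrite /k !leq_max leqnn !orbT.
rewrite (mpoly_actE _ k1) (mpoly_actE _ k2) (mpoly_actE _ k3) -big_split.
by apply: eq_bigr => m _; rewrite mcoeffD scalerDl.
Qed.

Lemma mpoly_actZ c f g : mpoly_act (c *: f) g = c *: mpoly_act f g.
Proof.
pose k := maxn (msize (c *: f)) (msize f).
have k1 : (msize (c *: f) <= k)%N by rewrite leq_maxl.
have k2 : (msize f <= k)%N by rewrite leq_maxr.
rewrite (mpoly_actE _ k1) (mpoly_actE _ k2) scaler_sumr.
by apply: eq_bigr => m _; rewrite mcoeffZ scalerA.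
Qed.

Lemma mpoly_act0 g : mpoly_act 0 g = 0.
Proof. by have := mpoly_actZ 0 0 g; rewrite !scale0r. Qed.

Lemma mpoly_act_sum (I : Type) (r : seq I) (P : pred I) (F : I -> {mpoly C[n]}) g :
  mpoly_act (\sum_(i <- r | P i) F i) g = \sum_(i <- r | P i) mpoly_act (F i) g.
Proof. exact: (big_morph (mpoly_act^~ g) (fun x y => mpoly_actD x y g) (mpoly_act0 g)). Qed.

Lemma mpoly_actX m g : mpoly_act 'X_[m] g = mderivm m g.
Proof. by rewrite /mpoly_act msuppX big_seq1 mcoeffX eqxx scale1r. Qed.

Lemma mpoly_actM f f' g : mpoly_act (f * f') g = mpoly_act f (mpoly_act f' g).
Proof.
rewrite [f]mpolyE mulr_suml !mpoly_act_sum; apply: eq_bigr => m _.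
rewrite -scalerAl !mpoly_actZ; congr (_ *: _); rewrite mpoly_actX.
have -> : mpoly_act f' g = \sum_(m' <- msupp f') f'@_m' *: mderivm m' g by [].
rewrite linear_sum {1}[f']mpolyE mulr_sumr mpoly_act_sum; apply: eq_bigr => m' _.
by rewrite -scalerAr mpoly_actZ linearZ /= -mpolyXD mpoly_actX addmC mderivmDm.
Qed.

Lemma mpoly_act_r0 f : mpoly_act f 0 = 0.
Proof. by rewrite /mpoly_act big1 // => m _; rewrite linear0 scaler0. Qed.

Lemma mpoly_act1 g : mpoly_act 1 g = g.
Proof. by rewrite -mpolyX0 mpoly_actX mderivm0m. Qed.

End MpolyAct.

(** * Directional derivatives and the degree along a subspace *)

Section Directional.
Variables (C : fieldType) (L : vectType C).
Local Notation A := (sym_alg L).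
Implicit Types (f g : A) (x u v : L) (h : 'Hom(L, C^o)) (p : 'End(L)) (N : {vspace L}).

Lemma sym_act_sum (m : nat) (F : 'I_m -> A) g :
  sym_act (\sum_(i < m) F i) g = \sum_(i < m) sym_act (F i) g.
Proof. exact: mpoly_act_sum. Qed.

Lemma sym_actM f f' g : sym_act (f * f') g = sym_act f (sym_act f' g).
Proof. exact: mpoly_actM. Qed.

Lemma sym_act_r0 f : sym_act f 0 = 0.
Proof. exact: mpoly_act_r0. Qed.

Definition dir_deriv v g : A :=
  \sum_(j < \dim {:L}) coord (vbasis {:L}) j v *: mderiv j (g : {mpoly C[_]}).

Lemma sym_act_vec v g : sym_act (sym_vec v) g = dir_deriv v g.
Proof.
rewrite /sym_vec -[LHS]/(mpoly_act _ _) mpoly_act_sum; apply: eq_bigr => j _.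
by rewrite mpoly_actZ mpoly_actX mderivmU1m.
Qed.

Lemma sym_act_vecX v e g : sym_act (sym_vec v ^+ e) g = iter e (dir_deriv v) g.
Proof.
elim: e => [|e IH]; first by rewrite expr0; exact: mpoly_act1.
by rewrite exprS sym_actM IH sym_act_vec.
Qed.

Lemma dir_deriv0 v : dir_deriv v 0 = 0.
Proof. by rewrite /dir_deriv big1 // => j _; rewrite linear0 scaler0. Qed.

Lemma dir_derivD v f g : dir_deriv v (f + g) = dir_deriv v f + dir_deriv v g.
Proof.
rewrite /dir_deriv -big_split; apply: eq_bigr => j _ /=.
by rewrite linearD scalerDr.
Qed.

Lemma dir_derivM v f g : dir_deriv v (f * g) = dir_deriv v f * g + f * dir_deriv v g.
Proof.
rewrite /dir_deriv mulr_suml mulr_sumr -big_split; apply: eq_bigr => j _ /=.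
by rewrite mderivM scalerDr scalerAl scalerAr.
Qed.

Lemma dir_deriv_sum v (I : Type) (r : seq I) (F : I -> A) :
  dir_deriv v (\sum_(i <- r) F i) = \sum_(i <- r) dir_deriv v (F i).
Proof. exact: (big_morph (dir_deriv v) (dir_derivD v) (dir_deriv0 v)). Qed.

Lemma dir_deriv_const v c : dir_deriv v (sym_const L c) = 0.
Proof. by rewrite /dir_deriv big1 // => j _; rewrite /sym_const mderivC scaler0. Qed.

Lemma dir_deriv_X v j : dir_deriv v ('X_j : {mpoly C[_]}) = sym_const L (coord (vbasis {:L}) j v).
Proof.
rewrite /dir_deriv (bigD1 j) //= big1 ?addr0 => [|i ij]; rewrite mderivX mnm1E.
  have -> : (U_(j) - U_(j))%MM = 0%MM :> 'X_{1..\dim {:L}}.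
    by apply/mnmP => i; rewrite mnmBE subnn mnm0E.
  by rewrite eqxx scale1r mpolyX0 /sym_const -mul_mpolyC mulr1.
by rewrite eq_sym (negbTE ij) scale0r scaler0.
Qed.

Lemma dir_derivZ v c g : dir_deriv v (sym_const L c * g) = sym_const L c * dir_deriv v g.
Proof. by rewrite dir_derivM dir_deriv_const mul0r add0r. Qed.

Lemma dir_deriv_form v h : dir_deriv v (sym_form h) = sym_const L (h v).
Proof.
rewrite {1}(form_coord h) sym_form_sum dir_deriv_sum.
transitivity (\sum_(j < \dim {:L}) sym_const L (h (vbasis {:L})`_j * coord (vbasis {:L}) j v)).
  apply: eq_bigr => j _; rewrite sym_formZ dir_derivZ sym_form_coord dir_deriv_X.
  by rewrite /sym_const mpolyCM.
rewrite {2}(coord_vbasis (memvf v)) linear_sum /sym_const -(rmorph_sum (@mpolyC _ C)).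
by congr _%:MP; apply: eq_bigr => j _; rewrite linearZ mulrC.
Qed.

(** Chain rule: (1 - p) v = 0 and p v = v, so differentiating g((1 - p) x + T p x) along [v] brings
    out one factor T. *)
Lemma weight_poly_dirder p N v g : proj_onto p N -> v \in N ->
  forall i, dir_deriv v (weight_poly p g)`_i = ('X * weight_poly p (dir_deriv v g))`_i.
Proof.
move=> hp vN; have [_ /(_ v vN) pv] := hp.
move: g; apply: sym_alg_gen => [c|h|f g hf hg|f g hf hg] i.
- rewrite weight_poly_const dir_deriv_const rmorph0 mulr0 coef0 coefC.
  by case: eqP => _; [exact: dir_deriv_const|exact: dir_deriv0].
- rewrite dir_deriv_form weight_poly_const weight_poly_form coefXM coefD coefMX !coefC.
  case: i => [|[|i]] /=.
  + by rewrite addr0 dir_deriv_form add_lfunE opp_lfunE comp_lfunE pv subrr /sym_const mpolyC0.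
  + by rewrite add0r dir_deriv_form comp_lfunE pv.
  + by rewrite addr0 dir_deriv0.
- by rewrite dir_derivD !rmorphD /= mulrDr !coefD dir_derivD hf hg.
rewrite dir_derivM rmorphM rmorphD !rmorphM /= mulrDr coefD coefM dir_deriv_sum.
rewrite mulrA coefM mulrCA coefM -big_split; apply: eq_bigr => j _.
by rewrite dir_derivM hf hg.
Qed.

Lemma wsize_dirder p N v g e : proj_onto p N -> v \in N ->
  (wsize p g <= e.+1)%N -> (wsize p (dir_deriv v g) <= e)%N.
Proof.
move=> hp vN le; apply/leq_sizeP => i ei.
have := weight_poly_dirder g hp vN i.+1; rewrite coefXM /= => <-.
by rewrite nth_default ?dir_deriv0 // (leq_trans le).
Qed.

Lemma iter_dirder_eq0 p N v g e : proj_onto p N -> v \in N ->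
  (wsize p g <= e)%N -> iter e (dir_deriv v) g = 0.
Proof.
move=> hp vN; elim: e g => [|e IH] g le.
  by apply/eqP; rewrite -(wsize_eq0 p) -leqn0.
by rewrite iterSr; apply: IH; exact: (wsize_dirder hp vN le).
Qed.

Definition eval_at x g : C := g.@[fun j => coord (vbasis {:L}) j x].

HB.instance Definition _ x := GRing.RMorphism.copy (eval_at x)
  (meval (fun j => coord (vbasis {:L}) j x)).

Lemma eval_at_const x c : eval_at x (sym_const L c) = c.
Proof. exact: mevalC. Qed.

Lemma eval_at_form x h : eval_at x (sym_form h) = h x.
Proof.
rewrite {1}(form_coord h) sym_form_sum rmorph_sum {2}(coord_vbasis (memvf x)) linear_sum.
apply: eq_bigr => j _; rewrite sym_formZ rmorphM /= eval_at_const sym_form_coord.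
by rewrite /eval_at mevalXU linearZ mulrC.
Qed.

(** The restriction of g to the line u + T v. *)
Definition line_poly u v : A -> {poly C} :=
  mmap (@polyC C) (fun j => (coord (vbasis {:L}) j u)%:P + (coord (vbasis {:L}) j v)%:P * 'X).

HB.instance Definition _ u v := GRing.RMorphism.copy (line_poly u v)
  (mmap (@polyC C) (fun j => (coord (vbasis {:L}) j u)%:P + (coord (vbasis {:L}) j v)%:P * 'X)).

Lemma line_poly_const u v c : line_poly u v (sym_const L c) = c%:P.
Proof. exact: mmapC. Qed.

Lemma line_poly_form u v h : line_poly u v (sym_form h) = (h u)%:P + (h v)%:P * 'X.
Proof.
rewrite {1}(form_coord h) sym_form_sum rmorph_sum /=.
rewrite {2}(coord_vbasis (memvf u)) {2}(coord_vbasis (memvf v)) !linear_sum /=.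
rewrite !rmorph_sum /= mulr_suml -big_split; apply: eq_bigr => j _ /=.
rewrite sym_formZ rmorphM /= line_poly_const sym_form_coord /line_poly mmapX mmap1U.
by rewrite !linearZ /= ![coord _ _ _ *: _]mulrC !polyCM mulrDr mulrA.
Qed.

Lemma line_poly_dirder u v g : (line_poly u v g)^`() = line_poly u v (dir_deriv v g).
Proof.
move: g; apply: sym_alg_gen => [c|h|f g hf hg|f g hf hg].
- by rewrite line_poly_const derivC dir_deriv_const rmorph0.
- by rewrite line_poly_form dir_deriv_form line_poly_const derivD derivC derivM derivC derivX mul0r mulr1 !add0r.
- by rewrite dir_derivD !rmorphD /= derivD hf hg.
- by rewrite dir_derivM rmorphM rmorphD !rmorphM /= derivM hf hg.
Qed.

Lemma line_poly_weight p x g :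
  map_poly (eval_at x) (weight_poly p g) = line_poly (x - p x) (p x) g.
Proof.
move: g; apply: sym_alg_gen => [c|h|f g hf hg|f g hf hg].
- by rewrite weight_poly_const map_polyC /= eval_at_const line_poly_const.
- rewrite weight_poly_form rmorphD rmorphM /= !map_polyC map_polyX /= !eval_at_form line_poly_form.
  by rewrite add_lfunE opp_lfunE comp_lfunE linearB.
- by rewrite !rmorphD /= hf hg.
- by rewrite !rmorphM /= hf hg.
Qed.

Hypothesis natC_inj : injective (fun k : nat => k%:R : C).

Lemma size_derivn_eq0 (q : {poly C}) e : q^`(e) = 0 -> (size q <= e)%N.
Proof.
move=> qe; apply/leq_sizeP => i ei.
have := congr1 (fun r : {poly C} => r`_(i - e)) qe.
rewrite /= coef_derivn subnKC // coef0 -mulr_natl => /eqP; rewrite mulf_eq0 => /orP[|/eqP //].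
rewrite -[0]/(0%:R) (inj_eq natC_inj) -leqn0 leqNgt ffact_gt0.
by rewrite ei.
Qed.

Lemma exists_eval_neq0 g : g != 0 -> exists x, eval_at x g != 0.
Proof.
move=> /(mpoly_nonvanish natC_inj) [w hw].
exists (\sum_(j < \dim {:L}) w j *: (vbasis {:L})`_j); rewrite /eval_at.
have -> : (fun j => coord (vbasis {:L}) j (\sum_(i < \dim {:L}) w i *: (vbasis {:L})`_i)) = w.
  by apply/funext => j; rewrite coord_sum_free // (basis_free (vbasisP _)).
exact: hw.
Qed.

(** A nonzero coefficient of index at least e would be nonzero at some x with p x generic. But g
    restricted to the line x - p x + T p x has zero e-th derivative, hence degree less than e. *)
Lemma wsize_of_dirder n (l : 'I_n -> 'Hom(L, C^o)) (P : pred 'I_n) p N g e :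
  proj_onto p N -> (forall i, P i -> ~~ (N <= lker (l i))%VS) ->
  (forall v, v \in N -> (forall i, P i -> l i v != 0) -> iter e (dir_deriv v) g = 0) ->
  (wsize p g <= e)%N.
Proof.
move=> hp hP hv; apply/leq_sizeP => i ei; apply/eqP.
have pr0 : \prod_(j | P j) sym_form (l j \o p)%VF != 0.
  by apply/prodf_neq0 => j Pj; rewrite sym_form_eq0; exact: (form_proj_neq0 hp (hP j Pj)).
(* Multiplying by the product of the l_j o p forces p x to be generic at the point found. *)
rewrite -(mulIr_eq0 _ (mulIf pr0)); apply: contraT => /exists_eval_neq0 [x].
rewrite rmorphM rmorph_prod mulf_eq0 negb_or => /andP[/negP gx /prodf_neq0 lx].
exfalso; apply: gx; have [pN pid] := hp.
have h0 : iter e (dir_deriv (p x)) g = 0.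
  apply: hv => // j Pj; have := lx j Pj.
  by rewrite /= eval_at_form comp_lfunE.
have dn k : (line_poly (x - p x) (p x) g)^`(k) = line_poly (x - p x) (p x) (iter k (dir_deriv (p x)) g).
  by elim: k => [|k IH]; rewrite ?derivn0 // derivnS IH line_poly_dirder.
have : line_poly (x - p x) (p x) g = map_poly (eval_at x) (weight_poly p g).
  by rewrite line_poly_weight.
have {dn} sz : (size (line_poly (x - p x) (p x) g) <= e)%N.
  by apply: size_derivn_eq0; rewrite dn h0 rmorph0.
move=> eq; rewrite eq in sz; move/leq_sizeP: sz => /(_ i ei).
by rewrite coef_map => ->.
Qed.

End Directional.

(** * Comparison of the inverse system with the global sections *)

Section Sections.
Variables (C : fieldType) (L : vectType C) (n : nat) (l : 'I_n -> 'Hom(L, C^o)).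
Hypothesis hl : (\bigcap_(i < n) lker (l i))%VS = 0%VS.
Hypothesis natC_inj : injective (fun k : nat => k%:R : C).
Variable k : int.
Local Notation A := (sym_alg L).
Local Notation K := (rat_fun L).
Local Notation s := (proper_flats l).
Implicit Types (F : {set 'I_n}) (v : L) (g : A) (E : set K).

(** The flat in whose space [v] is generic; rho counts its complement. *)
Definition supp_flat v : {set 'I_n} := [set i | v \in lker (l i)]%SET.

Lemma supp_flat_mem v : v \in flat_space l (supp_flat v).
Proof. by rewrite memvE; apply/subv_bigcapP => i; rewrite inE -memvE. Qed.

Lemma supp_flat_proper v : v != 0 -> proper_flat l (supp_flat v).
Proof.
move=> v0; apply/andP; split.
  apply/forallP => j; apply/implyP => /subvP h.
  by rewrite inE; apply: h; exact: supp_flat_mem.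
apply: contra v0 => /eqP e; rewrite -memv0 -hl memvE; apply/subv_bigcapP => i _.
by have := finset.in_setT i; rewrite -e inE -memvE.
Qed.

Lemma rho_supp v : rho l v = (n - #|supp_flat v|)%N.
Proof.
have -> : rho l v = #|~: supp_flat v|%SET by apply: eq_card => i; rewrite !inE.
by have := cardsC (supp_flat v); rewrite card_ord; lia.
Qed.

Definition flat_coef F : int := n%:Z - #|F|%:Z + k.

Lemma power_exponentE v : power_exponent l k v =
  (if (flat_coef (supp_flat v) + 1)%R is Posz m then m else 0%N).
Proof.
rewrite /power_exponent /flat_coef rho_supp subzn //.
by rewrite -[X in (_ <= X)%N]card_ord; exact: max_card.
Qed.

Lemma inverse_systemP g : inverse_system l k g <->
  forall v, v != 0 -> iter (power_exponent l k v) (dir_deriv v) g = 0.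
Proof.
split=> [hg v v0|hv f].
  rewrite -sym_act_vecX; apply: hg.
  exists 1%N, (fun _ => 1), (fun _ => sym_vec v ^+ power_exponent l k v).
  by rewrite big_ord1 mul1r; split=> // _; split=> //; exists v.
move=> [m [b [t [ht ->]]]]; rewrite sym_act_sum big1 // => j _.
have [_ [v v0 <-]] := ht j.
by rewrite sym_actM sym_act_vecX hv // sym_act_r0.
Qed.

Lemma boundary_coef F E : proper_flat l F -> boundary_divisor l F E ->
  ones_divisor l E + k * alpha_divisor l E = flat_coef F.
Proof.
move=> pF bF; rewrite /ones_divisor /alpha_divisor.
by rewrite (boundary_sumE _ pF bF) (boundary_sumE _ pF bF) mulr1.
Qed.

Lemma regular_coef E : (forall g, E (tofrac g)) ->
  ones_divisor l E + k * alpha_divisor l E = 0.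
Proof.
by move=> Eg; rewrite /ones_divisor /alpha_divisor !boundary_sum0 // mulr0 addr0.
Qed.

(** A vector of L_F on which no l_i with i outside [F] vanishes has [supp_flat] equal to [F], so its
    power kills [g] with exponent c_F + 1. *)
Lemma inverse_system_wsize g F p : inverse_system l k g -> proper_flat l F ->
  proj_onto p (flat_space l F) -> g != 0 -> (wsize p g)%:Z <= flat_coef F + 1.
Proof.
move=> /inverse_systemP hg pF hp g0.
(* When c_F + 1 is negative the exponent is 0; [wsize] would then be 0, impossible for g nonzero. *)
pose e := if (flat_coef F + 1)%R is Posz m then m else 0%N.
suff : (wsize p g <= e)%N.
  have : (0 < wsize p g)%N by rewrite lt0n wsize_eq0.
  by rewrite /e; case: (flat_coef F + 1) => m; lia.
apply: (@wsize_of_dirder _ _ natC_inj n l (fun i => i \notin F) p (flat_space l F)) => //.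
  by move=> i niF; apply: contra niF; exact: flat_mem.
move=> v vF gen.
have eF : supp_flat v = F.
  apply/setP => i; rewrite inE; apply/idP/idP => [vi|iF].
    by apply: contraLR vi => /gen; rewrite memv_ker.
  exact: (subvP (flat_space_ker l iF)).
have v0 : v != 0.
  apply/eqP => v0; have /andP[_ /negP nT] := pF; apply: nT; rewrite -eF v0.
  by apply/eqP/setP => i; rewrite !inE mem0v.
by have := hg v v0; rewrite power_exponentE eF.
Qed.

(** Each nonzero v is tested on its own flat [supp_flat v], whose space contains it. *)
Lemma wsize_inverse_system g :
  (forall F p, proper_flat l F -> proj_onto p (flat_space l F) ->
     (wsize p g)%:Z <= flat_coef F + 1) -> inverse_system l k g.
Proof.
move=> h; apply/inverse_systemP => v v0.
have pF := supp_flat_proper v0; have [p hp] := exists_proj (flat_space l (supp_flat v)).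
apply: (iter_dirder_eq0 hp (supp_flat_mem v)); rewrite power_exponentE.
by have := h _ _ pF hp; case: (flat_coef _ + 1) => m; lia.
Qed.

Lemma regular_proj_chart : proj_chart (0, 1) = range (@tofrac A) :> set K.
Proof.
apply/seteqP; split.
  apply: chart_min.
  - split; first by exists 1 => //; rewrite rmorph1.
      by move=> _ _ [a _ <-] [b _ <-]; exists (a - b) => //; rewrite rmorphB.
    by move=> _ _ [a _ <-] [b _ <-]; exists (a * b) => //; rewrite rmorphM.
  - by move=> c; exists (sym_const L c).
  - by move=> h; rewrite hyp_form1 divr1; exists (sym_form h.1 + sym_const L h.2).
move=> _ [g _ <-]; have sR := @chart_subring C L (0, 1).
move: g; apply: sym_alg_gen => [c|h|f g hf hg|f g hf hg].
- exact: chart_const.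
- by rewrite -hyp_form_lin -[hyp_form _]divr1 -(@hyp_form1 C L); exact: chart_div.
- by rewrite rmorphD; exact: (subringD sR).
- by rewrite rmorphM; exact: (subringM sR).
Qed.

Lemma regular_wonderful P : is_prime_ideal (range (@tofrac A)) P ->
  is_dvr (localization (range (@tofrac A)) P) ->
  wonderful l (localization (range (@tofrac A)) P).
Proof.
move=> hP dP; have [v dv] := dvr_exists_val dP.
rewrite wonderful_stage; apply: (stage_keep_dvr dv (j := 0)); first by rewrite leqnn.
rewrite stage0; exists (0, 1), P; rewrite regular_proj_chart; split=> //.
by rewrite -hyp_form_eq0 hyp_form1 oner_eq0.
Qed.

Lemma weight_order g p N e : proj_onto p N -> N != 0%VS -> g != 0 ->
  has_order (weight_dvr p) (tofrac g) e <-> e = 1 - (wsize p g)%:Z.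
Proof.
move=> hp N0 g0; have [v [hv dv]] := weight_dvr_is_dvr hp N0.
have g0' : tofrac g != 0 :> K by rewrite tofrac_eq0.
have -> : 1 - (wsize p g)%:Z = v (tofrac g).
  rewrite -[tofrac g]divr1 -(rmorph1 (@tofrac A)) hv ?oner_neq0 //.
  by rewrite /wsize rmorph1 size_poly1.
exact: has_orderE.
Qed.

Lemma inverse_system_sections :
  [set (tofrac g : K) | g in inverse_system l k] =
  global_sections (wonderful l) (fun E => ones_divisor l E + k * alpha_divisor l E).
Proof.
apply/seteqP; split.
  move=> _ [g hg <-]; rewrite /global_sections /= tofrac_eq0 => g0 E wE dE e oe.
  have [v dv] := dvr_exists_val dE.
  have g0' : tofrac g != 0 :> K by rewrite tofrac_eq0.
  (* Either [E] is a prime divisor meeting L, where the coefficient is 0 and [g] is regular, or some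
     polynomial has a pole and [E] belongs to some D_F. *)
  have [Eg|/existsNP [f nEf]] := pselect (forall g, E (tofrac g)).
    rewrite regular_coef // addr0; move/(has_orderE e dv g0'): oe => ->.
    exact: (dvr_valE dv g0').1.
  have E_const c : E (tofrac (sym_const L c)).
    by move: wE; rewrite wonderful_stage => wE; exact: (stage_const c _ wE).
  have [F [p [pF hp eE]]] := polar_dvr hl dv E_const wE nEf.
  rewrite eE in oe *; rewrite (boundary_coef pF (boundary_weight pF hp)).
  move/(weight_order e hp (proper_flat_neq0 pF) g0): oe => ->.
  by have := inverse_system_wsize hg pF hp g0; lia.
move=> f hf.
have [f0|f0] := eqVneq f 0.
  exists 0; last by rewrite f0 rmorph0.
  by move=> b _; exact: sym_act_r0.
have {}hf := hf f0.
(* The prime divisors of L survive all blow-ups with coefficient 0, so [f] has no pole on L and is a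
   polynomial. *)
have [P hP dP|g eg] := mpoly_regular (f := f : {fraction {mpoly C[\dim {:L}]}}) natC_inj.
  have [v dv] := dvr_exists_val dP.
  have Eg g : localization (range (@tofrac A)) P (tofrac g).
    apply: sub_localization; last by exists g.
      by rewrite -regular_proj_chart; exact: chart_subring.
    by case: hP => _ [].
  apply: (dvr_valE dv f0).2.
  have := hf _ (regular_wonderful hP dP) dP (v f).
  by rewrite regular_coef // addr0; apply; apply: (has_orderE _ dv f0).2.
exists g => //; apply: wsize_inverse_system => F p pF hp.
have g0 : g != 0 by rewrite -(tofrac_eq0 (g : A)); rewrite eg in f0.
have [v [_ dv]] := weight_dvr_is_dvr hp (proper_flat_neq0 pF).
have := hf _ (weight_wonderful pF hp) (dvr_val_dvr dv) (1 - (wsize p g)%:Z).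
rewrite (boundary_coef pF (boundary_weight pF hp)) eg => h.
have {h} := h ((weight_order _ hp (proper_flat_neq0 pF) g0).2 erefl); lia.
Qed.

End Sections.

(* Sym L^* is identified with the functions regular on L in the function field
   of W_L; in particular all global sections are asserted to lie in it. *)
Theorem corollary1p2 (R : realType) (L : vectType (complex R)) (n : nat)
    (l : 'I_n -> 'Hom(L, (complex R)^o))
    (hl : (\bigcap_(i < n) lker (l i))%VS = 0%VS) (k : int) :
  [set (tofrac g : rat_fun L) | g in inverse_system l k] =
  global_sections (wonderful l)
    (fun E => ones_divisor l E + k * alpha_divisor l E).
Proof.
apply: (inverse_system_sections hl) => i j /eqP.
by rewrite eqr_nat => /eqP.
Qed.
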